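(* The Whitham kernel $K$ can be expressed in the form $$K(x)=\int_{(0,\infty)}e^{-s|x|}\,d\mu(s),\qquad d\mu(s)=\frac1{2s}\,d(\psi_*\sigma)(s),\quad \psi(t)=\sqrt t,$$ where $\sigma$ is a Borel measure on $(0,\infty)$, $\psi_*\sigma$ is its pushforward by $\psi$, $\int_{(0,\infty)}\frac{d\sigma(t)}t<\infty$, and $\sigma$ is absolutely continuous (with respect to Lebesgue measure) with density $$\frac1\pi\sum_{n=1}^\infty\sqrt{\frac{|\tan\sqrt t|}{\sqrt t}}\;\chi_{\left(\left(\frac{(2n-1)\pi}2\right)^2,\,(n\pi)^2\right)}(t).$$ Thus $$K(x)=\frac1\pi\sum_{n=1}^\infty\int_{\frac{(2n-1)\pi}2}^{n\pi}e^{-s|x|}\sqrt{\frac{|\tan s|}s}\,ds,$$ and $K$ is completely monotone on $(0,\infty)$. In particular, it is positive, strictly decreasing and strictly convex for $x>0$.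
   Context: $m(\xi)=\sqrt{\tanh(\xi)/\xi}$ (with $m(0)=1$), and the Whitham kernel is $K=\mathcal F^{-1}m$, i.e. $K(x)=\frac1{2\pi}\int_{\mathbb R}m(\xi)e^{ix\xi}\,d\xi$, the inverse Fourier transform in the sense of tempered distributions; $K$ is regarded as an even function on $\mathbb R\setminus\{0\}$ (the integral converges conditionally for $x\neq0$), and is singular at the origin. $\chi_I$ denotes the characteristic function of $I$. A function $g\colon(0,\infty)\to\mathbb R$ is completely monotone if it is $C^\infty$ and $(-1)^ng^{(n)}(\lambda)\ge0$ for all integers $n\ge0$ and all $\lambda>0$. *)

(* Defs.v *)
From HB Require Import structures.
From mathcomp Require Import all_boot all_order all_algebra.
From mathcomp Require Import all_classical all_reals all_analysis.
From mathcomp Require Import complex.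

Set Implicit Arguments.
Unset Strict Implicit.
Unset Printing Implicit Defensive.

Import Order.TTheory GRing.Theory Num.Theory.
Import numFieldNormedType.Exports.

Local Open Scope classical_set_scope.
Local Open Scope complex_scope.
Local Open Scope ring_scope.

Section ComplexValued.
Context {R : realType}.
Implicit Types (D : set R) (f : R -> R[i]).

Definition cis (t : R) : R[i] := cos t +i* sin t.

Definition Cintegrable D f : Prop :=
  lebesgue_measure.-integrable D (fun x => (complex.Re (f x))%:E) /\
  lebesgue_measure.-integrable D (fun x => (complex.Im (f x))%:E).

Definition Cintegral D f : R[i] :=
  (\int[lebesgue_measure]_(x in D) complex.Re (f x)) +i*
  (\int[lebesgue_measure]_(x in D) complex.Im (f x)).

(* Convention: (F f)(xi) = \int f(x) e^{-i x xi} dx, so that F^{-1} carries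
   the factor 1 / (2 pi). *)
Definition fourier f (xi : R) : R[i] :=
  Cintegral setT (fun x => f x * cis (- (x * xi))).

Definition real_schwartz (g : R -> R) : Prop :=
  (forall (n : nat) (x : R), derivable (derive1n n g) x 1) /\
  (forall k n : nat, exists C : R, forall x : R,
     `|x| ^+ k * `|derive1n n g x| <= C).

Definition schwartz f : Prop :=
  real_schwartz (fun x => complex.Re (f x)) /\
  real_schwartz (fun x => complex.Im (f x)).

(* The function u is F^{-1} v in the sense of tempered distributions, i.e.
   F u = v, where <F u, phi> = <u, F phi> for every Schwartz function phi.
   The first clause makes the pairing with u well defined on the whole
   Schwartz space. *)
Definition tempered_inverse_fourier (u v : R -> R) : Prop :=
  (forall phi, schwartz phi -> Cintegrable setT (fun x => (u x)%:C * phi x)) /\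
  (forall phi, schwartz phi ->
     Cintegral setT (fun x => (u x)%:C * fourier phi x) =
     Cintegral setT (fun xi => (v xi)%:C * phi xi)).

End ComplexValued.

Section Whitham.
Context {R : realType}.

Definition tanh (x : R) : R := (expR x - expR (- x)) / (expR x + expR (- x)).

Definition whitham_symbol (xi : R) : R :=
  if xi == 0 then 1 else Num.sqrt (tanh xi / xi).

Definition truncated_kernel (a b x : R) : R[i] :=
  ((2 * pi)^-1)%:C *
  Cintegral `[- a, b] (fun xi => (whitham_symbol xi)%:C * cis (x * xi)).

(* The integral over the whole line converges only conditionally: it is the
   limit of the truncated ones as both ends go to infinity independently.
   The imaginary part tends to 0 because the symbol is even.  The value at x = 0, where there is no limit, is meaningless. *)
Definition whitham_kernel (x : R) : R :=
  lim ((fun ab : R * R => complex.Re (truncated_kernel ab.1 ab.2 x)) @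
       filter_prod (pinfty_nbhs R) (pinfty_nbhs R)).

Definition sigma_density (t : R) : \bar R :=
  ((pi^-1)%:E * \sum_(1 <= n <oo)
    (Num.sqrt (`|tan (Num.sqrt t)| / Num.sqrt t) *
     \1_(`] ((2 * n%:R - 1) * pi / 2) ^+ 2, (n%:R * pi) ^+ 2 [%classic : set R)
       t)%:E)%E.

End Whitham.

Section Monotonicity.
Context {R : realType}.

(* Complete monotonicity on (0, +oo).  Derivatives at x > 0 only depend on g
   near x, so the values of g on (-oo, 0] are irrelevant. *)
Definition completely_monotone (g : R -> R) : Prop :=
  forall (n : nat) (x : R), 0 < x ->
    derivable (derive1n n g) x 1 /\ 0 <= (-1) ^+ n * derive1n n g x.

Definition strictly_decreasing_pos (g : R -> R) : Prop :=
  forall x y : R, 0 < x -> x < y -> g y < g x.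

Definition strictly_convex_pos (g : R -> R) : Prop :=
  forall x y t : R, 0 < x -> 0 < y -> x != y -> 0 < t -> t < 1 ->
    g (t * x + (1 - t) * y) < t * g x + (1 - t) * g y.

End Monotonicity.

(* Main.v *)
(* Write the symbol as the square root of w(z) = tanh z / z.  On Re z > 0 this
   w avoids the closed negative half-line, so m = sqrt w is holomorphic there,
   and on the imaginary axis w(iv) = tan v / v; as Re z -> 0+, Im m(u + iv) tends
   to -sqrt(max(0, -tan v / v)), which lives exactly on the intervals
   ((2n-1) pi/2, n pi).  Cauchy's theorem on rectangles [a, b] x [0, n pi], where
   |m| is controlled by |cos v|^(-1/2) uniformly in u, rotates an integral of
   m k over the positive real axis into one over the imaginary axis.  With
   k(z) = e^{ixz} this yields the convergence of the truncated integrals and the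
   Laplace representation of the kernel.  With k(z) = 1 / (e + i eta - iz) and
   e -> 0+, the Poisson kernel recovers m(eta) as a Stieltjes integral of the same
   density, which by Fubini is the Fourier transform of that Laplace integral.
   Monotonicity follows by differentiating under the integral, and the measures
   are obtained from the substitution t = s^2. *)

Require Import Defs.
From HB Require Import structures.
From mathcomp Require Import all_boot all_order all_algebra.
From mathcomp Require Import all_classical all_reals all_analysis.
From mathcomp Require Import complex measurable_realfun.
From mathcomp Require Import ring lra.

Set Implicit Arguments.
Unset Strict Implicit.
Unset Printing Implicit Defensive.

Import Order.TTheory GRing.Theory Num.Theory.
Import numFieldNormedType.Exports.

Local Open Scope classical_set_scope.
Local Open Scope ring_scope.

(** The symbol decays like |xi|^(-1/2), so it is not integrable. The kernel is therefore shown to be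
    integrable itself and its Fourier transform is computed, after which Fubini gives the pairing
    with Schwartz functions. The obstacle on the imaginary axis is that m blows up at every zero of
    cos. Contours stay in Re z > 0, and the limits onto the axis and to infinity are dominated by
    one function of v: |z| >= v bounds |m| by (|cos v| v)^(-1/2), and the decay 1 / (1 + v) required
    of k makes the integrals over successive intervals of length pi/2 summable. The top edge sits at
    height n pi because |cos| = 1 there. Cauchy's theorem enters in one real component, as Green's
    formula for two real functions with a common partial derivative; a constant factor in the kernel
    selects the component. The boundary values of m also involve the positive part of tan v / v. It
    drops out of the cosine integral by the choice of component, and out of the Poisson integral by
    adding the poles belonging to eta and -eta. *)

Local Notation Re := complex.Re.
Local Notation Im := complex.Im.
Local Notation normc := Normc.normc.

(** * Complex functions by real and imaginary parts: derivatives, exponential, square root,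
    limits *)

Section ComplexCalculus.
Context {R : realType}.
Local Open Scope complex_scope.
Local Notation C := (R[i]).
Implicit Types (f g : R -> C) (t : R) (a b z : C).

Lemma Re_mulc a b : Re (a * b) = Re a * Re b - Im a * Im b.
Proof. by case: a b => [? ?] [? ?]. Qed.

Lemma Im_mulc a b : Im (a * b) = Re a * Im b + Im a * Re b.
Proof. by case: a b => [? ?] [? ?]. Qed.

Lemma Re_addc a b : Re (a + b) = Re a + Re b.
Proof. by case: a b => [? ?] [? ?]. Qed.

Lemma Im_addc a b : Im (a + b) = Im a + Im b.
Proof. by case: a b => [? ?] [? ?]. Qed.

Lemma Re_oppc a : Re (- a) = - Re a.
Proof. by case: a. Qed.

Lemma Im_oppc a : Im (- a) = - Im a.
Proof. by case: a. Qed.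

Lemma Re_invc a : Re a^-1 = Re a / (Re a ^+ 2 + Im a ^+ 2).
Proof. by case: a. Qed.

Lemma Im_invc a : Im a^-1 = - Im a / (Re a ^+ 2 + Im a ^+ 2).
Proof. by case: a => x y /=; rewrite mulNr. Qed.

Lemma normc_ReIm a : normc a = Num.sqrt (Re a ^+ 2 + Im a ^+ 2).
Proof. by case: a. Qed.

Lemma normc_sqr a : normc a ^+ 2 = Re a ^+ 2 + Im a ^+ 2.
Proof. by rewrite normc_ReIm sqr_sqrtr// addr_ge0// sqr_ge0. Qed.

Lemma normc_ge0 a : 0 <= normc a.
Proof. by rewrite normc_ReIm sqrtr_ge0. Qed.

Lemma normc_gt0 a : (0 < normc a) = (a != 0).
Proof.
rewrite lt_def normc_ge0 andbT; congr (~~ _).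
by apply/eqP/eqP => [/Normc.eq0_normc//|->]; rewrite Normc.normc0.
Qed.

Lemma normr_Re_le a : `|Re a| <= normc a.
Proof.
rewrite normc_ReIm -sqrtr_sqr ler_wsqrtr// lerDl; exact: sqr_ge0.
Qed.

Lemma normr_Im_le a : `|Im a| <= normc a.
Proof.
rewrite normc_ReIm -sqrtr_sqr ler_wsqrtr// lerDr; exact: sqr_ge0.
Qed.

Lemma normc_real (x : R) : normc x%:C = `|x|.
Proof. by rewrite normc_ReIm/= expr0n addr0 sqrtr_sqr. Qed.

(** Differentiation along a real parameter. Holomorphy enters only through the chain rule along
    curves; taken on horizontal and vertical segments it contains the Cauchy-Riemann equations. *)
Definition Cderive f t a :=
  is_derive t 1 (fun s => Re (f s)) (Re a) /\
  is_derive t 1 (fun s => Im (f s)) (Im a).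

Lemma Cderive_eq f t a b : Cderive f t a -> a = b -> Cderive f t b.
Proof. by move=> + <-. Qed.

Lemma Cderive_cst a t : Cderive (fun=> a) t 0.
Proof. by split; exact: is_derive_cst. Qed.

Lemma CderiveD f g t a b : Cderive f t a -> Cderive g t b ->
  Cderive (fun s => f s + g s) t (a + b).
Proof.
move=> [f1 f2] [g1 g2]; split.
  under eq_fun do rewrite Re_addc.
  by rewrite Re_addc; exact: is_deriveD.
under eq_fun do rewrite Im_addc.
by rewrite Im_addc; exact: is_deriveD.
Qed.

Lemma CderiveM f g t a b : Cderive f t a -> Cderive g t b ->
  Cderive (fun s => f s * g s) t (a * g t + f t * b).
Proof.
move=> [f1 f2] [g1 g2]; split.
  under eq_fun do rewrite Re_mulc.
  have := is_deriveB (is_deriveM f1 g1) (is_deriveM f2 g2).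
  move/is_derive_eq; apply.
  by rewrite Re_addc !Re_mulc /GRing.scale/=; ring.
under eq_fun do rewrite Im_mulc.
have := is_deriveD (is_deriveM f1 g2) (is_deriveM f2 g1).
move/is_derive_eq; apply.
by rewrite Im_addc !Im_mulc /GRing.scale/=; ring.
Qed.

Lemma sqr_normc_gt0 a : (0 < Re a ^+ 2 + Im a ^+ 2) = (a != 0).
Proof. by rewrite -normc_sqr exprn_even_gt0//= -normc_gt0 lt_def normc_ge0 andbT. Qed.

Lemma CderiveV f t a : f t != 0 -> Cderive f t a ->
  Cderive (fun s => (f s)^-1) t (- a / f t ^+ 2).
Proof.
move=> ft0 [f1 f2].
have n0 : Re (f t) ^+ 2 + Im (f t) ^+ 2 != 0.
  by rewrite gt_eqF// sqr_normc_gt0.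
have fE : - a / f t ^+ 2 = - a * (f t)^-1 * (f t)^-1.
  by rewrite expr2 invfM mulrA.
have dn := is_deriveD (is_deriveX 2 f1) (is_deriveX 2 f2).
have dV := @is_deriveV _ (fun s => Re (f s) ^+ 2 + Im (f s) ^+ 2) _ _ _ n0 dn.
split.
  under eq_fun do rewrite Re_invc.
  have := is_deriveM f1 dV.
  move/is_derive_eq; apply.
  rewrite fE !(Re_mulc, Im_mulc, Re_oppc, Im_oppc, Re_invc, Im_invc) /GRing.scale/=.
  by field.
under eq_fun do rewrite Im_invc.
have := is_deriveM (is_deriveN f2) dV.
move/is_derive_eq; apply.
rewrite fE !(Re_mulc, Im_mulc, Re_oppc, Im_oppc, Re_invc, Im_invc) /GRing.scale/=.
change ((- (fun s : R => Im (f s))) t) with (- Im (f t)).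
by field.
Qed.

Definition cexp z : C := (expR (Re z))%:C * cis (Im z).

Lemma Re_cexp z : Re (cexp z) = expR (Re z) * cos (Im z).
Proof. by rewrite Re_mulc/= mul0r subr0. Qed.

Lemma Im_cexp z : Im (cexp z) = expR (Re z) * sin (Im z).
Proof. by rewrite Im_mulc/= mul0r addr0. Qed.

Lemma normc_cexp z : normc (cexp z) = expR (Re z).
Proof.
rewrite normc_ReIm Re_cexp Im_cexp !exprMn -mulrDr cos2Dsin2 mulr1.
by rewrite sqrtr_sqr ger0_norm// expR_ge0.
Qed.

Lemma Cderive_exp f t a : Cderive f t a ->
  Cderive (fun s => cexp (f s)) t (a * cexp (f t)).
Proof.
move=> [f1 f2].
have e1 := is_derive1_comp (is_derive_expR (Re (f t))) f1.
have c1 := is_derive1_comp (is_derive_cos (Im (f t))) f2.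
have s1 := is_derive1_comp (is_derive_sin (Im (f t))) f2.
split.
  under eq_fun do rewrite Re_cexp.
  have := is_deriveM e1 c1.
  move/is_derive_eq; apply.
  by rewrite Re_mulc Re_cexp Im_cexp /GRing.scale/=; ring.
under eq_fun do rewrite Im_cexp.
have := is_deriveM e1 s1.
move/is_derive_eq; apply.
by rewrite Im_mulc Re_cexp Im_cexp /GRing.scale/=; ring.
Qed.

(* Principal square root, off the closed negative half-line: there
   [normc z + Re z = 0] and the value is junk. *)
Definition csqrt z : C :=
  Num.sqrt ((normc z + Re z) / 2) +i*
  (Im z / (2 * Num.sqrt ((normc z + Re z) / 2))).

Lemma Re_csqrt z : Re (csqrt z) = Num.sqrt ((normc z + Re z) / 2).
Proof. by []. Qed.

Lemma Im_csqrt z :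
  Im (csqrt z) = Im z / (2 * Num.sqrt ((normc z + Re z) / 2)).
Proof. by []. Qed.

Lemma csqrt_sqr z : 0 < normc z + Re z -> csqrt z ^+ 2 = z.
Proof.
move=> z0; have p0 : 0 < (normc z + Re z) / 2 by rewrite divr_gt0.
set p := Num.sqrt ((normc z + Re z) / 2).
have pp : p ^+ 2 = (normc z + Re z) / 2 by rewrite sqr_sqrtr// ltW.
have pn0 : p != 0 by rewrite gt_eqF// sqrtr_gt0.
have e : Im z ^+ 2 = (normc z + Re z) * (normc z - Re z).
  by rewrite mulrC -subr_sqr normc_sqr addrC addKr.
apply/eqP; rewrite eq_complex expr2 Re_mulc Im_mulc/= -/p -!expr2 expr_div_n exprMn pp e.
apply/andP; split; apply/eqP; last by field.
by field; rewrite gt_eqF.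
Qed.

Lemma normc_csqrt z : 0 < normc z + Re z -> normc (csqrt z) = Num.sqrt (normc z).
Proof.
move=> z0; rewrite -[in RHS](csqrt_sqr z0) expr2 Normc.normcM -expr2 sqrtr_sqr.
by rewrite ger0_norm// normc_ge0.
Qed.

Lemma csqrt_real (x : R) : 0 <= x -> csqrt x%:C = (Num.sqrt x)%:C.
Proof.
move=> x0; rewrite /csqrt normc_real/= ger0_norm// mul0r.
by congr (Num.sqrt _ +i* _); field.
Qed.

Lemma Cderive_sqrt f t a : 0 < normc (f t) + Re (f t) -> Cderive f t a ->
  Cderive (fun s => csqrt (f s)) t (a / (2 * csqrt (f t))).
Proof.
move=> z0 [f1 f2].
have p0 : 0 < (normc (f t) + Re (f t)) / 2 by rewrite divr_gt0.
have fn0 : f t != 0.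
  by apply: contraTneq z0 => ->; rewrite Normc.normc0/= addr0 ltxx.
have n0 : 0 < Re (f t) ^+ 2 + Im (f t) ^+ 2 by rewrite sqr_normc_gt0.
have dn := is_deriveD (is_deriveX 2 f1) (is_deriveX 2 f2).
have dr : is_derive t 1 (fun s => normc (f s))
    ((Re (f t) * Re a + Im (f t) * Im a) / normc (f t)).
  under eq_fun do rewrite normc_ReIm.
  have := @is_derive1_comp _ Num.sqrt
    (fun s => Re (f s) ^+ 2 + Im (f s) ^+ 2) _ _ _ (is_derive1_sqrt n0) dn.
  move/is_derive_eq; apply.
  rewrite normc_ReIm /GRing.scale/= !expr1; field.
  by rewrite sqrtr_eq0 -ltNge.
have dp : is_derive t 1 (fun s => Num.sqrt ((normc (f s) + Re (f s)) / 2))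
   (((Re (f t) * Re a + Im (f t) * Im a) / normc (f t) + Re a) / 4 /
     Num.sqrt ((normc (f t) + Re (f t)) / 2)).
  have h : is_derive t 1 (fun s => (normc (f s) + Re (f s)) / 2)
     (((Re (f t) * Re a + Im (f t) * Im a) / normc (f t) + Re a) / 2).
    rewrite (_ : (fun s => _) = 2^-1 \*: (fun s => normc (f s) + Re (f s))).
      apply: (is_derive_eq (is_deriveZ 2^-1 (is_deriveD dr f1))).
      by rewrite /GRing.scale/= mulrC.
    by apply/funext => s; rewrite /GRing.scale/= mulrC.
  have := @is_derive1_comp _ Num.sqrt
    (fun s => (normc (f s) + Re (f s)) / 2) _ _ _ (is_derive1_sqrt p0) h.
  move/is_derive_eq; apply; field.
  by rewrite sqrtr_eq0 -ltNge p0 gt_eqF// normc_gt0.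
set p := Num.sqrt _ in dp.
have pn0 : p != 0 by rewrite gt_eqF// sqrtr_gt0.
have dV := @is_deriveV _ (fun s => 2 * Num.sqrt ((normc (f s) + Re (f s)) / 2))
  _ _ _ (mulf_neq0 (negbT (pnatr_eq0 R 2)) pn0) (is_deriveZ 2 dp).
have rn0 : normc (f t) != 0 by rewrite gt_eqF// normc_gt0.
have pp : p ^+ 2 = (normc (f t) + Re (f t)) / 2 by rewrite sqr_sqrtr// ltW.
(* [e] and [e2] eliminate the modulus and the square of the imaginary part in favour of [p] and
   [Re (f t)], so that both components of the derivative become rational identities. *)
have e : normc (f t) = p ^+ 2 * 2 - Re (f t).
  by rewrite pp; field.
have e2 : Im (f t) ^+ 2 = 4 * p ^+ 2 * (p ^+ 2 - Re (f t)).
  have : Im (f t) ^+ 2 = normc (f t) ^+ 2 - Re (f t) ^+ 2.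
    by rewrite normc_sqr addrC addKr.
  by rewrite e => ->; ring.
have key : csqrt (f t) = p +i* (Im (f t) / (2 * p)) by [].
have d0 : p ^+ 2 + (Im (f t) / (2 * p)) ^+ 2 = normc (f t).
  by rewrite expr_div_n e2 e; field.
have sV : (2 * csqrt (f t))^-1 =
    (p / (2 * normc (f t))) +i* (- (Im (f t) / (2 * p)) / (2 * normc (f t))).
  apply/eqP; rewrite eq_complex Re_invc Im_invc -mulr_natl !(Re_mulc, Im_mulc) key/=.
  rewrite !(mul0r, mulr0, mulr1, addr0, subr0).
  have -> : ((1 + 1) * p) ^+ 2 + ((1 + 1) * (Im (f t) / (2 * p))) ^+ 2 =
      4 * normc (f t) by rewrite -d0; ring.
  by apply/andP; split; apply/eqP; field; rewrite ?pn0 rn0.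
have sn0 : p ^+ 2 * 2 - Re (f t) != 0 by rewrite -e.
rewrite sV; split.
  apply: (is_derive_eq dp); rewrite Re_mulc/= e.
  by field; rewrite pn0 sn0.
have := is_deriveM f2 dV.
move/is_derive_eq; apply.
rewrite Im_mulc/= /GRing.scale/= -/p.
have h (x y : R) : (x - y) * (8 * p ^+ 3 * normc (f t)) = 0 -> x = y.
  have c0 : 8 * p ^+ 3 * normc (f t) != 0.
    by rewrite mulf_neq0// mulf_neq0 ?expf_neq0// pnatr_eq0.
  by move=> /eqP; rewrite mulf_eq0 subr_eq0 (negbTE c0) orbF => /eqP.
apply: h.
(* With denominators cleared, the difference is a combination of two expressions that vanish by [e]
   and by [e2]. *)
transitivity ((4 * p ^+ 2 * (normc (f t) + Re (f t) - 2 * p ^+ 2) -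
  (Im (f t) ^+ 2 - 4 * p ^+ 2 * (p ^+ 2 - Re (f t)))) * Im a -
  Im (f t) * Re a * (Re (f t) + normc (f t) - 2 * p ^+ 2)).
  by field; rewrite pn0 rn0.
by rewrite e e2; ring.
Qed.

Section Limits.
Context {T : Type} (F : set_system T) {FF : Filter F}.

(** An arbitrary filter on an arbitrary type, so that the same rules serve one-sided limits at the
    imaginary axis and continuity in one or two real variables. *)
Definition Ccvg (h : T -> C) a :=
  (Re (h x) @[x --> F] --> Re a) /\ (Im (h x) @[x --> F] --> Im a).

Implicit Types h k : T -> C.

Lemma cvg_continuous (h : T -> R) (p : R -> R) (l : R) :
  continuous p -> h x @[x --> F] --> l -> p (h x) @[x --> F] --> p l.
Proof. by move=> cp hl; apply: continuous_cvg => //; exact: cp. Qed.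

Lemma Ccvg_cst a : Ccvg (fun=> a) a.
Proof. by split; exact: cvg_cst. Qed.

Lemma CcvgD h k a b : Ccvg h a -> Ccvg k b -> Ccvg (fun x => h x + k x) (a + b).
Proof.
move=> [h1 h2] [k1 k2]; split.
  by under eq_fun do rewrite Re_addc; rewrite Re_addc; exact: cvgD.
by under eq_fun do rewrite Im_addc; rewrite Im_addc; exact: cvgD.
Qed.

Lemma CcvgM h k a b : Ccvg h a -> Ccvg k b -> Ccvg (fun x => h x * k x) (a * b).
Proof.
move=> [h1 h2] [k1 k2]; split.
  by under eq_fun do rewrite Re_mulc; rewrite Re_mulc; apply: cvgB; exact: cvgM.
by under eq_fun do rewrite Im_mulc; rewrite Im_mulc; apply: cvgD; exact: cvgM.
Qed.

Lemma CcvgN h a : Ccvg h a -> Ccvg (fun x => - h x) (- a).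
Proof.
move=> [h1 h2]; split.
  by under eq_fun do rewrite Re_oppc; rewrite Re_oppc; exact: cvgN.
by under eq_fun do rewrite Im_oppc; rewrite Im_oppc; exact: cvgN.
Qed.

Lemma cvg_sqr_normc h a : Ccvg h a ->
  Re (h x) ^+ 2 + Im (h x) ^+ 2 @[x --> F] --> Re a ^+ 2 + Im a ^+ 2.
Proof. by move=> [h1 h2]; apply: cvgD; rewrite !expr2; under eq_fun do rewrite expr2; exact: cvgM. Qed.

Lemma CcvgV h a : a != 0 -> Ccvg h a -> Ccvg (fun x => (h x)^-1) a^-1.
Proof.
move=> a0 H; have [h1 h2] := H.
have n0 : Re a ^+ 2 + Im a ^+ 2 != 0 by rewrite gt_eqF// sqr_normc_gt0.
have nV : (Re (h x) ^+ 2 + Im (h x) ^+ 2)^-1 @[x --> F] -->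
  (Re a ^+ 2 + Im a ^+ 2)^-1 by apply: cvgV => //; exact: cvg_sqr_normc.
split.
  by under eq_fun do rewrite Re_invc; rewrite Re_invc; exact: cvgM.
under eq_fun do rewrite Im_invc; rewrite Im_invc; apply: cvgM => //; exact: cvgN.
Qed.

Lemma cvg_normc h a : Ccvg h a -> normc (h x) @[x --> F] --> normc a.
Proof.
move=> H; under eq_fun do rewrite normc_ReIm; rewrite normc_ReIm.
apply: (@cvg_continuous _ Num.sqrt); [exact: sqrt_continuous|exact: cvg_sqr_normc].
Qed.

Lemma Ccvg_exp h a : Ccvg h a -> Ccvg (fun x => cexp (h x)) (cexp a).
Proof.
move=> [h1 h2]; split.
  under eq_fun do rewrite Re_cexp; rewrite Re_cexp; apply: cvgM.
    by apply: (@cvg_continuous _ expR _ _ h1); exact: continuous_expR.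
  by apply: (@cvg_continuous _ cos _ _ h2); exact: continuous_cos.
under eq_fun do rewrite Im_cexp; rewrite Im_cexp; apply: cvgM.
  by apply: (@cvg_continuous _ expR _ _ h1); exact: continuous_expR.
by apply: (@cvg_continuous _ sin _ _ h2); exact: continuous_sin.
Qed.

Lemma Ccvg_sqrt h a : 0 < normc a + Re a -> Ccvg h a ->
  Ccvg (fun x => csqrt (h x)) (csqrt a).
Proof.
move=> a0 H; have p0 : 0 < (normc a + Re a) / 2 by rewrite divr_gt0.
have p1 : Num.sqrt ((normc (h x) + Re (h x)) / 2) @[x --> F] -->
    Num.sqrt ((normc a + Re a) / 2).
  apply: (@cvg_continuous _ Num.sqrt); first exact: sqrt_continuous.
  apply: cvgM; last exact: cvg_cst.
  by apply: cvgD; [exact: cvg_normc|exact: H.1].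
split => //=; apply: cvgM; first exact: H.2.
apply: cvgV; first by rewrite mulf_neq0// gt_eqF// sqrtr_gt0.
by apply: cvgM => //; exact: cvg_cst.
Qed.

End Limits.

End ComplexCalculus.

(** * The symbol on the right half-plane and its boundary values on the imaginary axis *)

Section Symbol.
Context {R : realType}.
Local Open Scope complex_scope.
Local Notation C := (R[i]).
Implicit Types (u v t : R) (z a : C).

(* [wsym z = tanh z / z]; the symbol is its square root. *)
Definition wsym z : C := (cexp (2 * z) - 1) / ((cexp (2 * z) + 1) * z).

(** The quotient rule for [wsym], kept explicit because Green's formula needs the derivative to be
    jointly continuous. *)
Definition wsym' z : C :=
  2 * cexp (2 * z) / ((cexp (2 * z) + 1) * z) -
  (cexp (2 * z) - 1) * (2 * cexp (2 * z) * z + (cexp (2 * z) + 1)) /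
    ((cexp (2 * z) + 1) * z) ^+ 2.

Definition msym z : C := csqrt (wsym z).

Definition msym' z : C := wsym' z / (2 * msym z).

Lemma Re_dbl z : Re (2 * z) = 2 * Re z.
Proof. by case: z => x y /=; ring. Qed.

Lemma Im_dbl z : Im (2 * z) = 2 * Im z.
Proof. by case: z => x y /=; ring. Qed.

(** The poles of tanh lie on the imaginary axis, since |e^(2z)| > 1 to the right of it. *)
Lemma cexpD1_neq0 z : 0 < Re z -> cexp (2 * z) + 1 != 0.
Proof.
move=> z0; apply/eqP => /eqP; rewrite addr_eq0 => /eqP.
have : 1 < expR (2 * Re z) by rewrite expR_gt1 mulr_gt0.
move=> + /(congr1 (@Normc.normc R)); rewrite normc_cexp Re_dbl normc_ReIm/= => + e.
by rewrite e oppr0 expr0n addr0 sqrrN expr1n sqrtr1 ltxx.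
Qed.

Lemma Re_gt0_neq0 z : 0 < Re z -> z != 0.
Proof. by apply: contraTneq => ->; rewrite ltxx. Qed.

Lemma normcDRe_gt0 z : (Im z = 0 -> 0 < Re z) -> 0 < normc z + Re z.
Proof.
move=> H; have [//|z0] := ltP 0 (normc z + Re z).
have : `|Re z| <= normc z := normr_Re_le z.
have [r0|r0] := leP 0 (Re z) => rn.
  have n0 : normc z = 0 by have := normc_ge0 z; lra.
  by have := H _; rewrite (Normc.eq0_normc n0) /= => /(_ erefl); rewrite ltxx.
have e : normc z = - Re z by move: rn; rewrite ltr0_norm// => rn; lra.
have := normc_sqr z; rewrite e sqrrN => /eqP.
rewrite eq_sym -subr_eq0 addrC addKr sqrf_eq0 => /eqP /H; lra.
Qed.

(** Multiplication by the conjugate of the denominator makes the denominator real; the only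
    transcendental quantities left in the numerators are X and sin (2 Im z), and their signs can be
    read off. *)
Lemma wsym_num z (X := expR (2 * Re z)) (d := (cexp (2 * z) + 1) * z) :
  d != 0 ->
  Re (wsym z) = ((X ^+ 2 - 1) * Re z + 2 * X * Im z * sin (2 * Im z)) /
    normc d ^+ 2 /\
  Im (wsym z) = (2 * X * Re z * sin (2 * Im z) - (X ^+ 2 - 1) * Im z) /
    normc d ^+ 2.
Proof.
move=> d0; have n0 : normc d ^+ 2 != 0 by rewrite expf_neq0// gt_eqF// normc_gt0.
rewrite /wsym -/d Re_mulc Im_mulc Re_invc Im_invc -normc_sqr.
have cs := cos2Dsin2 (2 * Im z).
split.
  transitivity ((Re (cexp (2 * z) - 1) * Re d + Im (cexp (2 * z) - 1) * Im d) /
    normc d ^+ 2); first by rewrite mulrA mulNr mulrN opprK mulrA -mulrDl.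
  congr (_ / _).
  rewrite /d Re_mulc Im_mulc !Re_addc !Im_addc Re_oppc Im_oppc Re_cexp Im_cexp Re_dbl Im_dbl -/X/=.
  transitivity ((X ^+ 2 * (cos (2 * Im z) ^+ 2 + sin (2 * Im z) ^+ 2) - 1) * Re z
    + 2 * X * Im z * sin (2 * Im z)); first by ring.
  by rewrite cs mulr1.
transitivity ((Im (cexp (2 * z) - 1) * Re d - Re (cexp (2 * z) - 1) * Im d) /
  normc d ^+ 2); first by rewrite mulNr mulrN !mulrA -mulNr -mulrDl addrC.
congr (_ / _).
rewrite /d Re_mulc Im_mulc !Re_addc !Im_addc Re_oppc Im_oppc Re_cexp Im_cexp Re_dbl Im_dbl -/X/=.
transitivity (2 * X * Re z * sin (2 * Im z) -
  (X ^+ 2 * (cos (2 * Im z) ^+ 2 + sin (2 * Im z) ^+ 2) - 1) * Im z); first by ring.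
by rewrite cs mulr1.
Qed.

(** Only the points where w is real matter. There the vanishing numerator of Im w turns Re z times
    the numerator of Re w into (X^2 - 1) |z|^2 > 0, so w is positive. *)
Lemma wsym_slit z : 0 < Re z -> 0 < normc (wsym z) + Re (wsym z).
Proof.
move=> z0; apply: normcDRe_gt0.
have d0 : (cexp (2 * z) + 1) * z != 0.
  by rewrite mulf_neq0 ?cexpD1_neq0 ?Re_gt0_neq0.
have [-> ->] := wsym_num d0.
have n0 : 0 < normc ((cexp (2 * z) + 1) * z) ^+ 2.
  by rewrite exprn_gt0// normc_gt0.
set X := expR _.
have X1 : 1 < X by rewrite expR_gt1 mulr_gt0.
have X2 : 0 < X ^+ 2 - 1 by rewrite subr_gt0 exprn_egt1.
move/eqP; rewrite mulf_eq0 invr_eq0 (gt_eqF n0) orbF subr_eq0 => /eqP e.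
rewrite divr_gt0//.
rewrite -(pmulr_rgt0 _ z0).
have -> : Re z * ((X ^+ 2 - 1) * Re z + 2 * X * Im z * sin (2 * Im z)) =
  (X ^+ 2 - 1) * Re z ^+ 2 + Im z * (2 * X * Re z * sin (2 * Im z)) by ring.
rewrite e.
have -> : (X ^+ 2 - 1) * Re z ^+ 2 + Im z * ((X ^+ 2 - 1) * Im z) =
  (X ^+ 2 - 1) * (Re z ^+ 2 + Im z ^+ 2) by ring.
by rewrite mulr_gt0// sqr_normc_gt0 Re_gt0_neq0.
Qed.

Lemma msym_neq0 z : 0 < Re z -> msym z != 0.
Proof.
move=> z0; apply: Re_gt0_neq0.
by rewrite /msym Re_csqrt sqrtr_gt0 divr_gt0// wsym_slit.
Qed.

(** This is |tanh z| <= 1 / |c| with c = cos (Im z), whatever Re z is: |e^(2z) + 1|^2 - c^2 |e^(2z)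
    - 1|^2 equals (1 - c^2) (X - 1)^2 + 4 X c^4, a sum of nonnegative terms. *)
Lemma normc_wsym_le z : 0 <= Re z -> z != 0 -> cos (Im z) != 0 ->
  normc (wsym z) <= (`|cos (Im z)| * normc z)^-1.
Proof.
move=> z0 zn0 cz; set c := cos (Im z) in cz *.
have nz0 : 0 < normc z by rewrite normc_gt0.
have c0 : 0 < `|c| by rewrite normr_gt0.
rewrite /wsym Normc.normcM Normc.normcV Normc.normcM !invfM mulrA.
rewrite ler_pM2r ?invr_gt0//.
set X := expR (2 * Re z).
have X1 : 1 <= X by rewrite -expR0 ler_expR mulr_ge0.
have c1 : c ^+ 2 <= 1 by rewrite -real_normK ?num_real// exprn_ile1// cos_max.
have cE : cos (2 * Im z) = 2 * c ^+ 2 - 1.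
  by rewrite mulr_natl cos_mulr2n -mulr_natl.
have cs := cos2Dsin2 (2 * Im z).
have e1 : normc (cexp (2 * z) - 1) ^+ 2 = X ^+ 2 - 2 * X * (2 * c ^+ 2 - 1) + 1.
  rewrite normc_sqr Re_addc Im_addc Re_oppc Im_oppc Re_cexp Im_cexp Re_dbl Im_dbl -/X/= -cE.
  transitivity (X ^+ 2 * (cos (2 * Im z) ^+ 2 + sin (2 * Im z) ^+ 2) -
    2 * X * cos (2 * Im z) + 1); first by ring.
  by rewrite cs mulr1.
have e2 : normc (cexp (2 * z) + 1) ^+ 2 = X ^+ 2 + 2 * X * (2 * c ^+ 2 - 1) + 1.
  rewrite normc_sqr Re_addc Im_addc Re_cexp Im_cexp Re_dbl Im_dbl -/X/= -cE.
  transitivity (X ^+ 2 * (cos (2 * Im z) ^+ 2 + sin (2 * Im z) ^+ 2) +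
    2 * X * cos (2 * Im z) + 1); first by ring.
  by rewrite cs mulr1.
have cp : 0 < c ^+ 2 by rewrite exprn_even_gt0.
have key : c ^+ 2 * normc (cexp (2 * z) - 1) ^+ 2 <= normc (cexp (2 * z) + 1) ^+ 2.
  rewrite e1 e2 -subr_ge0.
  have -> : X ^+ 2 + 2 * X * (2 * c ^+ 2 - 1) + 1 -
    c ^+ 2 * (X ^+ 2 - 2 * X * (2 * c ^+ 2 - 1) + 1) =
    (1 - c ^+ 2) * (X - 1) ^+ 2 + 4 * X * (c ^+ 2) ^+ 2 by ring.
  rewrite addr_ge0// mulr_ge0// ?sqr_ge0 ?subr_ge0//; lra.
have d0 : 0 < normc (cexp (2 * z) + 1).
  rewrite lt_def normc_ge0 andbT -sqrf_eq0 e2.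
  have -> : X ^+ 2 + 2 * X * (2 * c ^+ 2 - 1) + 1 =
    (X - 1) ^+ 2 + 4 * X * c ^+ 2 by ring.
  by rewrite gt_eqF// ltr_wpDl ?sqr_ge0// mulr_gt0//; lra.
rewrite ler_pdivrMr// [leRHS]mulrC ler_pdivlMr//.
rewrite -(@ler_pXn2r _ 2) ?nnegrE ?mulr_ge0 ?normc_ge0//.
by rewrite exprMn real_normK ?num_real// mulrC.
Qed.

Lemma normc_msym_le z : 0 < Re z -> cos (Im z) != 0 ->
  normc (msym z) <= Num.sqrt (`|cos (Im z)| * normc z)^-1.
Proof.
move=> z0 cz; rewrite normc_csqrt ?wsym_slit// ler_wsqrtr//.
by rewrite normc_wsym_le ?Re_gt0_neq0// ltW.
Qed.

Lemma Cderive_wsym (g : R -> C) t a : 0 < Re (g t) -> Cderive g t a ->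
  Cderive (fun s => wsym (g s)) t (a * wsym' (g t)).
Proof.
move=> g0 dg.
have dE : Cderive (fun s => cexp (2 * g s)) t (2 * a * cexp (2 * g t)).
  apply: Cderive_exp; apply: (Cderive_eq (CderiveM (Cderive_cst 2 t) dg)).
  by rewrite mul0r add0r.
have dd : Cderive (fun s => (cexp (2 * g s) + 1) * g s) t
    (2 * a * cexp (2 * g t) * g t + (cexp (2 * g t) + 1) * a).
  apply: (Cderive_eq (CderiveM (CderiveD dE (Cderive_cst 1 t)) dg)).
  by rewrite addr0.
have dn : Cderive (fun s => cexp (2 * g s) - 1) t (2 * a * cexp (2 * g t)).
  by apply: (Cderive_eq (CderiveD dE (Cderive_cst (-1) t))); rewrite addr0.
have E0 := cexpD1_neq0 g0; have z0 := Re_gt0_neq0 g0.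
apply: (Cderive_eq (CderiveM dn (CderiveV _ dd))); first by rewrite mulf_neq0.
by rewrite /wsym'; field; rewrite E0 z0.
Qed.

Lemma Cderive_msym (g : R -> C) t a : 0 < Re (g t) -> Cderive g t a ->
  Cderive (fun s => msym (g s)) t (a * msym' (g t)).
Proof.
move=> g0 dg.
apply: (Cderive_eq (Cderive_sqrt (wsym_slit g0) (Cderive_wsym g0 dg))).
by rewrite /msym' mulrA.
Qed.

Section SymbolLimits.
Context {T : Type} (F : set_system T) {FF : Filter F}.

Lemma Ccvg_cexp_dbl (h : T -> C) a : Ccvg F h a ->
  Ccvg F (fun x => cexp (2 * h x)) (cexp (2 * a)).
Proof. by move=> ha; apply: Ccvg_exp; apply: CcvgM => //; exact: Ccvg_cst. Qed.

Lemma Ccvg_wsym (h : T -> C) a : a != 0 -> cexp (2 * a) + 1 != 0 ->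
  Ccvg F h a -> Ccvg F (fun x => wsym (h x)) (wsym a).
Proof.
move=> a0 E0 ha; have hE := Ccvg_cexp_dbl ha.
apply: CcvgM; first by apply: CcvgD => //; exact: Ccvg_cst.
apply: CcvgV; first by rewrite mulf_neq0.
by apply: CcvgM => //; apply: CcvgD => //; exact: Ccvg_cst.
Qed.

Lemma Ccvg_msym (h : T -> C) a : 0 < Re a ->
  Ccvg F h a -> Ccvg F (fun x => msym (h x)) (msym a).
Proof.
move=> a0 ha; apply: Ccvg_sqrt; first exact: wsym_slit.
by apply: Ccvg_wsym => //; [exact: Re_gt0_neq0|exact: cexpD1_neq0].
Qed.

Lemma Ccvg_msym' (h : T -> C) a : 0 < Re a ->
  Ccvg F h a -> Ccvg F (fun x => msym' (h x)) (msym' a).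
Proof.
move=> a0 ha; have hE := Ccvg_cexp_dbl ha.
have E0 := cexpD1_neq0 a0; have z0 := Re_gt0_neq0 a0.
have hE1 : Ccvg F (fun x => cexp (2 * h x) + 1) (cexp (2 * a) + 1).
  by apply: CcvgD => //; exact: Ccvg_cst.
have h2E : Ccvg F (fun x => 2 * cexp (2 * h x)) (2 * cexp (2 * a)).
  by apply: CcvgM => //; exact: Ccvg_cst.
have hd : Ccvg F (fun x => (cexp (2 * h x) + 1) * h x) ((cexp (2 * a) + 1) * a).
  exact: CcvgM.
apply: CcvgM; last first.
  apply: CcvgV; first by rewrite mulf_neq0 ?msym_neq0// pnatr_eq0.
  by apply: CcvgM; [exact: Ccvg_cst|exact: Ccvg_msym].
apply: CcvgD.
  by apply: CcvgM => //; apply: CcvgV => //; rewrite mulf_neq0.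
apply: CcvgN; apply: CcvgM.
  apply: CcvgM; first by apply: CcvgD => //; exact: Ccvg_cst.
  by apply: CcvgD => //; exact: CcvgM.
apply: CcvgV; first by rewrite expf_neq0// mulf_neq0.
by under [X in Ccvg F X]eq_fun do rewrite expr2; rewrite expr2; exact: CcvgM.
Qed.

End SymbolLimits.

Lemma msym_real u : 0 < u -> msym u%:C = (Num.sqrt (tanh u / u))%:C.
Proof.
move=> u0.
have e0 : expR u + expR (- u) != 0 by rewrite gt_eqF// addr_gt0// expR_gt0.
have w_real : wsym u%:C = (tanh u / u)%:C.
  rewrite /wsym.
  have -> : cexp (2 * u%:C) = (expR (2 * u))%:C.
    apply/eqP; rewrite eq_complex Re_cexp Im_cexp Re_dbl Im_dbl/= mulr0.
    by rewrite cos0 sin0 mulr0 mulr1 !eqxx.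
  have -> : (1 : C) = (1 : R)%:C by [].
  rewrite -rmorphB -rmorphD -rmorphM -fmorphV -rmorphM/=; congr (_%:C).
  have eu : expR u * expR (- u) = 1 by rewrite expRxMexpNx_1.
  have -> : 2 * u = u + u by ring.
  rewrite expRD /tanh.
  have en0 : expR u != 0 by rewrite gt_eqF// expR_gt0.
  have f0 : expR u * expR u + 1 != 0.
    by rewrite gt_eqF// addr_gt0// mulr_gt0// expR_gt0.
  have -> : expR (- u) = (expR u)^-1 by rewrite expRN.
  rewrite expRN in e0.
  by field; rewrite en0 f0 gt_eqF.
have t0 : 0 <= tanh u / u.
  apply: divr_ge0; last exact: ltW.
  apply: divr_ge0; last by rewrite addr_ge0 ?expR_ge0.
  by rewrite subr_ge0 ler_expR; clear -u0; lra.
by rewrite /msym w_real csqrt_real.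
Qed.

(** [Num.sqrt] is 0 on negative numbers, so these two are the square roots of the positive and
    negative parts of tan v / v, and at most one of them is nonzero. *)
Definition sqrt_tan_pos v := Num.sqrt (tan v / v).
Definition sqrt_tan_neg v := Num.sqrt (- (tan v / v)).

Lemma wsym_imag v : v != 0 -> cos v != 0 -> wsym (0 +i* v) = (tan v / v)%:C.
Proof.
move=> v0 cv; rewrite /wsym.
have -> : cexp (2 * (0 +i* v)) = (cos v +i* sin v) ^+ 2.
  apply/eqP; rewrite eq_complex expr2 Re_cexp Im_cexp Re_dbl Im_dbl Re_mulc Im_mulc/=.
  have -> : 2 * v = v + v by ring.
  by rewrite mulr0 expR0 !mul1r cosD sinD [cos v * sin v]mulrC !eqxx.
have cs := cos2Dsin2 v.
(* Writing 1 as e^(iv) e^(-iv) lets a factor e^(iv) cancel and leaves 2 i sin v over 2 cos v times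
   iv. *)
have -> : (1 : C) = (cos v +i* sin v) * (cos v -i* sin v).
  apply/eqP; rewrite eq_complex Re_mulc Im_mulc/= mulrN opprK -!expr2 cs eqxx/=.
  by apply/eqP; ring.
have e0 : cos v +i* sin v != 0.
  by rewrite -sqr_normc_gt0/= cs.
have c2 : (2 * cos v)%:C != 0 by rewrite eq_complex/= eqxx andbT mulf_neq0.
have vv : 0 +i* v = 'i * v%:C by apply/eqP; rewrite eq_complex Re_mulc Im_mulc/=; apply/andP; split; apply/eqP; ring.
have i0 : ('i : C) != 0 by rewrite eq_complex/= eqxx oner_eq0.
have vc0 : v%:C != 0 by rewrite eq_complex/= eqxx andbT.
have -> : (cos v +i* sin v) ^+ 2 - (cos v +i* sin v) * (cos v -i* sin v) =
  (cos v +i* sin v) * ('i * (2 * sin v)%:C).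
  rewrite expr2 -mulrBr; congr (_ * _).
  by apply/eqP; rewrite eq_complex Re_addc Im_addc Re_oppc Im_oppc Re_mulc Im_mulc/=; apply/andP; split; apply/eqP; ring.
have -> : (cos v +i* sin v) ^+ 2 + (cos v +i* sin v) * (cos v -i* sin v) =
  (cos v +i* sin v) * (2 * cos v)%:C.
  rewrite expr2 -mulrDr; congr (_ * _).
  by apply/eqP; rewrite eq_complex Re_addc Im_addc/=; apply/andP; split; apply/eqP; ring.
rewrite vv.
transitivity ((2 * sin v)%:C / ((2 * cos v)%:C * v%:C)).
  have gen (a b c d i : C) : a != 0 -> c != 0 -> d != 0 -> i != 0 ->
      a * (i * b) / (a * c * (i * d)) = b / (c * d).
    by move=> a0 c0 d0 j0; field; rewrite a0 c0 d0 j0.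
  exact: gen.
rewrite -rmorphM -fmorphV -rmorphM/=; congr (_%:C).
by rewrite /tan; field; rewrite cv v0.
Qed.

(* On the right of the imaginary axis [wsym] approaches the negative half-line
   from below, hence the sign of the imaginary part. *)
Lemma Ccvg_msym_imag v : 0 < v -> cos v != 0 ->
  Ccvg 0^'+ (fun u => msym (u +i* v)) (sqrt_tan_pos v -i* sqrt_tan_neg v).
Proof.
move=> v0 cv.
have hz : Ccvg (0 : R)^'+ (fun u => u +i* v) (0 +i* v).
  by split; [exact: cvg_at_right_filter cvg_id|exact: cvg_cst].
have E0 : cexp (2 * (0 +i* v)) + 1 != 0.
  rewrite -sqr_normc_gt0 Re_addc Im_addc Re_cexp Im_cexp Re_dbl Im_dbl/= mulr0 expR0 !mul1r addr0.
  have cE : cos (2 * v) = 2 * cos v ^+ 2 - 1.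
    by rewrite mulr_natl cos_mulr2n -mulr_natl.
  rewrite cE ltr_pwDl ?sqr_ge0//.
  by rewrite subrK exprn_even_gt0//= mulf_neq0// expf_neq0.
have hw : Ccvg (0 : R)^'+ (fun u => wsym (u +i* v)) (tan v / v)%:C.
  rewrite -wsym_imag// ?gt_eqF//; apply: Ccvg_wsym => //.
  by rewrite eq_complex/= eqxx/= gt_eqF.
have hn : normc (wsym (u +i* v)) @[u --> (0 : R)^'+] --> `|tan v / v|.
  by rewrite -normc_real; exact: cvg_normc.
set tau := tan v / v in hw hn *.
(* The formula for [Im (csqrt w)] divides by a quantity that tends to 0 when tan v / v < 0. Its
   absolute value is sqrt((|w| - Re w) / 2), which is continuous; the sign is settled separately. *)
have hq : Num.sqrt ((normc (wsym (u +i* v)) - Re (wsym (u +i* v))) / 2)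
    @[u --> (0 : R)^'+] --> sqrt_tan_neg v.
  have -> : sqrt_tan_neg v = Num.sqrt ((`|tau| - tau) / 2).
    rewrite /sqrt_tan_neg -/tau; have [t0|t0] := leP 0 tau.
      rewrite ger0_norm// subrr mul0r sqrtr0.
      by apply/eqP; rewrite sqrtr_eq0 oppr_le0.
    by rewrite ltr0_norm//; congr Num.sqrt; field.
  apply: (@cvg_continuous _ _ _ _ _ Num.sqrt); first exact: sqrt_continuous.
  by apply: cvgM; [apply: cvgB => //; exact: hw.1|exact: cvg_cst].
have QE u : 0 < u -> `|Im (msym (u +i* v))| =
    Num.sqrt ((normc (wsym (u +i* v)) - Re (wsym (u +i* v))) / 2).
  move=> u0; have s0 : 0 < normc (wsym (u +i* v)) + Re (wsym (u +i* v)).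
    exact: wsym_slit.
  rewrite -sqrtr_sqr; congr Num.sqrt.
  have e1 := normc_sqr (msym (u +i* v)).
  rewrite normc_csqrt// sqr_sqrtr ?normc_ge0// in e1.
  have e2 : Re (msym (u +i* v)) ^+ 2 =
      (normc (wsym (u +i* v)) + Re (wsym (u +i* v))) / 2.
    by rewrite /msym Re_csqrt sqr_sqrtr// divr_ge0// ltW.
  by rewrite e2 in e1; lra.
split.
  have -> : Re (sqrt_tan_pos v -i* sqrt_tan_neg v) = Num.sqrt ((`|tau| + tau) / 2).
    rewrite /= /sqrt_tan_pos -/tau; have [t0|t0] := leP 0 tau.
      by rewrite ger0_norm//; congr Num.sqrt; field.
    rewrite ltr0_norm// addNr mul0r sqrtr0.
    by apply/eqP; rewrite sqrtr_eq0 ltW.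
  apply: (@cvg_continuous _ _ _ _ _ Num.sqrt); first exact: sqrt_continuous.
  by apply: cvgM; [apply: cvgD => //; exact: hw.1|exact: cvg_cst].
have [t0|t0] := leP 0 tau.
  have n0 : sqrt_tan_neg v = 0 by apply/eqP; rewrite sqrtr_eq0 oppr_le0.
  rewrite [Im _]/= n0 oppr0; rewrite n0 in hq; apply/norm_cvg0P.
  apply: cvg_trans hq; apply: near_eq_cvg; near=> u.
  by rewrite -QE.
apply: cvg_trans (cvgN hq); apply: near_eq_cvg; near=> u.
have u0 : 0 < u by [].
rewrite -[RHS]opprK; congr (- _).
rewrite -QE// ler0_norm// /msym Im_csqrt.
have d0 : (cexp (2 * (u +i* v)) + 1) * (u +i* v) != 0.
  by rewrite mulf_neq0 ?cexpD1_neq0 ?Re_gt0_neq0.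
rewrite (wsym_num d0).2 [Re _]/= [Im _]/=.
rewrite pmulr_lle0 ?invr_gt0 ?mulr_gt0 ?sqrtr_gt0 ?divr_gt0//; last exact: wsym_slit.
rewrite pmulr_lle0 ?invr_gt0 ?exprn_gt0 ?normc_gt0//.
(* A negative tan v / v forces sin (2v) <= 0, so both terms in the numerator of Im w are nonpositive
   for every u > 0, and the imaginary part approaches its limit from below the axis. *)
have s0 : sin (2 * v) <= 0.
  rewrite mulr_natl sin_mulr2n mulrn_wle0//.
  have : tau * v * cos v ^+ 2 <= 0.
    by apply: mulr_le0_ge0 (sqr_ge0 _); apply: mulr_le0_ge0; exact: ltW.
  by rewrite /tau /tan; congr (_ <= 0); field; rewrite cv gt_eqF.
have X1 : 1 < expR (2 * u) by rewrite expR_gt1 mulr_gt0.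
rewrite subr_le0; apply: (@le_trans _ _ 0).
  by rewrite mulr_ge0_le0// !mulr_ge0 ?expR_ge0// ltW.
by rewrite mulr_ge0 ?(ltW v0)// subr_ge0 exprn_ege1// ltW.
Unshelve. all: by end_near. Qed.

End Symbol.

(** * Green's formula on rectangles and an integrable majorant on the imaginary axis *)

Section RealIntegration.
Context {R : realType}.
Notation mu := (@lebesgue_measure R).
Notation MR := (measurableTypeR R).
Implicit Types (f F : R -> R) (a b c d p q x y u v : R).

Lemma is_derive_continuous f x (l : R) : is_derive x 1 f l -> {for x, continuous f}.
Proof. by move=> [fx _]; apply/differentiable_continuous/derivable1_diffP. Qed.

Lemma continuous_integrable_itv f a b :
  {in `[a, b], forall x, {for x, continuous f}} ->
  mu.-integrable `[a, b] (EFin \o f).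
Proof.
move=> cf; apply: continuous_compact_integrable; first exact: segment_compact.
by apply: continuous_in_subspaceT => x /set_mem; exact: cf.
Qed.

Lemma integrable_scale (D : set MR) c f : measurable D ->
  mu.-integrable D (EFin \o f) -> mu.-integrable D (EFin \o (fun x => c * f x)).
Proof.
move=> mD fi; rewrite (_ : _ \o _ = (fun x => c%:E * (EFin \o f) x)%E)//.
exact: integrableZl.
Qed.

Lemma RFTC2 f F a b : a < b ->
  {in `[a, b], forall x, is_derive x 1 F (f x)} ->
  {in `[a, b], forall x, {for x, continuous f}} ->
  \int[mu]_(x in `[a, b]) f x = F b - F a.
Proof.
move=> ab dF cf.
have aI : a \in `[a, b] by rewrite in_itv/= lexx ltW.
have bI : b \in `[a, b] by rewrite in_itv/= lexx ltW.
rewrite /Rintegral (@continuous_FTC2 _ f F a b ab)//.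
- by apply: continuous_in_subspaceT => x /set_mem; exact: cf.
- split.
  + by move=> x /subset_itv_oo_cc /dF[].
  + apply: cvg_at_right_filter; exact: is_derive_continuous (dF _ aI).
  + apply: cvg_at_left_filter; exact: is_derive_continuous (dF _ bI).
- by move=> x /subset_itv_oo_cc /dF dFx; rewrite derive1E derive_val.
Qed.

Lemma continuous_bounded_rectangle (D : R -> R -> R) a b c d :
  (forall u v, a <= u <= b -> c <= v <= d ->
    {for (u, v), continuous (fun p : R * R => D p.1 p.2)}) ->
  exists M : R, forall u v, a <= u <= b -> c <= v <= d -> `|D u v| <= M.
Proof.
move=> cD.
have : bounded_set ((fun p : R * R => D p.1 p.2) @` (`[a, b] `*` `[c, d])).
  apply: compact_bounded; apply: continuous_compact.
    by apply: continuous_in_subspaceT => -[u v] /set_mem[/= ub vd]; apply: cD;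
      [move: ub|move: vd]; rewrite in_itv.
  by apply: compact_setX; exact: segment_compact.
move=> [M [Mr HM]]; exists (M + 1) => u v ub vd.
apply: (HM (M + 1)); first by rewrite ltrDl.
by exists (u, v) => //; split; rewrite /= in_itv.
Qed.

(* One real component of Cauchy's theorem on the rectangle [a, b] x [c, d]. *)
Lemma green_rectangle (A B D : R -> R -> R) u0 v0 a b c d :
  u0 < a -> a < b -> v0 < c -> c < d ->
  (forall u v, u0 < u -> v0 < v -> is_derive u 1 (A ^~ v) (D u v)) ->
  (forall u v, u0 < u -> v0 < v -> is_derive v 1 (B u) (D u v)) ->
  (forall u v, u0 < u -> v0 < v -> {for v, continuous (A u)}) ->
  (forall u v, u0 < u -> v0 < v -> {for u, continuous (B ^~ v)}) ->
  (forall u v, u0 < u -> v0 < v ->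
    {for (u, v), continuous (fun p : R * R => D p.1 p.2)}) ->
  \int[mu]_(v in `[c, d]) (A b v - A a v) =
  \int[mu]_(u in `[a, b]) (B u d - B u c).
Proof.
move=> u0a ab v0c cd dA dB cA cB cD.
(* Differentiation under the integral sign needs an open interval of parameters around [c, d], on
   which [D] is still bounded. *)
set c' := (v0 + c) / 2; set d' := d + 1.
have v0c' : v0 < c' by rewrite /c'; lra.
have c'c : c' < c by rewrite /c'; lra.
have dd' : d < d' by rewrite /d'; lra.
have [M HM] : exists M : R, forall u v, a <= u <= b -> c' <= v <= d' ->
    `|D u v| <= M.
  apply: continuous_bounded_rectangle => u v /andP[au _] /andP[cv _].
  by apply: cD; [exact: lt_le_trans au|exact: lt_le_trans cv].
have M0 : 0 <= M.
  apply: (le_trans (normr_ge0 (D a c))); apply: HM.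
    by rewrite lexx ltW.
  by rewrite (ltW c'c) ltW// (lt_trans cd).
pose Psi v := \int[mu]_(u in `[a, b]) B u v.
have mI : measurable (`[a, b] : set R) by [].
have cDu u v : u0 < u -> v0 < v -> {for u, continuous (D ^~ v)}.
  move=> u0u v0v; apply: (@continuous_comp _ _ _ (fun u => (u, v))
    (fun p : R * R => D p.1 p.2)); last exact: cD.
  by apply: (cvg_pair cvg_id (cvg_cst v)).
have intB v : c' < v < d' -> mu.-integrable `[a, b] (EFin \o (B ^~ v)).
  move=> /andP[c'v vd']; apply: continuous_integrable_itv => u.
  rewrite in_itv/= => /andP[au ub]; apply: cB; first exact: lt_le_trans au.
  exact: lt_trans c'v.
(* The derivative of [Psi] is the integral over u of [D], which is also the u-derivative of [A], so
   it is an increment of [A]. Integrating once more in v gives Green's formula without a double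
   integral. *)
have dPsi v : c' < v < d' -> is_derive v 1 Psi (A b v - A a v).
  move=> cvd; have /andP[c'v vd'] := cvd.
  have v0v : v0 < v by exact: lt_trans c'v.
  have Iv : `]c', d'[%classic v by rewrite /= in_itv/= cvd.
  have d1E x y : c' < x -> a <= y -> partial1of2 (fun v u => B u v) x y = D y x.
    move=> c'x ay; rewrite partial1of2E.
    have dBx : is_derive x 1 (B y) (D y x).
      by apply: dB; [exact: lt_le_trans ay|exact: lt_trans c'x].
    by rewrite derive_val.
  have H1 x : `]c', d'[%classic x ->
      mu.-integrable `[a, b] (EFin \o (fun u => B u x)).
    by rewrite /= in_itv/= => ?; exact: intB.
  have H2 x y : `]c', d'[%classic x -> `[a, b]%classic y ->
      derivable ((fun v u => B u v) ^~ y) x 1.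
    rewrite /= !in_itv/= => /andP[c'x _] /andP[ay _].
    have [//] : is_derive x 1 (B y) (D y x).
      by apply: dB; [exact: lt_le_trans ay|exact: lt_trans c'x].
  have H3 x y : `]c', d'[%classic x -> `[a, b]%classic y ->
      `|partial1of2 (fun v u => B u v) x y| <= cst M y.
    rewrite /= !in_itv/= => /andP[c'x xd'] /andP[ay yb].
    by rewrite d1E//; apply: HM; rewrite ?ay ?yb ?ltW.
  have H4 : mu.-integrable `[a, b] (EFin \o cst M).
    by apply: continuous_integrable_itv => x _; exact: cvg_cst.
  have dv := @derivable_under_integral R _ _ mu (fun v u => B u v) `[a, b] mI
    v c' d' Iv H1 H2 (cst M) (fun=> M0) H4 H3.
  have vv := @differentiation_under_integral R _ _ mu (fun v u => B u v) `[a, b] mI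
    v c' d' Iv H1 H2 (cst M) (fun=> M0) H4 H3.
  apply: DeriveDef => //; rewrite -derive1E vv.
  rewrite (@eq_Rintegral _ _ _ mu _ (D ^~ v)).
    apply: (@RFTC2 (D ^~ v) (A ^~ v) _ _ ab) => y; rewrite in_itv/= => /andP[ay yb].
      by apply: dA v0v; exact: lt_le_trans ay.
    by apply: cDu v0v; exact: lt_le_trans ay.
  by move=> y /set_mem; rewrite /= in_itv/= => /andP[ay _]; exact: d1E.
have Ha v : v \in `[c, d] -> c' < v < d'.
  rewrite in_itv/= => /andP[cv vd].
  by rewrite (lt_le_trans c'c cv) (le_lt_trans vd dd').
rewrite (@RFTC2 _ Psi)//.
- rewrite /Psi -RintegralB//; apply: intB; apply: Ha; by rewrite in_itv/= lexx ltW.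
- by move=> v /Ha; exact: dPsi.
- move=> v /Ha /andP[c'v _].
  have v0v := lt_trans v0c' c'v; have u0b := lt_trans u0a ab.
  by apply: cvgB; exact: cA.
Qed.

(** [f] may blow up at both ends: the fundamental theorem is applied on compact subintervals
    increasing to ]p, q[, followed by monotone convergence. *)
Lemma ge0_integral_oo_le f F p q c : p < q ->
  {in `]p, q[, forall x, 0 <= f x} ->
  {in `]p, q[, forall x, {for x, continuous f}} ->
  {in `]p, q[, forall x, is_derive x 1 F (f x)} ->
  {in `]p, q[ &, forall x y, F y - F x <= c} ->
  (\int[mu]_(x in `]p, q[) (f x)%:E <= c%:E)%E.
Proof.
move=> pq f0 cf dF Fc.
(* The denominator is at least 3, so that 2 e(n) < q - p and already the first interval is
   nondegenerate. *)
pose e (n : nat) := (q - p) / n.+3%:R.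
have e0 n : 0 < e n by rewrite divr_gt0// subr_gt0.
have e2 n : p + e n < q - e n.
  suff : e n * 2 < q - p by lra.
  rewrite /e -mulrA -ltr_pdivlMl ?subr_gt0// mulVf ?subr_eq0 ?gt_eqF//.
  by rewrite mulrC ltr_pdivrMr// mul1r ltr_nat.
pose I n := `[p + e n, q - e n]%classic.
have Isub n : I n `<=` `]p, q[%classic.
  move=> x; rewrite /I /= !in_itv/= => /andP[px xq].
  by have := e0 n => en0; apply/andP; split; lra.
have UI : \bigcup_n I n = `]p, q[%classic.
  apply/seteqP; split => [x [n _]|x]; first exact: Isub.
  rewrite /= in_itv/= => /andP[px xq].
  pose m := Num.min (x - p) (q - x).
  have m0 : 0 < m by rewrite lt_min !subr_gt0 px xq.
  exists (Num.truncn ((q - p) / m)) => //.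
  have en : e (Num.truncn ((q - p) / m)) < m.
    rewrite /e ltr_pdivrMr// mulrC -ltr_pdivrMr//.
    apply: lt_le_trans (truncnS_gt _) _.
    by rewrite ler_nat ltnW.
  move: en; rewrite lt_min => /andP[en1 en2].
  by rewrite /I /= in_itv/=; apply/andP; split; lra.
have nd : nondecreasing_seq I.
  move=> m n mn; apply/subsetPset => x; rewrite /I /= !in_itv/= => /andP[px xq].
  have : e n <= e m.
    by rewrite ler_pM2l ?subr_gt0// lef_pV2 ?posrE// ler_nat !ltnS.
  by move=> ?; apply/andP; split; lra.
have mf n : measurable_fun (I n : set MR) (EFin \o f).
  apply: (@measurable_int _ _ _ mu).
  by apply: continuous_integrable_itv => x xI; apply: cf; exact: (Isub n).
have f0I n x : I n x -> (0 <= (f x)%:E)%E.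
  by move=> /Isub xI; rewrite lee_fin f0.
have := @ge0_nondecreasing_set_cvg_integral _ MR R I (EFin \o f)
  mu nd (fun n => measurable_itv _) mf f0I.
rewrite UI => cvgI; rewrite -(cvg_lim _ cvgI)//.
apply: lime_le; first by apply/cvg_ex; eexists; exact: cvgI.
apply: nearW => n.
have IE x : x \in `[p + e n, q - e n] -> x \in `]p, q[ by move=> /Isub.
have fi : mu.-integrable (I n) (EFin \o f).
  by apply: continuous_integrable_itv => x /IE; exact: cf.
have mIn : measurable (I n : set MR) by exact: measurable_itv.
rewrite -(fineK (integrable_fin_num mIn fi)) lee_fin.
have -> : fine (\int[mu]_(x in I n) (f x)%:E) = F (q - e n) - F (p + e n).
  by apply: RFTC2 => // x /IE; [exact: dF|exact: cf].
by apply: Fc; apply: IE; rewrite in_itv/= lexx ltW.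
Qed.

Lemma measurable_invr : measurable_fun [set: R] (@GRing.inv R).
Proof.
have -> : [set: R] = [set~ 0] `|` [set 0] by rewrite setUC setUv.
apply/measurable_funU => //; first exact: measurableC.
split; last exact: measurable_fun_set1.
apply: open_continuous_measurable_fun; first by apply: closed_openC; exact: closed_eq.
by move=> x /set_mem/= /eqP x0; exact: inv_continuous.
Qed.

Lemma measurable_sqrtr : measurable_fun [set: R] (@Num.sqrt R).
Proof. by apply: continuous_measurable_fun; exact: sqrt_continuous. Qed.

Lemma measurable_sin : measurable_fun [set: R] (@sin R).
Proof. by apply: continuous_measurable_fun; exact: continuous_sin. Qed.

Lemma measurable_cos : measurable_fun [set: R] (@cos R).
Proof. by apply: continuous_measurable_fun; exact: continuous_cos. Qed.

Lemma measurable_tan : measurable_fun [set: R] (@tan R).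
Proof.
apply: measurable_funM; first exact: measurable_sin.
exact: (measurableT_comp measurable_invr measurable_cos).
Qed.

(** Between consecutive multiples of pi/2 the functions sin, cos and tan have constant sign; tan is
    negative exactly on the intervals of odd index. Their union fills (0, +oo) up to a countable
    set. *)
Definition quarter (n : nat) : set R := `]n%:R * (pi / 2), n.+1%:R * (pi / 2)[.

Definition quarters : set R := \bigcup_n quarter n.

Lemma quarterE n v : quarter n v = (n%:R * (pi / 2) < v < n.+1%:R * (pi / 2)).
Proof. by rewrite /quarter /= in_itv. Qed.

Lemma measurable_quarter n : measurable (quarter n).
Proof. exact: measurable_itv. Qed.

Lemma measurable_quarters : measurable (quarters : set MR).
Proof. by apply: bigcupT_measurable => n; exact: measurable_quarter. Qed.

Lemma quarters_gt0 v : quarters v -> 0 < v.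
Proof.
move=> [n _]; rewrite quarterE => /andP[+ _].
by apply: le_lt_trans; rewrite mulr_ge0// divr_ge0// pi_ge0.
Qed.

(** A shift by pi/2 changes the sign of sin cos, which is positive on the first interval. *)
Lemma sign_sincos (n : nat) v : n%:R * (pi / 2) < v < n.+1%:R * (pi / 2) ->
  0 < (-1) ^+ n * (sin v * cos v).
Proof.
elim: n v => [|n IHn] v.
  rewrite mul0r mul1r expr0 mul1r => vI; have /andP[v0 v1] := vI.
  rewrite mulr_gt0 ?sin_gt0_pihalf// cos_gt0_pihalf// v1 (lt_trans _ v0)//.
  by rewrite oppr_lt0 divr_gt0// pi_gt0.
move=> /andP[nv vn].
have /IHn : n%:R * (pi / 2) < v - pi / 2 < n.+1%:R * (pi / 2).
  by move: nv vn; rewrite -!natr1 !mulrDl !mul1r => nv vn; apply/andP; split; lra.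
by rewrite sinBpihalf cosBpihalf exprS; congr (_ < _); ring.
Qed.

Lemma quarters_cos_neq0 v : quarters v -> cos v != 0.
Proof.
by move=> [n _]; rewrite quarterE => /sign_sincos; apply: contraTneq => ->;
  rewrite !mulr0 ltxx.
Qed.

Lemma trivIset_quarters :
  trivIset setT quarter.
Proof.
have p0 : 0 < pi / 2 :> R by rewrite divr_gt0// pi_gt0.
apply/trivIsetP => m n _ _ mn; apply/seteqP; split => // x [].
rewrite !quarterE => /andP[mx xm] /andP[nx xn].
have := lt_trans mx xn; have := lt_trans nx xm.
rewrite !ltr_pM2r// !ltr_nat !ltnS => nm mn'.
by move: mn; rewrite eqn_leq nm mn'.
Qed.

Lemma quartersE : `]0, +oo[%classic = quarters `|`
  (range (fun n : nat => n%:R * (pi / 2)) `&` `]0, +oo[) :> set R.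
Proof.
have p0 : 0 < pi / 2 :> R by rewrite divr_gt0// pi_gt0.
apply/seteqP; split => [x|x [/quarters_gt0|[_ //]]]; last first.
  by rewrite /= in_itv/= andbT.
move=> /[dup] x0; rewrite /= in_itv/= andbT => x0'.
have [nx xn] : (Num.truncn (x / (pi / 2)))%:R * (pi / 2) <= x /\
    x < (Num.truncn (x / (pi / 2))).+1%:R * (pi / 2).
  have y0 : 0 <= x / (pi / 2) by rewrite divr_ge0// ltW.
  have /andP[h1 h2] := truncn_itv y0.
  by rewrite -ler_pdivlMr// -ltr_pdivrMr.
move: nx; rewrite le_eqVlt => /orP[/eqP e|nx].
  by right; split => //; eexists; [|exact: e].
by left; exists (Num.truncn (x / (pi / 2))) => //; rewrite quarterE nx xn.
Qed.

Lemma quartersC0 : mu (`]0, +oo[%classic `\` quarters) = 0%E.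
Proof.
apply: countable_lebesgue_measure0.
apply: (@sub_countable _ _ _ (range (fun n : nat => n%:R * (pi / 2) : R))).
  by apply: subset_card_le => x []; rewrite quartersE => -[//|[]].
exact: sub_countable (card_image_le _ _) (countableP _).
Qed.

(* Since [1 = sin^2 + cos^2], [|cos|^(-1/2) <= 1 + |sin| |cos|^(-1/2)], and the
   last term is the derivative of [2 |cos|^(1/2)] up to sign. *)
Lemma integral_quarter_le (n : nat) :
  (\int[mu]_(v in quarter n)
     (Num.sqrt (`|cos v|^-1))%:E <= 4%:E)%E.
Proof.
have p0 : 0 < pi / 2 :> R by rewrite divr_gt0// pi_gt0.
(* This is |cos v|^(1/2); writing |cos v| as the root of a square makes it accessible to the chain
   rule. *)
pose s v := Num.sqrt (Num.sqrt (cos v ^+ 2)) : R.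
pose f v : R := 1 + (-1) ^+ n * (sin v * cos v) / (Num.sqrt (cos v ^+ 2) * s v).
pose F v : R := v - (-1) ^+ n * (2 * s v).
have pq : n%:R * (pi / 2) < n.+1%:R * (pi / 2) :> R by rewrite ltr_pM2r// ltr_nat.
have cn0 v : quarter n v -> 0 < cos v ^+ 2.
  rewrite quarterE => /sign_sincos; rewrite exprn_even_gt0//=.
  by apply: contraTneq => ->; rewrite !mulr0 ltxx.
have sE v : s v = Num.sqrt `|cos v| by rewrite /s sqrtr_sqr.
apply: (@le_trans _ _ (\int[mu]_(v in quarter n) (f v)%:E)%E).
  apply: ge0_le_integral => //.
  - exact: measurable_quarter.
  - apply/measurable_EFinP/measurable_funTS.
    apply: (measurableT_comp measurable_sqrtr).
    apply: (measurableT_comp measurable_invr).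
    apply: measurableT_comp => //; exact: measurable_cos.
  - apply/measurable_EFinP/measurable_funTS.
    have mc : measurable_fun [set: R] (fun v => Num.sqrt (cos v ^+ 2) : R).
      apply: (measurableT_comp measurable_sqrtr).
      by apply: measurable_funX; exact: measurable_cos.
    apply: measurable_funD => //; apply: measurable_funM.
      apply: measurable_funM => //.
      by apply: measurable_funM; [exact: measurable_sin|exact: measurable_cos].
    apply: (measurableT_comp measurable_invr); apply: measurable_funM => //.
    exact: (measurableT_comp measurable_sqrtr).
  - move=> v vI; rewrite lee_fin /f sqrtr_sqr sE.
    have c0 : 0 < `|cos v|.
      by rewrite normr_gt0; have := cn0 _ vI; rewrite exprn_even_gt0.
    have c1 := cos_max v.
    have -> : (-1) ^+ n * (sin v * cos v) = `|sin v| * `|cos v|.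
      rewrite -normrM -[RHS]mul1r -[in RHS](@normr_sign R n) -normrM ger0_norm//.
      by move: vI; rewrite quarterE => /sign_sincos/ltW.
    rewrite sqrtrV//.
    set r := Num.sqrt `|cos v|.
    have r0 : 0 < r by rewrite sqrtr_gt0.
    have r2 : r ^+ 2 = `|cos v| by rewrite sqr_sqrtr// ltW.
    have sc : `|sin v| ^+ 2 + `|cos v| ^+ 2 = 1.
      by rewrite !real_normK ?num_real// addrC cos2Dsin2.
    have s0 : 0 <= `|sin v| by [].
    have s1 := sin_max v.
    have -> : 1 + `|sin v| * `|cos v| / (`|cos v| * r) = (r + `|sin v|) / r.
      by field; rewrite !gt_eqF.
    rewrite ler_pdivlMr// mulVf ?gt_eqF//.
    have r1 : r <= 1 by rewrite -sqrtr1 ler_wsqrtr.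
    have : `|sin v| ^+ 2 <= `|sin v| by rewrite expr2 ler_piMr.
    have : `|cos v| ^+ 2 <= r.
      by rewrite -r2 -exprM -[leRHS]expr1 ler_wiXn2l// ltW.
    by lra.
apply: (@ge0_integral_oo_le f F _ _ _ pq).
- move=> v vI; apply: addr_ge0 => //; apply: divr_ge0; last first.
    by rewrite mulr_ge0 ?sqrtr_ge0.
  by move: vI; rewrite in_itv/= => /sign_sincos/ltW.
- move=> v vI; have c0 := cn0 _ vI.
  have cc : {for v, continuous (fun v => Num.sqrt (cos v ^+ 2) : R)}.
    apply: (@cvg_continuous _ _ _ _ _ Num.sqrt); first exact: sqrt_continuous.
    by apply: (is_derive_continuous (is_deriveX 2 (is_derive_cos v))).
  apply: cvgD; first exact: cvg_cst.
  apply: cvgM.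
    apply: cvgM; first exact: cvg_cst.
    by apply: cvgM; [exact: continuous_sin|exact: continuous_cos].
  apply: cvgV; first by rewrite mulf_neq0// gt_eqF// ?sqrtr_gt0.
  apply: cvgM => //; apply: (@cvg_continuous _ _ _ _ _ Num.sqrt) => //.
  exact: sqrt_continuous.
- move=> v vI; have c0 := cn0 _ vI.
  have sc0 : 0 < Num.sqrt (cos v ^+ 2) by rewrite sqrtr_gt0.
  have ss0 : 0 < s v by rewrite sqrtr_gt0.
  have d1 := @is_derive1_comp _ Num.sqrt (fun v => cos v ^+ 2) _ _ _
    (is_derive1_sqrt c0) (is_deriveX 2 (is_derive_cos v)).
  have d2 := @is_derive1_comp _ Num.sqrt (fun v => Num.sqrt (cos v ^+ 2)) _ _ _
    (is_derive1_sqrt sc0) d1.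
  have := is_deriveB (is_derive_id v 1) (is_deriveZ ((-1) ^+ n * 2) d2).
  rewrite (_ : _ - _ = F); last first.
    by apply/funext => x; rewrite /F mulrA.
  move/is_derive_eq; apply.
  rewrite /f /s /GRing.scale/= expr1 -/(s v).
  by field; rewrite !gt_eqF.
- move=> x y; rewrite !in_itv/= => /andP[nx xn] /andP[ny yn].
  have sb v : 0 <= s v <= 1.
    by rewrite sqrtr_ge0 sE -sqrtr1 ler_wsqrtr ?sqrtr1 ?cos_max.
  have /andP[s0 s1] := sb x; have /andP[t0 t1] := sb y.
  (* The bound 4 is 2 + 2: the interval has length pi/2 < 2, and 2 s varies by at most 2. *)
  have p2 := pihalf_lt2 R.
  have -> : F y - F x = (y - x) + (-1) ^+ n * (2 * (s x - s y)) by rewrite /F; ring.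
  have : (-1) ^+ n * (2 * (s x - s y)) <= 2.
    by rewrite -signr_odd; case: odd; rewrite ?expr0 ?expr1; lra.
  have yn' : y < n%:R * (pi / 2) + pi / 2.
    by move: yn; rewrite -natr1 mulrDl mul1r.
  by lra.
Qed.

(* Dominates [|F k|] on every vertical line, for the symbol [F] and any kernel
   [k] with [|k(u + iv)| <= 1 / (1 + v)]. *)
Definition quarters_dom v : R := Num.sqrt ((`|cos v| * v)^-1) / (1 + v).

Lemma quarters_dom_ge0 v : 0 <= v -> 0 <= quarters_dom v.
Proof. by move=> v0; rewrite divr_ge0 ?sqrtr_ge0// addr_ge0. Qed.

Lemma measurable_quarters_dom : measurable_fun [set: R] quarters_dom.
Proof.
apply: measurable_funM.
  apply: (measurableT_comp measurable_sqrtr).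
  apply: (measurableT_comp measurable_invr).
  apply: measurable_funM => //; apply: measurableT_comp => //.
  exact: measurable_cos.
apply: (measurableT_comp measurable_invr); exact: measurable_funD.
Qed.

Lemma measurable_sqrt_cosV : measurable_fun [set: R] (fun v => Num.sqrt (`|cos v|^-1)).
Proof.
apply: (measurableT_comp measurable_sqrtr).
apply: (measurableT_comp measurable_invr).
by apply: measurableT_comp => //; exact: measurable_cos.
Qed.

Lemma sqrt_invM a b : 0 <= a -> 0 <= b ->
  Num.sqrt ((a * b)^-1) = (Num.sqrt a)^-1 * (Num.sqrt b)^-1.
Proof. by move=> a0 b0; rewrite sqrtrV ?mulr_ge0// sqrtrM// invfM. Qed.

(** The first interval has a singularity at each end, v^(-1/2) at 0 and |cos v|^(-1/2) at pi/2. They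
    are separated at v = 1: below, cos v >= cos 1; above, v^(-1/2) <= 1. *)
Lemma integral_quarters_dom0 : exists c : R,
  (\int[mu]_(v in quarter 0) (quarters_dom v)%:E <= c%:E)%E.
Proof.
pose k := Num.sqrt (cos 1)^-1 : R.
(* The first 4 bounds the increments of 2 sqrt(v) on an interval inside (0, 2), the second is the
   bound of [integral_quarter_le]. *)
exists (k * 4 + 4).
have qE v : quarter 0 v = (0 < v < pi / 2) by rewrite quarterE mul0r mul1r.
have mV : measurable_fun [set: R] (fun v => (Num.sqrt v)^-1).
  exact: (measurableT_comp measurable_invr measurable_sqrtr).
apply: (@le_trans _ _ (\int[mu]_(v in quarter 0)
    (k%:E * ((Num.sqrt v)^-1)%:E + (Num.sqrt (`|cos v|^-1))%:E))%E).
  apply: ge0_le_integral => //.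
  - exact: measurable_quarter.
  - move=> v; rewrite qE => /andP[v0 _].
    by rewrite lee_fin quarters_dom_ge0// ltW.
  - by apply/measurable_EFinP/measurable_funTS; exact: measurable_quarters_dom.
  - apply/measurable_funTS/emeasurable_funD; apply/measurable_EFinP.
      by apply: measurable_funM.
    exact: measurable_sqrt_cosV.
  - move=> v; rewrite qE => /andP[v0 v1].
    rewrite -EFinM -EFinD lee_fin /quarters_dom.
    have c0 : 0 < cos v by rewrite cos_gt0_pihalf// v1 (lt_trans _ v0)// oppr_lt0 divr_gt0// pi_gt0.
    rewrite ler_pdivrMr ?addr_gt0//.
    apply: (@le_trans _ _ (k * (Num.sqrt v)^-1 + Num.sqrt `|cos v|^-1)); last first.
      rewrite ler_peMr ?addr_ge0 ?mulr_ge0 ?invr_ge0 ?sqrtr_ge0//.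
      by rewrite lerDl ltW.
    rewrite sqrt_invM ?(ltW v0)// [Num.sqrt `|_|^-1]sqrtrV//.
    have [vl|vg] := leP v 1.
      rewrite -[leLHS]addr0 lerD ?sqrtr_ge0//.
      rewrite ler_pM2r ?invr_gt0 ?sqrtr_gt0// -sqrtrV// (gtr0_norm c0).
      rewrite ler_wsqrtr// lef_pV2 ?posrE ?cos1_gt0//.
      have p2 := pi_ge2 R.
      have [->//|vn1] := eqVneq v 1.
      apply/ltW; rewrite ltr_cos ?in_itv/=; first by rewrite lt_neqAle vn1.
        by rewrite (ltW v0); lra.
      by rewrite ler01; lra.
    rewrite -[leLHS]add0r lerD ?mulr_ge0 ?invr_ge0 ?sqrtr_ge0//.
    rewrite ler_piMr ?invr_ge0 ?sqrtr_ge0// invf_le1 ?sqrtr_gt0//.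
    by rewrite -[leLHS]sqrtr1 ler_wsqrtr// ltW.
rewrite ge0_integralD//; last 4 first.
- exact: measurable_quarter.
- by move=> v _; rewrite -EFinM lee_fin mulr_ge0 ?invr_ge0 ?sqrtr_ge0.
- apply/measurable_funTS/measurable_EFinP; exact: measurable_funM.
- apply/measurable_funTS/measurable_EFinP; exact: measurable_sqrt_cosV.
rewrite EFinD leeD ?integral_quarter_le// ge0_integralZl_EFin ?sqrtr_ge0//; last 2 first.
- exact: measurable_quarter.
- by apply/measurable_funTS/measurable_EFinP.
rewrite EFinM lee_wpmul2l ?lee_fin ?sqrtr_ge0//.
have pq : 0 * (pi / 2) < 1 * (pi / 2) :> R.
  by rewrite mul0r mul1r divr_gt0// pi_gt0.
have vE v : v \in `]0 * (pi / 2), 1 * (pi / 2)[ -> 0 < v < 2.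
  rewrite in_itv/= mul0r mul1r => /andP[-> v1] /=.
  by apply: lt_trans v1 _; exact: pihalf_lt2.
apply: (@ge0_integral_oo_le _ (fun v => 2 * Num.sqrt v)) => //.
- move=> v /vE /andP[v0 _]; apply: cvgV; first by rewrite gt_eqF// sqrtr_gt0.
  exact: sqrt_continuous.
- move=> v /vE /andP[v0 _].
  apply: (is_derive_eq (is_deriveZ 2 (is_derive1_sqrt v0))).
  by rewrite /GRing.scale/=; field; rewrite gt_eqF// sqrtr_gt0.
- move=> x y /vE /andP[x0 x2] /vE /andP[y0 y2].
  have : Num.sqrt y <= 2.
    by rewrite -[2]ger0_norm// -sqrtr_sqr ler_wsqrtr//; lra.
  by have := sqrtr_ge0 x; lra.
Qed.

(** Since pi/2 >= 1, v exceeds m = n + 1 on this interval, whence a bound 4 / (sqrt(m) (1 + m)). It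
    is replaced by a difference of consecutive inverse square roots so that the sum over n
    telescopes. *)
Lemma integral_quarters_domS (n : nat) :
  (\int[mu]_(v in quarter n.+1) (quarters_dom v)%:E <=
   (8 * ((Num.sqrt n.+1%:R)^-1 - (Num.sqrt n.+2%:R)^-1))%:E)%E.
Proof.
set m : R := n.+1%:R; have m0 : 0 < m by rewrite ltr0n.
have mE : n.+2%:R = 1 + m by rewrite -[n.+2%:R]natr1 addrC.
pose k := (Num.sqrt m)^-1 / (1 + m).
have k0 : 0 <= k by rewrite divr_ge0 ?invr_ge0 ?sqrtr_ge0// addr_ge0// ltW.
apply: (@le_trans _ _ (\int[mu]_(v in quarter n.+1)
    (k%:E * (Num.sqrt (`|cos v|^-1))%:E))%E).
  apply: ge0_le_integral => //.
  - exact: measurable_quarter.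
  - move=> v; rewrite quarterE => /andP[v0 _].
    rewrite lee_fin quarters_dom_ge0// ltW// (le_lt_trans _ v0)//.
    by rewrite mulr_ge0// divr_ge0// pi_ge0.
  - by apply/measurable_EFinP/measurable_funTS; exact: measurable_quarters_dom.
  - apply/measurable_funTS/measurable_EFinP; apply: measurable_funM => //.
    exact: measurable_sqrt_cosV.
  - move=> v; rewrite quarterE => /andP[v0 _].
    have mv : m < v by apply: le_lt_trans v0; rewrite ler_peMr ?pihalf_ge1.
    have vp : 0 < v by exact: lt_trans mv.
    rewrite -EFinM lee_fin /quarters_dom /k.
    rewrite sqrt_invM ?(ltW vp)// [leRHS]mulrC sqrtrV// -!mulrA.
    rewrite ler_wpM2l ?invr_ge0 ?sqrtr_ge0//.
    rewrite ler_pM ?invr_ge0 ?sqrtr_ge0 ?addr_ge0 ?(ltW vp)//.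
      by rewrite lef_pV2 ?posrE ?sqrtr_gt0// ler_wsqrtr// ltW.
    by rewrite lef_pV2 ?posrE ?addr_gt0// lerD2l ltW.
rewrite ge0_integralZl_EFin//; last 2 first.
- exact: measurable_quarter.
- apply/measurable_funTS/measurable_EFinP; exact: measurable_sqrt_cosV.
apply: (@le_trans _ _ (k%:E * 4%:E)%E).
  by rewrite lee_wpmul2l ?lee_fin// integral_quarter_le.
rewrite -EFinM lee_fin mE.
set a := Num.sqrt m; set b := Num.sqrt (1 + m).
have a0 : 0 < a by rewrite sqrtr_gt0.
have b0 : 0 < b by rewrite sqrtr_gt0 addr_gt0.
have ab : a <= b by rewrite ler_wsqrtr// lerDr.
have e1 : (b - a) * (b + a) = 1.
  rewrite -subr_sqr !sqr_sqrtr ?addr_ge0 ?(ltW m0)//; ring.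
have e2 : 1 + m = b ^+ 2 by rewrite sqr_sqrtr// addr_ge0// ltW.
rewrite /k e2 -/a.
have -> : 8 * (a^-1 - b^-1) = 8 * (b - a) / (a * b).
  by field; rewrite !gt_eqF.
have -> : a^-1 / b ^+ 2 * 4 = 4 / b / (a * b) by field; rewrite !gt_eqF.
rewrite ler_pM2r ?invr_gt0 ?mulr_gt0// ler_pdivrMr//.
have : (b - a) * (b + a) <= (b - a) * (2 * b).
  by rewrite ler_wpM2l ?subr_ge0//; lra.
by rewrite e1; lra.
Qed.

Lemma integrable_quarters_dom : mu.-integrable quarters (EFin \o quarters_dom).
Proof.
apply/integrableP; split.
  apply/measurable_EFinP/measurable_funTS; exact: measurable_quarters_dom.
have d0 v : quarters v -> (0 <= (quarters_dom v)%:E)%E.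
  by move=> /quarters_gt0 v0; rewrite lee_fin quarters_dom_ge0// ltW.
have -> : (\int[mu]_(v in quarters) `|(EFin \o quarters_dom) v| =
    \int[mu]_(v in quarters) (quarters_dom v)%:E)%E.
  by apply: eq_integral => v /set_mem qv; rewrite gee0_abs// d0.
rewrite /quarters ge0_integral_bigcup//; last 3 first.
- by move=> n; exact: measurable_quarter.
- apply/measurable_EFinP/measurable_funTS; exact: measurable_quarters_dom.
- exact: trivIset_quarters.
have [c Hc] := integral_quarters_dom0.
apply: (@le_lt_trans _ _ (c + 8)%:E); last exact: ltry.
have u0 n : (0 <= \int[mu]_(v in quarter n) (quarters_dom v)%:E)%E.
  by apply: integral_ge0 => v qv; apply: d0; exists n.
apply: lime_le; first by apply: is_cvg_nneseries => n _ _.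
have H N : (\sum_(0 <= n < N.+1) \int[mu]_(v in quarter n) (quarters_dom v)%:E <=
    (c + 8 * (1 - (Num.sqrt N.+1%:R)^-1))%:E)%E.
  elim: N => [|N IHN].
    by rewrite big_nat1 sqrtr1 invr1 subrr mulr0 addr0.
  rewrite big_nat_recr//=; apply: le_trans (leeD IHN (integral_quarters_domS N)) _.
  by rewrite -EFinD lee_fin; lra.
apply: nearW => -[|N]; first rewrite big_geq//.
  apply: (@le_trans _ _ c%:E); first exact: le_trans Hc.
  by rewrite lee_fin lerDl.
apply: le_trans (H N) _; rewrite lee_fin.
have : 0 <= (Num.sqrt N.+1%:R)^-1 :> R by rewrite invr_ge0 sqrtr_ge0.
by lra.
Qed.

Lemma Rdominated_convergence (D : set MR) (f_ : nat -> R -> R) f (g : R -> R) :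
  measurable D -> (forall n, measurable_fun D (f_ n)) ->
  (forall x, D x -> f_ n x @[n --> \oo] --> f x) ->
  mu.-integrable D (EFin \o g) ->
  (forall n x, D x -> `|f_ n x| <= g x) ->
  mu.-integrable D (EFin \o f) /\
  \int[mu]_(x in D) f_ n x @[n --> \oo] --> \int[mu]_(x in D) f x.
Proof.
move=> mD mf_ ff ig fg.
have mf : measurable_fun D f.
  by apply: (measurable_fun_cvg mf_) => x Dx; exact: ff.
have mfE n : measurable_fun D (EFin \o f_ n) by exact/measurable_EFinP.
have mfE' : measurable_fun D (EFin \o f) by exact/measurable_EFinP.
have H1 : {ae mu, forall x, D x -> (EFin \o f_ n) x @[n --> \oo] --> (EFin \o f) x}.
  by apply: aeW => x Dx; apply: cvg_EFin; [exact: nearW|exact: ff].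
have H2 : {ae mu, forall x n, D x -> (`|(EFin \o f_ n) x| <= (EFin \o g) x)%E}.
  by apply: aeW => x n Dx; rewrite lee_fin; exact: fg.
have [fi _ cvgI] := @dominated_convergence _ MR R mu D mD _ _ _ mfE mfE' H1 ig H2.
split => //; apply: fine_cvg.
by rewrite fineK// integrable_fin_num.
Qed.

Lemma cvg_Rintegral_itv f (b_ : nat -> R) :
  mu.-integrable `[0, +oo[ (EFin \o f) -> b_ n @[n --> \oo] --> +oo ->
  \int[mu]_(x in `[0, b_ n]) f x @[n --> \oo] --> \int[mu]_(x in `[0, +oo[) f x.
Proof.
move=> fi boo.
pose f_ n x := f x * \1_(`[0, b_ n]%classic) x.
have E n : \int[mu]_(x in `[0, b_ n]) f x = \int[mu]_(x in `[0, +oo[) f_ n x.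
  rewrite (_ : `[0, b_ n]%classic = `[0, +oo[%classic `&` `[0, b_ n]%classic); last first.
    by apply/esym/setIidPr => x; rewrite /= !in_itv/= andbT => /andP[].
  rewrite Rintegral_mkcondr; apply: eq_Rintegral => x _.
  rewrite /f_ patchE indicE; case: ifPn => xI.
    by rewrite mulr1.
  by rewrite mulr0.
rewrite (_ : (fun n => _) = (fun n => \int[mu]_(x in `[0, +oo[) f_ n x)); last exact/funext.
have mf : measurable_fun (`[0%R, +oo[%classic : set MR) f by have /integrableP[/measurable_EFinP] := fi.
have mD : measurable (`[0%R, +oo[%classic : set MR).
  exact: measurable_itv.
apply: (proj2 (@Rdominated_convergence _ f_ f (fun x => `|f x|) mD _ _ _ _)).
- by move=> n; apply: measurable_funM => //; exact: measurable_indic.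
- move=> x; rewrite /= in_itv/= andbT => x0.
  apply: cvg_near_cst; near=> n.
  rewrite /f_ indicE mem_set ?mulr1//= in_itv/= x0/=.
  by near: n; move/cvgryPge : boo; exact.
- rewrite [X in mu.-integrable _ X](_ : _ = abse \o (EFin \o f))//.
  exact: integrable_abse.
- move=> n x _; rewrite /f_ normrM ler_piMr// indicE.
  by case: (x \in _) => /=; rewrite ?normr1 ?normr0.
Unshelve. all: by end_near. Qed.

Lemma quartersD : quarters = `[0, +oo[%classic `\` (`[0, +oo[%classic `\` quarters).
Proof.
rewrite setDD; apply/esym/setIidPr => x /quarters_gt0 x0.
by rewrite /= in_itv/= andbT ltW.
Qed.

Lemma measurable_itv0D_quarters : measurable (`[0, +oo[%classic `\` quarters : set R).
Proof. by apply: measurableD; [exact: measurable_itv|exact: measurable_quarters]. Qed.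

Lemma itv0D_quarters0 : mu (`[0, +oo[%classic `\` quarters) = 0%E.
Proof.
have : mu ((`]0, +oo[%classic `\` quarters) `|` [set 0]) = 0%E.
  apply: null_set_setU; [|exact: measurable_set1|exact: quartersC0|].
    by apply: measurableD; [exact: measurable_itv|exact: measurable_quarters].
  exact: lebesgue_measure_set1.
apply: subset_measure0.
- exact: measurable_itv0D_quarters.
- apply: measurableU; last exact: measurable_set1.
  by apply: measurableD; [exact: measurable_itv|exact: measurable_quarters].
- move=> x [/=]; rewrite in_itv/= andbT le_eqVlt => /orP[/eqP <-|x0] nx.
    by right.
  by left; split => //=; rewrite in_itv/= x0.
Qed.

Lemma integrable_quartersP (f : R -> \bar R) : measurable_fun [set: R] f ->
  mu.-integrable `[0, +oo[ f <-> mu.-integrable quarters f.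
Proof.
move=> mf; rewrite quartersD.
apply: negligible_integrable.
- exact: measurable_itv0D_quarters.
- exact: measurable_itv.
- exact: measurable_funTS.
- exact: itv0D_quarters0.
Qed.

Lemma integral_quartersE (f : R -> \bar R) : mu.-integrable `[0, +oo[ f ->
  (\int[mu]_(x in `[0%R, +oo[) f x = \int[mu]_(x in quarters) f x)%E.
Proof.
move=> fi; rewrite [in RHS]quartersD.
apply: negligible_integral => //.
- exact: measurable_itv0D_quarters.
- exact: itv0D_quarters0.
Qed.

End RealIntegration.

(** * Rotating an integral from the positive real to the positive imaginary axis *)

Section Quadrant.
Context {R : realType}.
Local Open Scope complex_scope.
Notation mu := (@lebesgue_measure R).
Notation MR := (measurableTypeR R).
Local Notation C := (R[i]).
Implicit Types (u v a b d t M : R) (z : C) (k : C -> C).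

(** A function holomorphic on Im z > v0, with continuous derivative [k']. Because v0 < 0, the real
    axis lies inside this domain, so rectangles may have their lower edge on it. The last clause
    provides the decay that makes the vertical integrals converge. *)
Definition quadrant_kernel k (k' : C -> C) v0 M :=
  [/\ v0 < 0 /\ 0 <= M,
      forall (g : R -> C) t (l : C), v0 < Im (g t) -> Cderive g t l ->
        Cderive (fun s => k (g s)) t (l * k' (g t)),
      forall (T : Type) (F : set_system T) (h : T -> C) (l : C), Filter F ->
        v0 < Im l -> Ccvg F h l -> Ccvg F (fun s => k (h s)) (k l),
      forall (T : Type) (F : set_system T) (h : T -> C) (l : C), Filter F ->
        v0 < Im l -> Ccvg F h l -> Ccvg F (fun s => k' (h s)) (k' l) &
      forall u v, 0 <= u -> 0 <= v -> normc (k (u +i* v)) <= M / (1 + v)].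

Lemma Re_mulic z : Re ('i * z) = - Im z.
Proof. by rewrite Re_mulc/= mul0r mul1r sub0r. Qed.

(** With the denominator cleared, the difference is 2 (y cosh y - sinh y), whose derivative 2 y sinh
    y is nonnegative. *)
Lemma tanh_le x : 0 <= x -> tanh x <= x :> R.
Proof.
move=> x0.
have e0 (y : R) : 0 < expR y by exact: expR_gt0.
rewrite /tanh ler_pdivrMr ?addr_gt0// -subr_ge0.
pose f (y : R) := y * (expR y + expR (- y)) - (expR y - expR (- y)).
have df (y : R) : is_derive y 1 f (y * (expR y - expR (- y))).
  have dN : is_derive y 1 (fun y => expR (- y)) (- expR (- y)).
    apply: (is_derive_eq (is_derive1_comp (is_derive_expR (- y)) (is_deriveNid y 1))).
    by rewrite mulrN1.
  have := is_deriveB (is_deriveM (is_derive_id y 1) (is_deriveD (is_derive_expR y) dN))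
    (is_deriveB (is_derive_expR y) dN).
  move/is_derive_eq; apply; rewrite /GRing.scale/=.
  change ((expR + (fun y : R => expR (- y))) y) with (expR y + expR (- y)).
  ring.
have f00 : f 0 = 0 by rewrite /f mul0r oppr0 subrr subrr.
rewrite -/(f x) -f00.
move: x0; rewrite le_eqVlt => /orP[/eqP<-//|x0].
apply: (@ger0_derive1_le_cc _ f 0 x).
- by move=> y _; have [] := df y.
- move=> y; rewrite in_itv/= => /andP[y0 _].
  rewrite derive1E; have -> := @derive_val _ _ _ _ _ _ _ (df y).
  by rewrite mulr_ge0 ?(ltW y0)// subr_ge0 ler_expR; lra.
- by apply: continuous_in_subspaceT => y _; exact: is_derive_continuous (df y).
- by rewrite in_itv/= lexx ltW.
- by rewrite in_itv/= lexx ltW.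
- exact: ltW.
Qed.

Lemma whitham_symbol_ge0 x : 0 <= whitham_symbol x :> R.
Proof. by rewrite /whitham_symbol; case: ifP; rewrite ?sqrtr_ge0. Qed.

Lemma whitham_symbolN x : whitham_symbol (- x) = whitham_symbol x :> R.
Proof.
rewrite /whitham_symbol oppr_eq0; case: ifP => // _; congr Num.sqrt.
rewrite /tanh opprK invrN mulrN -mulNr; congr (_ / _).
by rewrite -mulNr opprB; congr (_ / _); rewrite addrC.
Qed.

Lemma whitham_symbol_le1 x : whitham_symbol x <= 1 :> R.
Proof.
wlog x0 : x / 0 <= x => [H|].
  by have [/H//|x0] := leP 0 x; rewrite -whitham_symbolN H// oppr_ge0 ltW.
rewrite /whitham_symbol; case: eqP => [//|/eqP xn0].
have xp : 0 < x by rewrite lt_def xn0.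
by rewrite -[leRHS]sqrtr1 ler_wsqrtr// ler_pdivrMr// mul1r tanh_le.
Qed.

Lemma measurable_whitham_symbol : measurable_fun [set: R] (@whitham_symbol R).
Proof.
apply: measurable_fun_ifT => //.
  exact: measurable_fun_eqr.
apply: (measurableT_comp measurable_sqrtr); apply: measurable_funM; last exact: measurable_invr.
have mN : measurable_fun [set: R] (fun x : R => expR (- x)).
  by apply: measurableT_comp => //; exact: measurable_expR.
apply: measurable_funM; first by apply: measurable_funB => //; exact: measurable_expR.
apply: (measurableT_comp measurable_invr).
by apply: measurable_funD => //; exact: measurable_expR.
Qed.

Lemma msym_symbol u : 0 < u -> msym u%:C = (whitham_symbol u)%:C.
Proof. by move=> u0; rewrite msym_real// /whitham_symbol gt_eqF. Qed.

(** The limit of [msym] at iv from the right half-plane, for v > 0 with cos v != 0. *)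
Definition msym_imag v : C := sqrt_tan_pos v -i* sqrt_tan_neg v.

Section QuadrantKernel.
Variables (k k' : C -> C) (v0 M : R).
Hypothesis kk : quadrant_kernel k k' v0 M.

Let G z := msym z * k z.
Let v00 : v0 < 0. Proof. by case: kk => -[]. Qed.
Let M0 : 0 <= M. Proof. by case: kk => -[]. Qed.

Let Cderive_u u v : Cderive (fun s => s +i* v) u 1.
Proof. by split; [exact: is_derive_id|exact: is_derive_cst]. Qed.

Let Cderive_v u v : Cderive (fun s => u +i* s) v 'i.
Proof. by split; [exact: is_derive_cst|exact: is_derive_id]. Qed.

Let G' z := msym' z * k z + msym z * k' z.

Let dG (g : R -> C) t (l : C) : 0 < Re (g t) -> v0 < Im (g t) ->
  Cderive g t l -> Cderive (fun s => G (g s)) t (l * G' (g t)).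
Proof.
move=> g0 gv dg; case: kk => _ dk _ _ _.
apply: (Cderive_eq (CderiveM (Cderive_msym g0 dg) (dk _ _ _ gv dg))).
by rewrite /G'; ring.
Qed.

Let dGu u v : 0 < u -> v0 < v -> Cderive (fun s => G (s +i* v)) u (G' (u +i* v)).
Proof.
by move=> u0 vv; have := @dG (fun s => s +i* v) u 1 u0 vv (Cderive_u u v); rewrite mul1r.
Qed.

Let dGv u v : 0 < u -> v0 < v ->
  Cderive (fun s => G (u +i* s)) v ('i * G' (u +i* v)).
Proof. by move=> u0 vv; exact: (@dG (fun s => u +i* s) v 'i u0 vv (Cderive_v u v)). Qed.

Let cG' (T : Type) (F : set_system T) {FF : Filter F} (h : T -> C) (l : C) :
  0 < Re l -> v0 < Im l -> Ccvg F h l -> Ccvg F (fun s => G' (h s)) (G' l).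
Proof.
move=> l0 lv hl; case: kk => _ _ ck ck' _.
apply: CcvgD; apply: CcvgM.
- exact: Ccvg_msym'.
- exact: ck.
- exact: Ccvg_msym.
- exact: ck'.
Qed.

Let Cderive_cts (f : R -> C) t l : Cderive f t l ->
  {for t, continuous (fun s => Re (f s))} /\ {for t, continuous (fun s => Im (f s))}.
Proof.
by move=> [d1 d2]; split; [exact: (is_derive_continuous d1)|exact: (is_derive_continuous d2)].
Qed.

Let G_le u v : 0 < u -> 0 <= v -> cos v != 0 ->
  normc (G (u +i* v)) <= Num.sqrt (`|cos v| * normc (u +i* v))^-1 * (M / (1 + v)).
Proof.
move=> u0 v_0 cv; case: kk => _ _ _ _ kM.
rewrite /G Normc.normcM ler_pM ?normc_ge0//; first exact: normc_msym_le.
by apply: kM => //; exact: ltW.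
Qed.

(** On a vertical line dz = i dv, and the real part of i G is - Im G: this is the integrand of the
    real part of the contour integral. *)
Let I u v := - Im (G (u +i* v)).

Let cts_v u v : 0 < u -> v0 < v -> {for v, continuous (I u)}.
Proof.
move=> u0 vv; have [_ cI] := Cderive_cts (dGv u0 vv).
exact: cvgN cI.
Qed.

Let cts_u u v : 0 < u -> v0 < v -> {for u, continuous (fun u => Re (G (u +i* v)))}.
Proof.
by move=> u0 vv; have [cI _] := Cderive_cts (dGu u0 vv).
Qed.

(** By Cauchy-Riemann, - Im G' is both the u-derivative of - Im G and the v-derivative of Re G,
    which is the situation of Green's formula. *)
Lemma quadrant_rectangle a b d : 0 < a -> a < b -> 0 < d ->
  \int[mu]_(v in `[0, d]) (I b v - I a v) =
  \int[mu]_(u in `[a, b]) (Re (G (u +i* d)) - Re (G (u +i* 0))).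
Proof.
move=> a0 ab d0.
apply: (@green_rectangle _ I (fun u v => Re (G (u +i* v)))
  (fun u v => - Im (G' (u +i* v))) 0 v0 a b 0 d a0 ab v00 d0).
- move=> u v u0 vv.
  by have [_ dI] := dGu u0 vv; exact: is_deriveN dI.
- move=> u v u0 vv.
  by have [dR _] := dGv u0 vv; rewrite Re_mulic in dR.
- by move=> u v; exact: cts_v.
- by move=> u v; exact: cts_u.
- move=> u v u0 vv.
  have [_ H] : Ccvg (nbhs (u, v)) (fun p : R * R => G' (p.1 +i* p.2)) (G' (u +i* v)).
    by apply: cG' => //; split; [exact: cvg_fst|exact: cvg_snd].
  exact: cvgN H.
Qed.

Let I_le u v : 0 < u -> quarters v ->
  `|I u v| <= M * quarters_dom v.
Proof.
move=> u0 qv; have vp := quarters_gt0 qv.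
have iG : `|I u v| <= normc (G (u +i* v)).
  by rewrite /I normrN; exact: normr_Im_le.
apply: le_trans iG _; apply: le_trans (G_le u0 (ltW vp) (quarters_cos_neq0 qv)) _.
rewrite /quarters_dom mulrCA ler_wpM2l// ler_wpM2r ?invr_ge0 ?addr_ge0 ?(ltW vp)//.
have c0 : 0 < `|cos v| by rewrite normr_gt0 quarters_cos_neq0.
have vz : v <= normc (u +i* v).
  by apply: le_trans (normr_Im_le _); exact: ler_norm.
have nz : 0 < normc (u +i* v) by exact: lt_le_trans vz.
by rewrite ler_wsqrtr// lef_pV2 ?posrE ?mulr_gt0// ler_pM2l.
Qed.

Let cts_norm u v : 0 < u -> {for v, continuous (fun v => I u `|v|)}.
Proof.
move=> u0; apply: continuous_comp; first exact: norm_continuous.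
by apply: cts_v => //; apply: lt_le_trans (normr_ge0 _).
Qed.

(* The integrals below only see [I u] on the right; precomposing with the norm
   makes it continuous, hence measurable, on the whole line. *)
Let mI u : 0 < u -> measurable_fun [set: R] (fun v => I u `|v|).
Proof.
by move=> u0; apply: continuous_measurable_fun => v; exact: cts_norm.
Qed.

Let int_dom : mu.-integrable quarters (EFin \o (fun v => M * quarters_dom v)).
Proof.
apply: integrable_scale; [exact: measurable_quarters|exact: integrable_quarters_dom].
Qed.

Let intI u : 0 < u -> mu.-integrable quarters (EFin \o (fun v => I u `|v|)).
Proof.
move=> u0; apply: le_integrable int_dom => //.
- exact: measurable_quarters.
- by apply/measurable_funTS/measurable_EFinP; exact: mI.
- move=> v qv /=; rewrite lee_fin (gtr0_norm (quarters_gt0 qv)).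
  by apply: le_trans (I_le u0 qv) _; exact: ler_norm.
Qed.

Let L u := \int[mu]_(v in quarters) I u `|v|.

Let cvgL u (b_ : nat -> R) : 0 < u -> b_ n @[n --> \oo] --> +oo ->
  \int[mu]_(v in `[0, b_ n]) I u `|v| @[n --> \oo] --> L u.
Proof.
move=> u0 boo.
have iI : mu.-integrable `[0, +oo[ (EFin \o (fun v => I u `|v|)).
  apply/integrable_quartersP; last exact: intI.
  by apply/measurable_EFinP; exact: mI.
have -> : L u = \int[mu]_(v in `[0, +oo[) I u `|v|.
  by rewrite /L /Rintegral integral_quartersE.
exact: cvg_Rintegral_itv.
Qed.

Let f u := whitham_symbol u * Re (k u%:C).

Let GfE u : 0 < u -> Re (G (u +i* 0)) = f u.
Proof.
move=> u0; by rewrite /G /f complexr0 msym_symbol// Re_mulc/= mul0r subr0.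
Qed.

Let npi_oo : (n.+1%:R * pi : R) @[n --> \oo] --> +oo.
Proof.
apply/cvgryPge => A; near=> n.
have : A / pi <= n.+1%:R.
  rewrite (@le_trans _ _ n%:R) ?ler_nat//; near: n; exact: nbhs_infty_ger.
by rewrite ler_pdivrMr// pi_gt0.
Unshelve. all: by end_near. Qed.

Let cos_npi (n : nat) : `|cos (n%:R * pi) : R| = 1.
Proof.
elim: n => [|n IHn]; first by rewrite mul0r cos0 normr1.
by rewrite -natr1 mulrDl mul1r cosDpi normrN.
Qed.

(** The height of the rectangle tends to infinity through multiples of pi, where |cos| = 1 keeps the
    symbol bounded on the top edge while the kernel tends to 0. *)
Lemma quadrant_diff a b : 0 < a -> a < b ->
  L b - L a = - \int[mu]_(u in `[a, b]) f u.
Proof.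
move=> a0 ab; have b0 := lt_trans a0 ab.
have cGu v u : 0 <= v -> 0 < u -> {for u, continuous (fun u => Re (G (u +i* v)))}.
  by move=> v_0 u0; apply: cts_u => //; exact: lt_le_trans v_0.
have iG v : 0 <= v -> mu.-integrable `[a, b] (EFin \o (fun u => Re (G (u +i* v)))).
  move=> v_0; apply: continuous_integrable_itv => u; rewrite in_itv/= => /andP[au _].
  by apply: cGu => //; exact: lt_le_trans au.
have iI c d : 0 < c -> mu.-integrable `[0, d] (EFin \o (fun v => I c `|v|)).
  by move=> c0; apply: continuous_integrable_itv => v _; exact: cts_norm.
have E (n : nat) : \int[mu]_(v in `[0, n.+1%:R * pi]) I b `|v| -
    \int[mu]_(v in `[0, n.+1%:R * pi]) I a `|v| =
    \int[mu]_(u in `[a, b]) Re (G (u +i* (n.+1%:R * pi))) -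
    \int[mu]_(u in `[a, b]) f u.
  have n0 : 0 < n.+1%:R * pi :> R by rewrite mulr_gt0// pi_gt0.
  have := quadrant_rectangle a0 ab n0.
  rewrite [RHS]RintegralB//; [|exact: iG (ltW n0)|exact: iG (lexx _)].
  move=> H; rewrite -RintegralB//; [|exact: iI|exact: iI].
  have -> : \int[mu]_(u in `[a, b]) f u = \int[mu]_(u in `[a, b]) Re (G (u +i* 0)).
    apply: eq_Rintegral => u; rewrite inE/= in_itv/= => /andP[au _].
    by rewrite GfE//; exact: lt_le_trans au.
  rewrite -H; apply: eq_Rintegral => v; rewrite inE/= in_itv/= => /andP[v_0 _].
  by rewrite ger0_norm.
have lhs : \int[mu]_(v in `[0, n.+1%:R * pi]) I b `|v| -
    \int[mu]_(v in `[0, n.+1%:R * pi]) I a `|v| @[n --> \oo] --> L b - L a.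
  by apply: cvgB; exact: cvgL.
have rhs : \int[mu]_(u in `[a, b]) Re (G (u +i* (n.+1%:R * pi))) -
    \int[mu]_(u in `[a, b]) f u @[n --> \oo] --> 0 - \int[mu]_(u in `[a, b]) f u.
  apply: cvgB; last exact: cvg_cst.
  (* On the top edge |z| >= u >= a gives |msym z| <= a^(-1/2), the kernel is at most M over the
     height, and the edge has length b - a. *)
  pose c := Num.sqrt a^-1 * M * (b - a).
  have c0 : 0 <= c by rewrite !mulr_ge0 ?sqrtr_ge0// subr_ge0 ltW.
  apply: norm_cvg0.
  have h : c * (n.+1%:R * pi)^-1 @[n --> \oo] --> (0 : R).
    rewrite -[X in _ --> X](mulr0 c); apply: cvgM; first exact: cvg_cst.
    apply/gtr0_cvgV0 => //.
    by apply: nearW => n; rewrite mulr_gt0// pi_gt0.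
  apply: (@squeeze_cvgr _ _ _ _ (cst 0) (fun n => c * (n.+1%:R * pi)^-1)) => //; last exact: cvg_cst.
  apply: nearW => n; rewrite normr_ge0/=.
  have n0 : 0 < n.+1%:R * pi :> R by rewrite mulr_gt0// pi_gt0.
  have iGn := iG _ (ltW n0).
  apply: le_trans (le_normr_Rintegral _ iGn) _; first exact: measurable_itv.
  have -> : c * (n.+1%:R * pi)^-1 =
      \int[mu]_(u in `[a, b]) (Num.sqrt a^-1 * M * (n.+1%:R * pi)^-1).
    rewrite Rintegral_cst; last exact: measurable_itv.
    have muab : mu `[a, b]%classic = (b - a)%:E.
      by rewrite lebesgue_measure_itv/= lte_fin ab -EFinB.
    by rewrite [X in fine X](_ : _ = (b - a)%:E)//= /c; ring.
  apply: le_Rintegral; first exact: measurable_itv.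
  - rewrite [X in mu.-integrable _ X](_ : _ = abse \o (EFin \o (fun u => Re (G (u +i* (n.+1%:R * pi))))))//.
    exact: integrable_abse.
  - by apply: continuous_integrable_itv => x _; exact: cvg_cst.
  - move=> u; rewrite /= in_itv/= => /andP[au _].
    have u0 : 0 < u by exact: lt_le_trans au.
    apply: le_trans (normr_Re_le _) _.
    have cn : cos (n.+1%:R * pi) != 0 :> R.
      by rewrite -normr_eq0 cos_npi oner_eq0.
    apply: le_trans (G_le u0 (ltW n0) cn) _.
    rewrite cos_npi mul1r -mulrA ler_pM ?sqrtr_ge0 ?divr_ge0 ?addr_ge0 ?(ltW n0)//.
      rewrite ler_wsqrtr//.
      have uz : u <= normc (u +i* (n.+1%:R * pi)).
        by apply: le_trans (normr_Re_le _); exact: ler_norm.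
      have nz := lt_le_trans u0 uz.
      by rewrite lef_pV2 ?posrE//; exact: le_trans uz.
    rewrite ler_wpM2l// lef_pV2 ?posrE ?addr_gt0//.
    by rewrite lerDr.
rewrite sub0r in rhs; apply: (cvg_unique _ _ rhs) => //.
apply: cvg_trans lhs; apply: near_eq_cvg; apply: nearW => n; exact: E.
Qed.

Let J v := - Im (msym_imag v * k (0 +i* v)).

Let cvgI v : quarters v -> I u `|v| @[u --> 0^'+] --> J v.
Proof.
move=> qv; have vp := quarters_gt0 qv; case: kk => _ _ ck _ _.
rewrite (gtr0_norm vp).
have H : Ccvg 0^'+ (fun u => G (u +i* v)) (msym_imag v * k (0 +i* v)).
  apply: CcvgM; first by apply: Ccvg_msym_imag => //; exact: quarters_cos_neq0.
  apply: ck; first exact: lt_trans vp.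
  by split; [exact: cvg_at_right_filter cvg_id|exact: cvg_cst].
exact: cvgN H.2.
Qed.

Lemma quadrant_boundary :
  mu.-integrable quarters (EFin \o J) /\
  L n.+1%:R^-1 @[n --> \oo] --> \int[mu]_(v in quarters) J v.
Proof.
apply: (@Rdominated_convergence _ _ (fun n v => I n.+1%:R^-1 `|v|) J
  (fun v => M * quarters_dom v)) => //.
- exact: measurable_quarters.
- by move=> n; apply: measurable_funTS; exact: mI.
- move=> v qv; have /cvg_at_rightP := cvgI qv; apply.
  by split=> [n|]; [rewrite invr_gt0|exact: cvg_harmonic].
- by move=> n v qv; rewrite (gtr0_norm (quarters_gt0 qv)); exact: I_le.
Qed.

Let f_le u : 0 <= u -> `|f u| <= M.
Proof.
move=> u0; rewrite /f normrM (ger0_norm (whitham_symbol_ge0 u)).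
rewrite -[leRHS]mul1r ler_pM ?whitham_symbol_ge0 ?whitham_symbol_le1//.
apply: le_trans (normr_Re_le _) _; case: kk => _ _ _ _ kM.
by have := kM u 0 u0 (lexx _); rewrite addr0 divr1 complexr0.
Qed.

Let mf : measurable_fun [set: R] f.
Proof.
apply: measurable_funM; first exact: measurable_whitham_symbol.
apply: continuous_measurable_fun => u; case: kk => _ _ ck _ _.
have [|cR _] := ck _ (nbhs u) (fun s => s%:C) u%:C _ v00; last exact: cR.
by split; [exact: cvg_id|exact: cvg_cst].
Qed.

(** The left edge moves to the imaginary axis. On the real segment the integrand is bounded by [M],
    and the vertical integral converges by [quadrant_boundary]. *)
Lemma quadrant_segment b : 0 < b ->
  \int[mu]_(u in `[0, b]) f u = \int[mu]_(v in quarters) J v - L b.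
Proof.
move=> b0.
pose a_ (n : nat) : R := n.+1%:R^-1.
have a0 n : 0 < a_ n by rewrite invr_gt0.
have a_0 : a_ n @[n --> \oo] --> 0 by exact: cvg_harmonic.
pose f_ (n : nat) (x : R) : R := f x * \1_(`[a_ n, b]%classic) x.
have E n : \int[mu]_(x in `[a_ n, b]) f x = \int[mu]_(x in `]0, b]) f_ n x.
  rewrite (_ : `[a_ n, b]%classic = `]0, b]%classic `&` `[a_ n, b]%classic); last first.
    apply/esym/setIidPr => x; rewrite /= !in_itv/= => /andP[ax ->].
    by rewrite andbT; exact: lt_le_trans ax.
  rewrite Rintegral_mkcondr; apply: eq_Rintegral => x _.
  rewrite /f_ patchE indicE; case: ifPn => xI; first by rewrite mulr1.
  by rewrite mulr0.
have mD : measurable (`]0, b]%classic : set MR).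
  exact: measurable_itv.
have iM : mu.-integrable `]0, b] (EFin \o cst M).
  apply: (@integrableS _ _ _ mu `[0, b]%classic) => //.
  - by apply: subset_itvr; rewrite bnd_simp.
  - by apply: continuous_integrable_itv => x _; exact: cvg_cst.
have [] := @Rdominated_convergence _ _ f_ f (cst M) mD _ _ iM _.
- move=> n; apply: measurable_funTS; apply: measurable_funM; first exact: mf.
  exact: measurable_indic.
- move=> x; rewrite /= in_itv/= => /andP[x0 xb].
  apply: cvg_near_cst; near=> n.
  rewrite /f_ indicE mem_set ?mulr1//= in_itv/= xb andbT.
  near: n; exact: (cvgr_le _ a_0 _ x0).
- move=> n x; rewrite /= in_itv/= => /andP[x0 _].
  rewrite /f_ normrM; apply: le_trans (f_le (ltW x0)).
  rewrite ler_piMr// indicE.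
  by case: (x \in _) => /=; rewrite ?normr1 ?normr0.
move=> intf cvgf.
rewrite Rintegral_itv_obnd_cbnd in cvgf; last exact: intf.
have lhs : L b - L (a_ n) @[n --> \oo] --> L b - \int[mu]_(v in quarters) J v.
  by apply: cvgB; [exact: cvg_cst|exact: quadrant_boundary.2].
have rhs : L b - L (a_ n) @[n --> \oo] --> - \int[mu]_(u in `[0, b]) f u.
  apply: cvg_trans (cvgN cvgf); apply: near_eq_cvg; near=> n.
  transitivity (- \int[mu]_(x in `[a_ n, b]) f x); first by rewrite E.
  rewrite -quadrant_diff//.
  near: n; exact: (cvgr_lt _ a_0 _ b0).
by rewrite -[RHS]opprB -(cvg_unique _ rhs lhs) ?opprK.
Unshelve. all: by end_near. Qed.

(** For fixed v the symbol is O(b^(-1/2)) at b + iv, and the majorant used near the imaginary axis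
    does not depend on the abscissa. *)
Lemma cvg_vertical_line : L b @[b --> +oo] --> (0 : R).
Proof.
apply/cvg_pinftyP => b_ boo.
(* A sequence tending to +oo may start with nonpositive terms, for which no bound on the line is
   available; the maximum agrees with it eventually. *)
pose c_ n := Num.max (b_ n) 1.
have c1 n : 1 <= c_ n by rewrite le_max lexx orbT.
have c0 n : 0 < c_ n by exact: lt_le_trans (c1 n).
have coo : c_ n @[n --> \oo] --> +oo.
  apply/cvgryPge => A; move/cvgryPge : boo => /(_ A); apply: filterS => n An.
  by rewrite le_max An.
have cV : (c_ n)^-1 @[n --> \oo] --> (0 : R).
  by apply/gtr0_cvgV0 => //; exact: nearW.
have H : L (c_ n) @[n --> \oo] --> \int[mu]_(v in quarters) (cst 0 v).
  have mq := @measurable_quarters R.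
  apply: (proj2 (@Rdominated_convergence _ _ (fun n v => I (c_ n) `|v|) (cst 0)
    (fun v => M * quarters_dom v) mq _ _ int_dom _)).
  - by move=> n; apply: measurable_funTS; exact: mI.
  - move=> v qv; have vp := quarters_gt0 qv; rewrite (gtr0_norm vp).
    have k0 : 0 < `|cos v| by rewrite normr_gt0 quarters_cos_neq0.
    apply: norm_cvg0.
    have h : Num.sqrt (`|cos v|^-1 * (c_ n)^-1) * M @[n --> \oo] --> (0 : R).
      rewrite -[X in _ --> X](mul0r M); apply: cvgM; last exact: cvg_cst.
      rewrite -[X in _ --> X]sqrtr0; apply: (@cvg_continuous _ _ _ _ _ Num.sqrt).
        exact: sqrt_continuous.
      by rewrite -(mulr0 `|cos v|^-1); apply: cvgM => //; exact: cvg_cst.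
    apply: (@squeeze_cvgr _ _ _ _ (cst 0) _ _ _ _ _ h); last exact: cvg_cst.
    apply: nearW => n; rewrite normr_ge0/= /I normrN.
    apply: le_trans (normr_Im_le _) _.
    apply: le_trans (G_le (c0 n) (ltW vp) (quarters_cos_neq0 qv)) _.
    have cz : c_ n <= normc (c_ n +i* v).
      by apply: le_trans (normr_Re_le _); exact: ler_norm.
    have nz : 0 < normc (c_ n +i* v) by exact: lt_le_trans cz.
    rewrite -invfM ler_pM ?sqrtr_ge0 ?divr_ge0 ?addr_ge0 ?(ltW vp)//.
      by rewrite ler_wsqrtr// lef_pV2 ?posrE ?mulr_gt0// ler_pM2l.
    by rewrite ler_pdivrMr ?addr_gt0// ler_peMr// lerDl ltW.
  - by move=> n v qv; rewrite (gtr0_norm (quarters_gt0 qv)); exact: I_le.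
rewrite Rintegral_cst ?mul0r in H; last exact: measurable_quarters.
apply: cvg_trans H; apply: near_eq_cvg.
move/cvgryPge : boo => /(_ 1); apply: filterS => n b1.
by rewrite /c_ max_l.
Qed.

(** This records the real part of the rotation; a constant factor of modulus one in the kernel
    yields the imaginary part. The limit in [b] is essential, as the left-hand integrals may
    converge only conditionally. *)
Theorem quadrant_formula :
  mu.-integrable quarters
    (fun v => (- Im (msym_imag v * k (0 +i* v)))%:E) /\
  \int[mu]_(u in `[0, b]) (whitham_symbol u * Re (k u%:C)) @[b --> +oo] -->
  \int[mu]_(v in quarters) (- Im (msym_imag v * k (0 +i* v))).
Proof.
split; first exact: quadrant_boundary.1.
have h : \int[mu]_(v in quarters) J v - L b @[b --> +oo] -->
    \int[mu]_(v in quarters) J v - 0.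
  by apply: cvgB; [exact: cvg_cst|exact: cvg_vertical_line].
rewrite subr0 in h; apply: cvg_trans h; apply: near_eq_cvg; near=> b.
by rewrite quadrant_segment.
Unshelve. all: by end_near. Qed.

End QuadrantKernel.
End Quadrant.

(** * The exponential and pole kernels; the symbol as a Stieltjes integral *)

Section Kernels.
Context {R : realType}.
Local Open Scope complex_scope.
Notation mu := (@lebesgue_measure R).
Notation MR := (measurableTypeR R).
Local Notation C := (R[i]).
Implicit Types (u v a b t x e eta M : R) (z : C).

(** The constant [c] is 1 for cosine and -i for sine. The decay comes from e^(xv) >= 1 + xv, and (1
    + v) / (1 + xv) <= 1 + 1/x. *)
Lemma exp_kernel (c : C) x : normc c = 1 -> 0 < x ->
  quadrant_kernel (fun z => c * cexp ('i * x%:C * z))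
    (fun z => c * ('i * x%:C * cexp ('i * x%:C * z))) (-1) (1 + x^-1).
Proof.
move=> c1 x0; split.
- by split; [rewrite oppr_lt0|rewrite addr_ge0// invr_ge0 ltW].
- move=> g t l _ dg.
  have dz : Cderive (fun s => 'i * x%:C * g s) t ('i * x%:C * l).
    by apply: (Cderive_eq (CderiveM (Cderive_cst _ t) dg)); rewrite mul0r add0r.
  apply: (Cderive_eq (CderiveM (Cderive_cst c t) (Cderive_exp dz))).
  by rewrite mul0r add0r; ring.
- move=> T F h l FF _ hl; apply: CcvgM; first exact: Ccvg_cst.
  by apply: Ccvg_exp; apply: CcvgM => //; exact: Ccvg_cst.
- move=> T F h l FF _ hl; apply: CcvgM; first exact: Ccvg_cst.
  apply: CcvgM; first exact: Ccvg_cst.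
  by apply: Ccvg_exp; apply: CcvgM => //; exact: Ccvg_cst.
- move=> u v u0 v0; rewrite Normc.normcM c1 mul1r normc_cexp.
  have -> : Re ('i * x%:C * (u +i* v)) = - (x * v) by rewrite !Re_mulc !Im_mulc/=; ring.
  have p : 0 < 1 + x * v by rewrite ltr_pwDl// mulr_ge0// ltW.
  apply: (@le_trans _ _ (1 + x * v)^-1).
    rewrite expRN lef_pV2 ?posrE ?expR_gt0//; exact: expR_ge1Dx.
  rewrite ler_pdivlMr ?ltr_pwDl// mulrC ler_pdivrMr//.
  have -> : (1 + x^-1) * (1 + x * v) = 1 + v + (x * v + x^-1).
    by field; rewrite gt_eqF.
  by rewrite lerDl addr_ge0 ?mulr_ge0 ?invr_ge0 ?(ltW x0).
Qed.

Lemma cexp_imul x u v :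
  cexp ('i * x%:C * (u +i* v)) = (expR (- (x * v)))%:C * cis (x * u).
Proof.
rewrite /cexp; congr ((expR _)%:C * cis _).
  by rewrite !Re_mulc !Im_mulc/=; ring.
by rewrite Im_mulc !Re_mulc !Im_mulc/=; ring.
Qed.

Lemma cvg_symbol_cos x : 0 < x ->
  mu.-integrable quarters (fun v => (sqrt_tan_neg v * expR (- (x * v)))%:E) /\
  \int[mu]_(u in `[0, b]) (whitham_symbol u * cos (x * u)) @[b --> +oo] -->
  \int[mu]_(v in quarters) (sqrt_tan_neg v * expR (- (x * v))).
Proof.
move=> x0; have n1 : normc (1 : C) = 1 by rewrite Normc.normc1.
have [i c] := quadrant_formula (exp_kernel n1 x0).
have JE v : sqrt_tan_neg v * expR (- (x * v)) =
    - Im (msym_imag v * (1 * cexp ('i * x%:C * (0 +i* v)))).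
  by rewrite cexp_imul mulr0 /cis cos0 sin0 mul1r !Im_mulc !Re_mulc/=; ring.
have KE u : cos (x * u) = Re (1 * cexp ('i * x%:C * u%:C)).
  by rewrite mul1r -complexr0 cexp_imul mulr0 oppr0 expR0 mul1r.
split.
  by under eq_fun do rewrite JE.
have -> : \int[mu]_(v in quarters) (sqrt_tan_neg v * expR (- (x * v))) =
    \int[mu]_(v in quarters) (- Im (msym_imag v * (1 * cexp ('i * x%:C * (0 +i* v))))).
  by apply: eq_Rintegral => v _; exact: JE.
by under eq_fun do under eq_Rintegral do rewrite KE.
Qed.

(** Serves the imaginary part of the truncated kernel: since a limit exists, the difference of two
    sine integrals with independent upper ends tends to 0. *)
Lemma cvg_symbol_sin x : 0 < x ->
  \int[mu]_(u in `[0, b]) (whitham_symbol u * sin (x * u)) @[b --> +oo] -->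
  \int[mu]_(v in quarters) (sqrt_tan_pos v * expR (- (x * v))).
Proof.
move=> x0; have n1 : normc (- 'i : C) = 1.
  by rewrite normc_ReIm/= oppr0 expr0n/= sqrrN expr1n add0r sqrtr1.
have [i c] := quadrant_formula (exp_kernel n1 x0).
have JE v : sqrt_tan_pos v * expR (- (x * v)) =
    - Im (msym_imag v * (- 'i * cexp ('i * x%:C * (0 +i* v)))).
  rewrite cexp_imul mulr0 /cis cos0 sin0.
  by rewrite !Im_mulc !Re_mulc/=; ring.
have KE u : sin (x * u) = Re (- 'i * cexp ('i * x%:C * u%:C)).
  by rewrite -complexr0 cexp_imul mulr0 oppr0 expR0 mul1r Re_mulc/=; ring.
have -> : \int[mu]_(v in quarters) (sqrt_tan_pos v * expR (- (x * v))) =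
    \int[mu]_(v in quarters) (- Im (msym_imag v * (- 'i * cexp ('i * x%:C * (0 +i* v))))).
  by apply: eq_Rintegral => v _; exact: JE.
by under eq_fun do under eq_Rintegral do rewrite KE.
Qed.

(** The pole eta - ie lies below the real axis, on which the real part of the kernel is the Poisson
    kernel e / (e^2 + (u - eta)^2). The constant comes from (1 + v) / (e + v) <= 1 + 1/e. *)
Lemma pole_kernel e eta : 0 < e ->
  quadrant_kernel (fun z => (e +i* eta - 'i * z)^-1)
    (fun z => 'i / (e +i* eta - 'i * z) ^+ 2) (- e) (1 + e^-1).
Proof.
move=> e0.
have p0 z : - e < Im z -> e +i* eta - 'i * z != 0.
  move=> ez; apply: Re_gt0_neq0.
  by rewrite Re_addc Re_oppc Re_mulic opprK/=; lra.
have hp (T : Type) (F : set_system T) (h : T -> C) (l : C) : Filter F ->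
    Ccvg F h l -> Ccvg F (fun s => e +i* eta - 'i * h s) (e +i* eta - 'i * l).
  move=> FF hl; apply: CcvgD; first exact: Ccvg_cst.
  by apply: CcvgN; apply: CcvgM => //; exact: Ccvg_cst.
split.
- by split; [rewrite oppr_lt0|rewrite addr_ge0// invr_ge0 ltW].
- move=> g t l gl dg.
  have dz : Cderive (fun s => e +i* eta - 'i * g s) t (- ('i * l)).
    have dN : Cderive (fun s => - 'i * g s) t (- 'i * l).
      by apply: (Cderive_eq (CderiveM (Cderive_cst _ t) dg)); rewrite mul0r add0r.
    have := CderiveD (Cderive_cst (e +i* eta) t) dN.
    rewrite add0r mulNr.
    by under eq_fun do rewrite mulNr.
  apply: (Cderive_eq (CderiveV (p0 _ gl) dz)).
  by rewrite opprK -mulrA mulrCA.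
- by move=> T F h l FF ll hl; apply: CcvgV; [exact: p0|exact: hp].
- move=> T F h l FF ll hl; apply: CcvgM; first exact: Ccvg_cst.
  apply: CcvgV; first by rewrite expf_neq0// p0.
  under [X in Ccvg F X]eq_fun do rewrite expr2.
  by rewrite expr2; apply: CcvgM; exact: hp.
- move=> u v u0 v0; rewrite Normc.normcV.
  have ev : 0 < e + v by rewrite ltr_pwDl.
  apply: (@le_trans _ _ (e + v)^-1).
    have h : e + v <= normc (e +i* eta - 'i * (u +i* v)).
      apply: le_trans (normr_Re_le _); apply: le_trans (ler_norm _).
      by rewrite Re_addc Re_oppc Re_mulic opprK.
    by rewrite lef_pV2 ?posrE//; exact: lt_le_trans h.
  rewrite ler_pdivlMr ?ltr_pwDl// mulrC ler_pdivrMr//.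
  have -> : (1 + e^-1) * (e + v) = 1 + v + (e + v / e).
    by field; rewrite gt_eqF.
  by rewrite lerDl addr_ge0 ?mulr_ge0 ?invr_ge0 ?(ltW e0).
Qed.

(** The Poisson kernel of the line folded onto the half-line. Adding the term for -eta also cancels,
    on the imaginary axis, the contribution of [sqrt_tan_pos], which is odd in eta. *)
Definition poisson e eta u : R :=
  e / (e ^+ 2 + (u - eta) ^+ 2) + e / (e ^+ 2 + (u + eta) ^+ 2).

Lemma cauchy_kernel_continuous e y : 0 < e ->
  continuous (fun u : R => e / (e ^+ 2 + (u - y) ^+ 2)).
Proof.
move=> e0 u; apply: cvgM; first exact: cvg_cst.
apply: cvgV; first by rewrite gt_eqF// ltr_pwDl ?exprn_gt0// sqr_ge0.
apply: cvgD; first exact: cvg_cst.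
have cs : {for u, continuous (fun u => u - y)}.
  by apply: cvgB; [exact: cvg_id|exact: cvg_cst].
by rewrite /continuous_at expr2; under eq_fun do rewrite expr2; exact: (cvgM cs cs).
Qed.

Lemma poisson_continuous e eta : 0 < e -> continuous (poisson e eta).
Proof.
move=> e0 u; have := @cauchy_kernel_continuous e (- eta) e0 u.
rewrite opprK; exact: cvgD (@cauchy_kernel_continuous e eta e0 u).
Qed.

Lemma integrable_symbolM (g : R -> R) a b : continuous g ->
  mu.-integrable `[a, b] (EFin \o (fun u => whitham_symbol u * g u)).
Proof.
move=> cg.
have ig : mu.-integrable `[a, b] (EFin \o g).
  by apply: continuous_integrable_itv => u _; exact: cg.
apply: le_integrable ig => //.
- apply/measurable_EFinP/measurable_funTS; apply: measurable_funM.
    exact: measurable_whitham_symbol.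
  exact: continuous_measurable_fun.
- move=> u _; rewrite /= lee_fin normrM ler_piMl//.
  by rewrite ger0_norm ?whitham_symbol_ge0// whitham_symbol_le1.
Qed.

Lemma cvg_symbol_poisson e eta : 0 < e ->
  mu.-integrable quarters (EFin \o (fun v =>
    2 * sqrt_tan_neg v * ((e + v) / ((e + v) ^+ 2 + eta ^+ 2)))) /\
  \int[mu]_(u in `[0, b]) (whitham_symbol u * poisson e eta u) @[b --> +oo] -->
  \int[mu]_(v in quarters)
    (2 * sqrt_tan_neg v * ((e + v) / ((e + v) ^+ 2 + eta ^+ 2))).
Proof.
move=> e0.
have H y := quadrant_formula (pole_kernel y e0).
have [i1 c1] := H eta; have [i2 c2] := H (- eta).
have RE y u : Re (e +i* y - 'i * u%:C)^-1 = e / (e ^+ 2 + (u - y) ^+ 2).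
  rewrite Re_invc !Re_addc !Im_addc !Re_oppc !Im_oppc Re_mulic Im_mulc/=.
  by congr (_ / (_ + _)); ring.
have Hi y b : mu.-integrable `[0, b]
    (EFin \o (fun u => whitham_symbol u * Re (e +i* y - 'i * u%:C)^-1)).
  rewrite (_ : (fun u => _) =
      (fun u => whitham_symbol u * (e / (e ^+ 2 + (u - y) ^+ 2)))).
    apply: (@integrable_symbolM (fun u => e / (e ^+ 2 + (u - y) ^+ 2)) 0 b).
    exact: cauchy_kernel_continuous.
  by apply/funext => u; rewrite RE.
have IE y v : quarters v ->
    - Im (msym_imag v * (e +i* y - 'i * (0 +i* v))^-1) =
    (sqrt_tan_pos v * y + sqrt_tan_neg v * (e + v)) / ((e + v) ^+ 2 + y ^+ 2).
  move=> qv; have vp := quarters_gt0 qv.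
  have d0 : (e + v) ^+ 2 + y ^+ 2 != 0.
    by rewrite gt_eqF// ltr_pwDl ?sqr_ge0// exprn_gt0// addr_gt0.
  have -> : e +i* y - 'i * (0 +i* v) = (e + v) +i* y.
    apply/eqP; rewrite eq_complex Re_addc Im_addc Re_oppc Im_oppc Re_mulic Im_mulc/=.
    by apply/andP; split; apply/eqP; ring.
  rewrite Im_mulc Re_invc Im_invc/=.
  by field.
have JE v : quarters v ->
    - Im (msym_imag v * (e +i* eta - 'i * (0 +i* v))^-1) +
    - Im (msym_imag v * (e +i* - eta - 'i * (0 +i* v))^-1) =
    2 * sqrt_tan_neg v * ((e + v) / ((e + v) ^+ 2 + eta ^+ 2)).
  move=> qv; have vp := quarters_gt0 qv; rewrite !IE// sqrrN.
  have d0 : (e + v) ^+ 2 + eta ^+ 2 != 0.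
    by rewrite gt_eqF// ltr_pwDl ?sqr_ge0// exprn_gt0// addr_gt0.
  by field.
have mq := @measurable_quarters R.
split.
  have := integrableD mq i1 i2; apply: eq_integrable => // v /set_mem qv.
  by rewrite /= -EFinD JE.
have cD := cvgD c1 c2.
rewrite -RintegralD// in cD.
rewrite (_ : \int[mu]_(v in quarters) _ = \int[mu]_(v in quarters)
  (- Im (msym_imag v * (e +i* eta - 'i * (0 +i* v))^-1) +
   - Im (msym_imag v * (e +i* - eta - 'i * (0 +i* v))^-1))); last first.
  by apply: eq_Rintegral => v /set_mem qv; rewrite JE.
rewrite (_ : (fun b => _) = (fun b =>
   \int[mu]_(u in `[0, b]) (whitham_symbol u * Re (e +i* eta - 'i * u%:C)^-1) +
   \int[mu]_(u in `[0, b]) (whitham_symbol u * Re (e +i* - eta - 'i * u%:C)^-1))); first exact: cD.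
apply/funext => b; rewrite -RintegralD//.
by apply: eq_Rintegral => u _; rewrite !RE opprK -mulrDr.
Qed.

Lemma is_derive_atan_scaled e y u : 0 < e ->
  is_derive u 1 (fun u => atan ((u - y) / e)) (e / (e ^+ 2 + (u - y) ^+ 2)).
Proof.
move=> e0.
have d1 : is_derive u 1 (fun u : R => (u - y) / e) e^-1.
  have := is_deriveM (is_deriveB (is_derive_id u 1) (is_derive_cst y u 1))
    (is_derive_cst e^-1 u 1).
  by move/is_derive_eq; apply; rewrite /GRing.scale/=; ring.
have := @is_derive1_comp _ atan (fun u : R => (u - y) / e) _ _ _
  (is_derive1_atan _) d1.
move/is_derive_eq; apply; field.
rewrite !gt_eqF//=; last by rewrite ltr_pwDl ?exprn_gt0// sqr_ge0.
Qed.

Lemma integral_poisson e eta b : 0 < e -> 0 < b ->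
  \int[mu]_(u in `[0, b]) poisson e eta u =
  atan ((b - eta) / e) + atan ((b + eta) / e).
Proof.
move=> e0 b0.
have pE : poisson e eta = fun u =>
    e / (e ^+ 2 + (u - eta) ^+ 2) + e / (e ^+ 2 + (u - - eta) ^+ 2).
  by apply/funext => u; rewrite opprK.
rewrite (@RFTC2 _ _ (fun u => atan ((u - eta) / e) + atan ((u - - eta) / e)) _ _ b0).
- by rewrite !sub0r !opprK mulNr atanN addNr subr0.
- by move=> u _; rewrite pE; apply: is_deriveD; exact: is_derive_atan_scaled.
- by move=> u _; exact: poisson_continuous.
Qed.

Lemma cvg_integral_poisson e eta : 0 < e ->
  \int[mu]_(u in `[0, b]) poisson e eta u @[b --> +oo] --> (pi : R).
Proof.
move=> e0.
have h y : atan ((b + y) / e) @[b --> +oo] --> (pi / 2 : R).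
  have hy : ((b + y) / e) @[b --> +oo] --> +oo.
    apply/cvgryPge => A; near=> b; rewrite ler_pdivlMr//.
    by rewrite -lerBlDr; near: b; apply: nbhs_pinfty_ge; exact: num_real.
  exact: (cvg_comp _ _ hy (@cvgy_atan R)).
have : atan ((b + - eta) / e) + atan ((b + eta) / e) @[b --> +oo] --> (pi / 2 + pi / 2 : R).
  by apply: cvgD; exact: h.
rewrite -splitr; apply: cvg_trans; apply: near_eq_cvg; near=> b.
by rewrite integral_poisson.
Unshelve. all: by end_near. Qed.

Lemma is_derive_lipschitz (f : R -> R) x (l : R) : is_derive x 1 f l ->
  exists2 r : R, 0 < r & forall y, `|y - x| < r ->
    `|f y - f x| <= (`|l| + 1) * `|y - x|.
Proof.
move=> [df fl]; move: df; rewrite /derivable => /cvg_ex[l' hl'].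
have ll : l' = l.
  by rewrite -fl; apply/esym/cvg_lim.
rewrite {}ll in hl'.
move/cvgrPdist_le : hl' => /(_ 1 ltr01).
move=> /nbhs_ballP[r /= r0 Hr]; exists r => // y yx.
have [->|yn] := eqVneq y x; first by rewrite !subrr !normr0 mulr0.
have h0 : y - x != 0 by rewrite subr_eq0.
have := Hr (y - x); rewrite /ball/= sub0r normrN => /(_ yx h0).
rewrite /GRing.scale/= mulr1 subrK => Hy.
have : `|(y - x)^-1 * (f y - f x)| <= `|l| + 1.
  rewrite -[X in `|X|](subrK l) addrC.
  by apply: le_trans (ler_normD _ _) _; rewrite lerD2l distrC.
by rewrite normrM normfV ler_pdivrMl ?normr_gt0// mulrC.
Qed.

(** Near [eta] this is differentiability of [msym]; at distance at least d the values in [0, 1]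
    differ by at most 1 <= |u - eta| / d. The linear factor compensates the concentration of the
    Poisson kernel at [eta]. *)
Lemma whitham_symbol_lipschitz eta : 0 < eta ->
  exists M : R, forall u, 0 <= u ->
    `|whitham_symbol u - whitham_symbol eta| <= M * `|u - eta|.
Proof.
move=> eta0.
have dz : Cderive (fun s : R => s%:C) eta 1.
  by split; [exact: is_derive_id|exact: is_derive_cst].
have [dm _] := @Cderive_msym _ (fun s => s%:C) eta 1 eta0 dz.
have [r r0 Hr] := is_derive_lipschitz dm.
have mE u : 0 < u -> Re (msym u%:C) = whitham_symbol u by move=> /msym_symbol ->.
set l := Re (1 * _) in Hr.
pose d := Num.min r eta.
have d0 : 0 < d by rewrite lt_min r0.
exists (`|l| + 1 + d^-1) => u u0.
have [ud|du] := ltP `|u - eta| d.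
  have up : 0 < u.
    move: ud; rewrite lt_min => /andP[_]; rewrite ltr_norml => /andP[+ _].
    by rewrite ltrBrDl subrr.
  have ur : `|u - eta| < r by move: ud; rewrite lt_min => /andP[].
  have := Hr u ur; rewrite !mE// => H; apply: le_trans H _.
  by rewrite ler_wpM2r// lerDl invr_ge0 ltW.
apply: (@le_trans _ _ 1).
  have := whitham_symbol_ge0 u; have := whitham_symbol_ge0 eta.
  have := whitham_symbol_le1 u; have := whitham_symbol_le1 eta.
  by move=> *; rewrite ler_norml; apply/andP; split; lra.
apply: (@le_trans _ _ (d^-1 * `|u - eta|)).
  by rewrite mulrC ler_pdivlMr// mul1r.
by rewrite ler_wpM2r// lerDr addr_ge0.
Qed.

Lemma integrable_cauchy_kernel y :
  mu.-integrable `[0, +oo[ (EFin \o (fun u => (1 + (u - y) ^+ 2)^-1)).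
Proof.
have cE : (fun u : R => (1 + (u - y) ^+ 2)^-1) = (fun u => 1 / (1 ^+ 2 + (u - y) ^+ 2)).
  by apply/funext => u; rewrite expr1n div1r.
have p0 u : 0 <= (1 + (u - y) ^+ 2)^-1 by rewrite invr_ge0 addr_ge0// sqr_ge0.
have c0 : continuous (fun u : R => (1 + (u - y) ^+ 2)^-1).
  by rewrite cE; exact: cauchy_kernel_continuous.
have da u : is_derive u 1 (fun u => atan ((u - y) / 1)) ((1 + (u - y) ^+ 2)^-1).
  have -> : (1 + (u - y) ^+ 2)^-1 = 1 / (1 ^+ 2 + (u - y) ^+ 2).
    by rewrite expr1n div1r.
  exact: is_derive_atan_scaled.
apply/integrableP; split.
  by apply/measurable_EFinP/measurable_funTS; exact: continuous_measurable_fun.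
have -> : (\int[mu]_(u in `[0%R, +oo[) `|(EFin \o (fun u => (1 + (u - y) ^+ 2)^-1)%R) u| =
    \int[mu]_(u in `[0%R, +oo[) ((1 + (u - y) ^+ 2)^-1)%:E)%E.
  by apply: eq_integral => u _; rewrite /= ger0_norm.
rewrite (@ge0_continuous_FTC2y _ _ (fun u => atan ((u - y) / 1)) 0 (pi / 2))//.
- by rewrite -EFinB ltry.
- by apply: continuous_in_subspaceT => u _; exact: c0.
- have hy : ((u - y) / 1) @[u --> +oo] --> +oo.
    apply/cvgryPge => A; near=> b; rewrite divr1 lerBrDr.
    by near: b; apply: nbhs_pinfty_ge; exact: num_real.
  exact: (cvg_comp _ _ hy (@cvgy_atan R)).
- by apply: cvg_at_right_filter; exact: (is_derive_continuous (da 0)).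
- by move=> u _; rewrite derive1E; have -> := @derive_val _ _ _ _ _ _ _ (da u).
Unshelve. all: by end_near. Qed.

Lemma sqrt_tan_neg_ge0 v : 0 <= sqrt_tan_neg v.
Proof. exact: sqrtr_ge0. Qed.

Lemma measurable_sqrt_tan_neg : measurable_fun [set: R] (@sqrt_tan_neg R).
Proof.
apply: (measurableT_comp measurable_sqrtr); apply: measurableT_comp => //.
by apply: measurable_funM; [exact: measurable_tan|exact: measurable_invr].
Qed.

Lemma sqrt_tan_neg_le v : quarters v ->
  sqrt_tan_neg v <= Num.sqrt ((`|cos v| * v)^-1).
Proof.
move=> qv; have vp := quarters_gt0 qv; have c0 := quarters_cos_neq0 qv.
rewrite ler_wsqrtr//; apply: le_trans (ler_norm _) _.
rewrite normrN /tan normrM normrM !normfV (gtr0_norm vp) invfM.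
by rewrite ler_pM2r ?invr_gt0// ler_piMl ?invr_ge0// sin_max.
Qed.

(** On (0, pi/2), which contains (0, 1], the tangent is positive. The density thus vanishes near 0,
    and dividing it by v creates no singularity there. *)
Lemma sqrt_tan_neg_small v : quarters v -> v <= 1 -> sqrt_tan_neg v = 0.
Proof.
move=> qv v1; have vp := quarters_gt0 qv; have c0 := quarters_cos_neq0 qv.
have p1 := pihalf_ge1 R.
have vp2 : v < pi / 2.
  rewrite lt_def (le_trans v1 p1) andbT; apply: contraNneq c0 => <-.
  by rewrite cos_pihalf.
apply/eqP; rewrite sqrtr_eq0 oppr_le0 divr_ge0 ?(ltW vp)// /tan divr_ge0 ?ltW//.
  by rewrite sin_gt0_pihalf// vp.
by rewrite cos_gt0_pihalf// vp2 andbT; lra.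
Qed.

Lemma sqrt_tan_negV_le v : quarters v -> sqrt_tan_neg v / v <= 2 * quarters_dom v.
Proof.
move=> qv; have vp := quarters_gt0 qv.
have [v1|v1] := leP v 1.
  by rewrite sqrt_tan_neg_small// mul0r mulr_ge0// quarters_dom_ge0// ltW.
rewrite /quarters_dom mulrCA ler_pM ?sqrt_tan_neg_ge0 ?invr_ge0 ?(ltW vp)//.
  exact: sqrt_tan_neg_le.
by rewrite ler_pdivlMr ?addr_gt0// mulrC ler_pdivrMr//; lra.
Qed.

Lemma integrable_sqrt_tan_negV :
  mu.-integrable quarters (EFin \o (fun v => sqrt_tan_neg v / v)).
Proof.
have mq := @measurable_quarters R.
apply: (le_integrable mq _ _ (integrable_scale 2 mq integrable_quarters_dom)).
- apply/measurable_EFinP/measurable_funTS; apply: measurable_funM.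
    exact: measurable_sqrt_tan_neg.
  exact: measurable_invr.
- move=> v qv; have vp := quarters_gt0 qv.
  rewrite /= lee_fin.
  rewrite ger0_norm ?divr_ge0 ?sqrt_tan_neg_ge0 ?(ltW vp)//.
  by apply: le_trans (sqrt_tan_negV_le qv) _; exact: ler_norm.
Qed.

Lemma poisson_ge0 e eta u : 0 < e -> 0 <= poisson e eta u.
Proof.
by move=> e0; rewrite addr_ge0// divr_ge0 ?(ltW e0)// addr_ge0// sqr_ge0.
Qed.

Lemma poisson_le e eta u : 0 < e -> 0 < eta -> 0 <= u ->
  poisson e eta u <= 2 * (e / (e ^+ 2 + (u - eta) ^+ 2)).
Proof.
move=> e0 eta0 u0; rewrite mulr_natl mulr2n lerD2l ler_pM2l//.
have e2 : 0 < e ^+ 2 by rewrite exprn_gt0.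
rewrite lef_pV2 ?posrE ?ltr_pwDl ?sqr_ge0// lerD2l -subr_ge0.
have -> : (u + eta) ^+ 2 - (u - eta) ^+ 2 = 4 * (u * eta) by ring.
by rewrite mulr_ge0// mulr_ge0// ltW.
Qed.

Section Stieltjes.
Variable eta : R.
Hypothesis eta0 : 0 < eta.

Let D e u := `|whitham_symbol u - whitham_symbol eta| * poisson e eta u.

Let dm1 u : `|whitham_symbol u - whitham_symbol eta| <= 1 :> R.
Proof.
have := whitham_symbol_ge0 u; have := whitham_symbol_ge0 eta.
have := whitham_symbol_le1 u; have := whitham_symbol_le1 eta.
by move=> *; rewrite ler_norml; apply/andP; split; lra.
Qed.

(** A bound uniform in [e], with d = u - eta. For |d| <= 1 the Lipschitz bound and 2 e |d| <= e^2 +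
    d^2 give 2 |M| after multiplication by 1 + d^2; for |d| > 1 the estimates e / (e^2 + d^2) <= 1 /
    d^2 and 1 + d^2 <= 2 d^2 give 4. *)
Let D_le : exists K : R, forall e u, 0 < e <= 1 -> 0 <= u ->
  D e u <= K * (1 + (u - eta) ^+ 2)^-1.
Proof.
have [M HM] := whitham_symbol_lipschitz eta0.
exists (2 * `|M| + 4) => e u /andP[e0 e1] u0.
set d := u - eta.
have d2 : 0 <= d ^+ 2 by exact: sqr_ge0.
have e2 : 0 < e ^+ 2 by rewrite exprn_gt0.
have ed : 0 < e ^+ 2 + d ^+ 2 by rewrite ltr_pwDl.
have p1 : 0 < 1 + d ^+ 2 by rewrite ltr_pwDl.
apply: (@le_trans _ _ (`|whitham_symbol u - whitham_symbol eta| *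
    (2 * (e / (e ^+ 2 + d ^+ 2))))).
  by rewrite ler_wpM2l// poisson_le.
rewrite ler_pdivlMr//.
have [d1|d1] := leP `|d| 1.
  have dd : d ^+ 2 <= 1 by rewrite -real_normK ?num_real// exprn_ile1.
  apply: (@le_trans _ _ (`|M| * 2)); last by have := normr_ge0 M; lra.
  rewrite ler_pM//; last 2 first.
  - apply: (@le_trans _ _ (`|M| * `|d| * (2 * (e / (e ^+ 2 + d ^+ 2))))).
      rewrite ler_wpM2r ?mulr_ge0 ?invr_ge0 ?(ltW e0) ?(ltW ed)//.
      by apply: le_trans (HM u u0) _; rewrite ler_wpM2r// ler_norm.
    rewrite -mulrA -[leRHS]mulr1 ler_wpM2l//.
    rewrite mulrCA mulrA mulrA ler_pdivrMr// mul1r -subr_ge0.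
    have -> : d ^+ 2 = `|d| ^+ 2 by rewrite real_normK ?num_real.
    have -> : e ^+ 2 + `|d| ^+ 2 - 2 * `|d| * e = (e - `|d|) ^+ 2 by ring.
    exact: sqr_ge0.
  - by lra.
  - by rewrite mulr_ge0// mulr_ge0// divr_ge0 ?(ltW e0) ?(ltW ed).
  - exact: ltW.
have dd : 1 <= d ^+ 2 by rewrite -real_normK ?num_real// exprn_ege1// ltW.
apply: (@le_trans _ _ (1 * (2 * (d ^+ 2)^-1) * (2 * d ^+ 2))); last first.
  rewrite mul1r mulrACA mulVf ?mulr1 ?gt_eqF//; last by lra.
  by have := normr_ge0 M; lra.
apply: ler_pM.
- by rewrite mulr_ge0// mulr_ge0// divr_ge0 ?(ltW e0) ?(ltW ed).
- exact: ltW.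
- apply: ler_pM => //.
  + by rewrite mulr_ge0// divr_ge0 ?(ltW e0) ?(ltW ed).
  + rewrite ler_pM2l// -[leRHS]mul1r ler_pM ?invr_ge0 ?(ltW e0) ?(ltW ed)//.
    by rewrite lef_pV2 ?posrE//; lra.
- by lra.
Qed.

Let mD e : 0 < e -> measurable_fun [set: R] (D e).
Proof.
move=> e0; apply: measurable_funM.
  apply: measurableT_comp => //; apply: measurable_funB => //.
  exact: measurable_whitham_symbol.
by apply: continuous_measurable_fun; exact: poisson_continuous.
Qed.

Let D_ge0 e u : 0 < e -> 0 <= D e u.
Proof. by move=> e0; rewrite mulr_ge0// poisson_ge0. Qed.

Let mI : measurable (`[0%R, +oo[%classic : set MR).
Proof. exact: measurable_itv. Qed.

Let iK (K : R) : mu.-integrable `[0, +oo[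
  (EFin \o (fun u => K * (1 + (u - eta) ^+ 2)^-1)).
Proof. exact: integrable_scale (integrable_cauchy_kernel eta). Qed.

Let iD e : 0 < e <= 1 -> mu.-integrable `[0, +oo[ (EFin \o D e).
Proof.
move=> e01; have /andP[e0 _] := e01; have [K HK] := D_le.
apply: le_integrable (iK K) => //.
- by apply/measurable_EFinP/measurable_funTS; exact: mD.
- move=> u; rewrite /= in_itv/= andbT => u0; rewrite lee_fin ger0_norm ?D_ge0//.
  by apply: le_trans (HK _ _ e01 u0) _; exact: ler_norm.
Qed.

Let S e := \int[mu]_(v in quarters)
  (2 * sqrt_tan_neg v * ((e + v) / ((e + v) ^+ 2 + eta ^+ 2))).

Let iP e b : 0 < e -> mu.-integrable `[0, b] (EFin \o (poisson e eta)).
Proof.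
move=> e0; apply: continuous_integrable_itv => u _; exact: poisson_continuous.
Qed.

(** The folded Poisson kernel has mass pi on the half-line, so pi m(eta) is the integral of the
    constant m(eta) against it, and the triangle inequality leaves the integral of [D e]. *)
Let S_close e : 0 < e <= 1 ->
  `|S e - pi * whitham_symbol eta| <= \int[mu]_(u in `[0, +oo[) D e u.
Proof.
move=> e01; have /andP[e0 _] := e01.
have h : `|\int[mu]_(u in `[0, b]) (whitham_symbol u * poisson e eta u) -
    (\int[mu]_(u in `[0, b]) poisson e eta u) * whitham_symbol eta| @[b --> +oo] -->
    `|S e - pi * whitham_symbol eta|.
  apply: cvg_norm; apply: cvgB; first exact: (cvg_symbol_poisson eta e0).2.
  by apply: cvgM; [exact: cvg_integral_poisson|exact: cvg_cst].
rewrite -(cvg_lim _ h)//; apply: limr_le; first by apply/cvg_ex; eexists; exact: h.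
near=> b.
have cP : continuous (poisson e eta) by exact: poisson_continuous.
have mb : measurable (`[0, b]%classic : set MR).
  exact: measurable_itv.
have iD0 : mu.-integrable `[0, b] (EFin \o D e).
  apply: integrableS (iD e01) => //.
  by apply: subset_itvl; rewrite bnd_simp.
rewrite -RintegralZr//; last exact: iP.
have iPm : mu.-integrable `[0, b]
    (EFin \o (fun u => poisson e eta u * whitham_symbol eta)).
  apply: continuous_integrable_itv => u _.
  by apply: cvgM; [exact: cP|exact: cvg_cst].
have imP := @integrable_symbolM (poisson e eta) 0 b cP.
rewrite -RintegralB//.
apply: le_trans (le_normr_Rintegral mb _) _.
  have := integrableB mb imP iPm.
  by apply: eq_integrable => // u _; rewrite /= EFinB.
have -> : \int[mu]_(u in `[0, b])
    `|whitham_symbol u * poisson e eta u - poisson e eta u * whitham_symbol eta| =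
    \int[mu]_(u in `[0, b]) D e u.
  apply: eq_Rintegral => u _; rewrite mulrC -mulrBr normrM mulrC.
  by rewrite [`|poisson _ _ _|]ger0_norm// poisson_ge0.
rewrite /Rintegral fine_le//.
- exact: integrable_fin_num.
- exact: integrable_fin_num (iD e01).
- apply: ge0_subset_integral => //.
  + by apply/measurable_EFinP/measurable_funTS; exact: mD.
  + by move=> u _; rewrite lee_fin D_ge0.
  + by apply: subset_itvl; rewrite bnd_simp.
Unshelve. all: by end_near. Qed.

(** The limit e -> 0+ on both sides: the Stieltjes integrands are dominated by 2 [sqrt_tan_neg v] /
    v, and the error [D e] by [D_le]. *)
Lemma stieltjes_symbol :
  mu.-integrable quarters
    (EFin \o (fun v => 2 * sqrt_tan_neg v * (v / (v ^+ 2 + eta ^+ 2)))) /\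
  \int[mu]_(v in quarters) (2 * sqrt_tan_neg v * (v / (v ^+ 2 + eta ^+ 2))) =
  pi * whitham_symbol eta.
Proof.
pose e_ (n : nat) : R := n.+1%:R^-1.
have e0 n : 0 < e_ n by rewrite invr_gt0.
have e01 n : 0 < e_ n <= 1 by rewrite e0/= invf_le1// ler1n.
have e_0 : e_ n @[n --> \oo] --> (0 : R) by exact: cvg_harmonic.
have mq := @measurable_quarters R.
have ig := integrable_scale 2 mq integrable_sqrt_tan_negV.
have mS n : measurable_fun (quarters : set MR)
    (fun v => 2 * sqrt_tan_neg v * ((e_ n + v) / ((e_ n + v) ^+ 2 + eta ^+ 2))).
  by have [/integrableP[/measurable_EFinP]] := cvg_symbol_poisson eta (e0 n).
have cf v : quarters v ->
    2 * sqrt_tan_neg v * ((e_ n + v) / ((e_ n + v) ^+ 2 + eta ^+ 2)) @[n --> \oo] -->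
    2 * sqrt_tan_neg v * (v / (v ^+ 2 + eta ^+ 2)).
  move=> qv; apply: cvgM; first exact: cvg_cst.
  have ev : e_ n + v @[n --> \oo] --> v.
    by rewrite -[X in _ --> X]add0r; apply: cvgD => //; exact: cvg_cst.
  apply: cvgM => //; apply: cvgV.
    by rewrite gt_eqF// ltr_pwDr ?sqr_ge0// exprn_gt0.
  apply: cvgD; last exact: cvg_cst.
  by rewrite expr2; under eq_fun do rewrite expr2; exact: cvgM.
have bf n v : quarters v ->
    `|2 * sqrt_tan_neg v * ((e_ n + v) / ((e_ n + v) ^+ 2 + eta ^+ 2))| <=
    2 * (sqrt_tan_neg v / v).
  move=> qv; have vp := quarters_gt0 qv; have en := e0 n.
  have ev : 0 < e_ n + v by rewrite addr_gt0.
  have p0 : 0 < (e_ n + v) ^+ 2 + eta ^+ 2 by rewrite ltr_pwDl ?sqr_ge0// exprn_gt0.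
  rewrite ger0_norm; last first.
    by rewrite !mulr_ge0 ?sqrt_tan_neg_ge0 ?invr_ge0 ?(ltW ev) ?(ltW p0).
  rewrite -mulrA ler_pM2l// ler_wpM2l ?sqrt_tan_neg_ge0//.
  rewrite ler_pdivrMr// mulrC ler_pdivlMr// expr2.
  have : v * (e_ n + v) <= (e_ n + v) * (e_ n + v) by rewrite ler_pM2r// lerDr ltW.
  by rewrite mulrC; have := sqr_ge0 eta; lra.
have [iS cS] := @Rdominated_convergence R quarters
  (fun n v => 2 * sqrt_tan_neg v * ((e_ n + v) / ((e_ n + v) ^+ 2 + eta ^+ 2)))
  (fun v => 2 * sqrt_tan_neg v * (v / (v ^+ 2 + eta ^+ 2)))
  (fun v => 2 * (sqrt_tan_neg v / v)) mq mS cf ig bf.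
split => //.
have cD : \int[mu]_(u in `[0, +oo[) D (e_ n) u @[n --> \oo] -->
    \int[mu]_(u in `[0, +oo[) (cst 0 u).
  have [K HK] := D_le.
  apply: (proj2 (@Rdominated_convergence R _ (fun n => D (e_ n)) (cst 0) _ mI _ _ (iK K) _)).
  - by move=> n; apply: measurable_funTS; exact: mD.
  - move=> u; rewrite /= in_itv/= andbT => u0.
    have [->|un] := eqVneq u eta.
      rewrite (_ : (fun n => _) = cst 0); first exact: cvg_cst.
      by apply/funext => n; rewrite /D subrr normr0 mul0r.
    have d0 : 0 < (u - eta) ^+ 2 by rewrite exprn_even_gt0//= subr_eq0.
    have h : 2 * (e_ n * ((u - eta) ^+ 2)^-1) @[n --> \oo] --> (0 : R).
      rewrite -[X in _ --> X](mulr0 2); apply: cvgM; first exact: cvg_cst.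
      rewrite -[X in _ --> X](mul0r ((u - eta) ^+ 2)^-1).
      by apply: cvgM => //; exact: cvg_cst.
    apply: (@squeeze_cvgr _ _ _ _ (cst 0) _ _ _ _ _ h); last exact: cvg_cst.
    apply: nearW => n; rewrite D_ge0//=.
    apply: (@le_trans _ _ (1 * (2 * (e_ n / (e_ n ^+ 2 + (u - eta) ^+ 2))))).
      by rewrite ler_pM// ?poisson_ge0// poisson_le.
    rewrite mul1r ler_pM2l// ler_pM2l// lef_pV2 ?posrE//.
      by rewrite lerDr sqr_ge0.
    by rewrite ltr_pwDr// sqr_ge0.
  - move=> n u; rewrite /= in_itv/= andbT => u0.
    by rewrite ger0_norm ?D_ge0//; exact: HK.
rewrite Rintegral_cst ?mul0r// in cD.
have lS : S (e_ n) @[n --> \oo] --> pi * whitham_symbol eta.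
  apply/subr_cvg0; apply: norm_cvg0.
  apply: (@squeeze_cvgr _ _ _ _ (cst 0) _ _ _ _ _ cD); last exact: cvg_cst.
  by apply: nearW => n; rewrite normr_ge0/= S_close.
exact: (cvg_unique _ cS lS).
Qed.

End Stieltjes.

End Kernels.

(** * The change of variable x to -x *)

Section Reflection.
Context {R : realType}.
Notation mu := (@lebesgue_measure R).
Notation MR := (measurableTypeR R).
Implicit Types (D : set MR) (f : R -> \bar R) (g : R -> R).

Let opp : measurableTypeR R -> measurableTypeR R := -%R.

Let mopp : measurable_fun setT opp.
Proof. by rewrite /opp. Qed.

Lemma ge0_integral_reflect D f : measurable D -> measurable_fun setT f ->
  (forall x, (0 <= f x)%E) ->
  (\int[mu]_(x in D) f x = \int[mu]_(x in opp @^-1` D) f (- x)%R)%E.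
Proof.
move=> mD mf f0.
rewrite -(@ge0_integral_pushforward _ _ _ _ R opp mopp mu D f mD)//; last first.
  exact: measurable_funTS.
by apply: eq_measure_integral => //= A mA AS; exact/esym/lebesgue_measureN.
Qed.

Lemma integrable_reflect D f : measurable D -> measurable_fun setT f ->
  mu.-integrable D f -> mu.-integrable (opp @^-1` D) (f \o opp).
Proof.
move=> mD mf /integrableP[_ fi]; apply/integrableP; split.
  by apply: measurable_funTS; exact: measurableT_comp mopp.
have <- : (\int[mu]_(x in D) `|f x| = \int[mu]_(x in opp @^-1` D) `|(f \o opp) x|)%E.
  apply: (@ge0_integral_reflect D (abse \o f)) => //.
    exact: measurableT_comp.
  by move=> x; exact: abse_ge0.
exact: fi.
Qed.

Lemma Rintegral_reflect D g : measurable D -> measurable_fun setT g ->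
  mu.-integrable D (EFin \o g) ->
  \int[mu]_(x in D) g x = \int[mu]_(x in opp @^-1` D) g (- x).
Proof.
move=> mD mg gi; have mf : measurable_fun setT (EFin \o g) by exact/measurable_EFinP.
rewrite /Rintegral; congr fine.
rewrite -[RHS](@integral_pushforward _ _ _ _ R opp mopp mu D (EFin \o g) mf _ mD)//; last first.
  exact: integrable_reflect.
by apply: eq_measure_integral => //= A mA AS; exact/esym/lebesgue_measureN.
Qed.

Lemma Rintegral_itv_reflect g (a b : R) : 0 < a -> 0 < b ->
  measurable_fun setT g -> mu.-integrable `[- a, b] (EFin \o g) ->
  \int[mu]_(x in `[- a, b]) g x =
  \int[mu]_(x in `[0, b]) g x + \int[mu]_(x in `[0, a]) g (- x).
Proof.
move=> a0 b0 mg gi.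
have E : `[- a, b]%classic = `[0, b]%classic `|` `[- a, 0[%classic :> set R.
  apply/seteqP; split => x /=; rewrite !in_itv/=.
    by move=> /andP[ax xb]; have [x0|x0] := leP 0 x; [left|right]; rewrite ?xb ?ax.
  by case=> /andP[h1 h2]; apply/andP; split; lra.
have mI : measurable (`[- a, 0[%classic : set MR) by exact: measurable_itv.
have gi2 : mu.-integrable `[- a, 0[ (EFin \o g).
  by apply: integrableS gi => //; rewrite E; right.
rewrite E Rintegral_setU//; last 2 first.
- by rewrite -E.
- apply/disj_setPS => x [/=]; rewrite !in_itv/= => /andP[x0 _] /andP[_].
  by rewrite ltNge x0.
congr (_ + _); rewrite (Rintegral_reflect mI mg gi2).
have -> : opp @^-1` `[- a, 0[ = `]0, a]%classic.
  by apply/seteqP; split => x /=; rewrite /opp !in_itv/= => /andP[h1 h2];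
    apply/andP; split; lra.
rewrite Rintegral_itv_obnd_cbnd//.
have := integrable_reflect mI (proj2 (measurable_EFinP _ _) mg) gi2.
congr (mu.-integrable _ _).
by apply/seteqP; split => x /=; rewrite /opp !in_itv/= => /andP[h1 h2];
  apply/andP; split; lra.
Qed.

End Reflection.

(** * The kernel as a Laplace integral: truncations, derivatives, strict inequalities *)

Section WhithamKernel.
Context {R : realType}.
Local Open Scope complex_scope.
Notation mu := (@lebesgue_measure R).
Implicit Types (u v a b x y : R).

Lemma measurable_symbolM (g : R -> R) : continuous g ->
  measurable_fun setT (fun u => whitham_symbol u * g u).
Proof.
move=> cg; apply: measurable_funM; first exact: measurable_whitham_symbol.
exact: continuous_measurable_fun.
Qed.

Lemma continuous_cos_scaled x : continuous (fun u => cos (x * u)).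
Proof.
move=> u; apply: (@cvg_continuous _ _ _ _ (fun u => x * u) cos).
  exact: continuous_cos.
by apply: cvgM; [exact: cvg_cst|exact: cvg_id].
Qed.

Lemma continuous_sin_scaled x : continuous (fun u => sin (x * u)).
Proof.
move=> u; apply: (@cvg_continuous _ _ _ _ (fun u => x * u) sin).
  exact: continuous_sin.
by apply: cvgM; [exact: cvg_cst|exact: cvg_id].
Qed.

Lemma measurable_cos_scaled x : measurable_fun setT (fun u => cos (x * u)).
Proof. by apply: continuous_measurable_fun; exact: continuous_cos_scaled. Qed.

Lemma measurable_sin_scaled x : measurable_fun setT (fun u => sin (x * u)).
Proof. by apply: continuous_measurable_fun; exact: continuous_sin_scaled. Qed.

Lemma Re_truncated_kernel a b x : 0 < a -> 0 < b ->
  Re (truncated_kernel a b x) = (2 * pi)^-1 *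
   (\int[mu]_(u in `[0, b]) (whitham_symbol u * cos (x * u)) +
    \int[mu]_(u in `[0, a]) (whitham_symbol u * cos (x * u))).
Proof.
move=> a0 b0; rewrite /truncated_kernel /Cintegral Re_mulc/= mul0r subr0.
congr (_ * _).
have -> : \int[mu]_(u in `[- a, b]) Re ((whitham_symbol u)%:C * cis (x * u)) =
    \int[mu]_(u in `[- a, b]) (whitham_symbol u * cos (x * u)).
  by apply: eq_Rintegral => u _; rewrite Re_mulc/= mul0r subr0.
rewrite Rintegral_itv_reflect//.
- by congr (_ + _); apply: eq_Rintegral => u _; rewrite whitham_symbolN mulrN cosN.
- exact: measurable_symbolM (@continuous_cos_scaled x).
- exact: integrable_symbolM (@continuous_cos_scaled x).
Qed.

Lemma Im_truncated_kernel a b x : 0 < a -> 0 < b ->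
  Im (truncated_kernel a b x) = (2 * pi)^-1 *
   (\int[mu]_(u in `[0, b]) (whitham_symbol u * sin (x * u)) -
    \int[mu]_(u in `[0, a]) (whitham_symbol u * sin (x * u))).
Proof.
move=> a0 b0; rewrite /truncated_kernel /Cintegral Im_mulc/= mul0r addr0.
congr (_ * _).
have -> : \int[mu]_(u in `[- a, b]) Im ((whitham_symbol u)%:C * cis (x * u)) =
    \int[mu]_(u in `[- a, b]) (whitham_symbol u * sin (x * u)).
  by apply: eq_Rintegral => u _; rewrite Im_mulc/= mul0r addr0.
rewrite Rintegral_itv_reflect//.
- congr (_ + _); rewrite -mulN1r -RintegralZl//; last first.
    exact: integrable_symbolM (@continuous_sin_scaled x).
  by apply: eq_Rintegral => u _; rewrite whitham_symbolN mulrN sinN; ring.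
- exact: measurable_symbolM (@continuous_sin_scaled x).
- exact: integrable_symbolM (@continuous_sin_scaled x).
Qed.

(** On (0, +oo), [laplace 0] is pi times the kernel and [laplace n] is pi times its n-th derivative
    up to the sign (-1)^n. *)
Definition laplace (n : nat) x : R :=
  \int[mu]_(v in quarters) (sqrt_tan_neg v * v ^+ n * expR (- (x * v))).

Lemma near_prod_pinfty_gt0 :
  \forall ab \near filter_prod (pinfty_nbhs R) (pinfty_nbhs R),
    0 < ab.1 /\ 0 < ab.2.
Proof.
exists ([set a : R | 0 < a], [set b : R | 0 < b]); last by move=> [].
by split; exact: nbhs_pinfty_gt.
Qed.

Lemma cvg_Re_truncated_kernel x : x != 0 ->
  (fun ab : R * R => Re (truncated_kernel ab.1 ab.2 x)) @
    filter_prod (pinfty_nbhs R) (pinfty_nbhs R) --> pi^-1 * laplace 0 `|x|.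
Proof.
move=> x0; have xp : 0 < `|x| by rewrite normr_gt0.
have [_] := cvg_symbol_cos xp.
set L := \int[mu]_(v in quarters) _.
have LE : laplace 0 `|x| = L.
  by apply: eq_Rintegral => v _; rewrite expr0 mulr1.
have -> : (fun b => \int[mu]_(u in `[0, b]) (whitham_symbol u * cos (`|x| * u))) =
    (fun b => \int[mu]_(u in `[0, b]) (whitham_symbol u * cos (x * u))).
  apply/funext => b; apply: eq_Rintegral => u _; congr (_ * _).
  by have [_|_] := ger0P x; rewrite ?mulNr ?cosN.
move=> c.
have -> : pi^-1 * laplace 0 `|x| = (2 * pi)^-1 * (L + L).
  rewrite LE -mulr2n -[L *+ 2]mulr_natl mulrA invfM.
  by rewrite [2^-1 * pi^-1 * 2]mulrAC mulVf ?mul1r.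
pose G b := \int[mu]_(u in `[0, b]) (whitham_symbol u * cos (x * u)).
have h : (2 * pi)^-1 * (G ab.2 + G ab.1) @[ab --> filter_prod (pinfty_nbhs R) (pinfty_nbhs R)]
    --> (2 * pi)^-1 * (L + L).
  apply: cvgM; first exact: cvg_cst.
  by apply: cvgD; [exact: (cvg_comp _ _ cvg_snd c)|exact: (cvg_comp _ _ cvg_fst c)].
apply: cvg_trans h; apply: near_eq_cvg.
apply: filterS near_prod_pinfty_gt0 => ab [a0 b0].
exact/esym/Re_truncated_kernel.
Qed.

Lemma cvg_Im_truncated_kernel x : x != 0 ->
  (fun ab : R * R => Im (truncated_kernel ab.1 ab.2 x)) @
    filter_prod (pinfty_nbhs R) (pinfty_nbhs R) --> 0.
Proof.
move=> x0.
have [l c] : exists l : R, \int[mu]_(u in `[0, b])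
    (whitham_symbol u * sin (x * u)) @[b --> +oo] --> l.
  have [xp|xn] := ltP 0 x; first by eexists; exact: cvg_symbol_sin.
  have xp : 0 < - x by rewrite oppr_gt0 lt_neqAle x0.
  exists (- \int[mu]_(v in quarters) (sqrt_tan_pos v * expR (- (- x * v)))).
  have h : - (\int[mu]_(u in `[0, b]) (whitham_symbol u * sin (- x * u))) @[b --> +oo] -->
      - \int[mu]_(v in quarters) (sqrt_tan_pos v * expR (- (- x * v))).
    by apply: cvgN; exact: cvg_symbol_sin.
  apply: cvg_trans h.
  apply: near_eq_cvg; apply: nearW => b.
  rewrite -mulN1r -RintegralZl//; last first.
    exact: integrable_symbolM (@continuous_sin_scaled (- x)).
  by apply: eq_Rintegral => u _; rewrite (mulNr x) sinN; ring.
have -> : 0 = (2 * pi)^-1 * (l - l) :> R by rewrite subrr mulr0.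
pose G b := \int[mu]_(u in `[0, b]) (whitham_symbol u * sin (x * u)).
have h : (2 * pi)^-1 * (G ab.2 - G ab.1) @[ab --> filter_prod (pinfty_nbhs R) (pinfty_nbhs R)]
    --> (2 * pi)^-1 * (l - l).
  apply: cvgM; first exact: cvg_cst.
  by apply: cvgB; [exact: (cvg_comp _ _ cvg_snd c)|exact: (cvg_comp _ _ cvg_fst c)].
apply: cvg_trans h; apply: near_eq_cvg.
apply: filterS near_prod_pinfty_gt0 => ab [a0 b0].
exact/esym/Im_truncated_kernel.
Qed.

Lemma whitham_kernelE x : x != 0 -> whitham_kernel x = pi^-1 * laplace 0 `|x|.
Proof. by move=> x0; apply: cvg_lim => //; exact: cvg_Re_truncated_kernel. Qed.

(** The inequality y <= e^y at y = us / (n + 1), raised to the power n + 1. *)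
Lemma pow_expN_bounded (n : nat) u : 0 < u -> exists C : R, forall s, 0 <= s ->
  s ^+ n.+1 * expR (- (u * s)) <= C.
Proof.
move=> u0; exists ((n.+1%:R / u) ^+ n.+1) => s s0.
have n0 : 0 < n.+1%:R :> R by rewrite ltr0n.
have -> : - (u * s) = n.+1%:R * - (u * s / n.+1%:R) by field; rewrite gt_eqF.
rewrite expRM_natl -exprMn ler_pXn2r ?nnegrE//; last 2 first.
- by rewrite mulr_ge0// expR_ge0.
- by rewrite divr_ge0 ?(ltW n0) ?(ltW u0).
rewrite expRN ler_pdivrMr ?expR_gt0// [leRHS]mulrAC ler_pdivlMr// mulrC.
have := expR_ge1Dx (u * s / n.+1%:R).
set E := expR _ => H.
have : u * s / n.+1%:R <= E by apply: le_trans H; rewrite lerDr.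
by rewrite ler_pdivrMr// [E * _]mulrC.
Qed.

(** The power v^n is traded for 1/v, as v^(n+1) e^(-uv) is bounded. Multiples of the single
    integrable function [sqrt_tan_neg v / v] thus dominate the integrands of all derivatives on [u,
    +oo). *)
Lemma laplace_dom (n : nat) u : 0 < u -> exists C : R, forall v x, quarters v -> u <= x ->
  `|sqrt_tan_neg v * v ^+ n * expR (- (x * v))| <= C * (sqrt_tan_neg v / v).
Proof.
move=> u0; have [C HC] := pow_expN_bounded n u0; exists C => v x qv ux.
have vp := quarters_gt0 qv.
rewrite ger0_norm ?mulr_ge0 ?sqrt_tan_neg_ge0 ?exprn_ge0 ?expR_ge0 ?(ltW vp)//.
have -> : sqrt_tan_neg v * v ^+ n * expR (- (x * v)) =
    v ^+ n.+1 * expR (- (x * v)) * (sqrt_tan_neg v / v).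
  by rewrite exprS; field; rewrite gt_eqF.
rewrite ler_wpM2r ?divr_ge0 ?sqrt_tan_neg_ge0 ?(ltW vp)//.
apply: le_trans (HC v (ltW vp)); rewrite ler_wpM2l ?exprn_ge0 ?(ltW vp)//.
by rewrite ler_expR lerN2 ler_pM2r.
Qed.

Lemma measurable_laplace_integrand (n : nat) x : measurable_fun setT
  (fun v => sqrt_tan_neg v * v ^+ n * expR (- (x * v))).
Proof.
apply: measurable_funM.
  by apply: measurable_funM; [exact: measurable_sqrt_tan_neg|exact: measurable_funX].
apply: measurableT_comp; first exact: measurable_expR.
by apply: measurableT_comp => //.
Qed.

Lemma integrable_laplace_dom (C : R) :
  mu.-integrable quarters (EFin \o (fun v => C * (sqrt_tan_neg v / v))).
Proof.
exact: integrable_scale (@measurable_quarters R) (@integrable_sqrt_tan_negV R).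
Qed.

Lemma integrable_laplace (n : nat) x : 0 < x -> mu.-integrable quarters
  (EFin \o (fun v => sqrt_tan_neg v * v ^+ n * expR (- (x * v)))).
Proof.
move=> x0; have [C HC] := laplace_dom n x0.
have mq := @measurable_quarters R.
apply: le_integrable (integrable_laplace_dom C) => //.
- by apply/measurable_EFinP/measurable_funTS; exact: measurable_laplace_integrand.
- move=> v qv; rewrite /= lee_fin; apply: le_trans (HC v x qv (lexx x)) _.
  exact: ler_norm.
Qed.

Lemma is_derive_laplace (n : nat) x : 0 < x ->
  is_derive x 1 (laplace n) (- laplace n.+1 x).
Proof.
move=> x0; have x20 : 0 < x / 2 by rewrite divr_gt0.
have [C HC] := laplace_dom n.+1 x20.
have mq := @measurable_quarters R.
pose f y v := sqrt_tan_neg v * v ^+ n * expR (- (y * v)).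
have Ix : `]x / 2, x + 1[%classic x.
  by rewrite /= in_itv/=; apply/andP; split; lra.
have yp y : `]x / 2, x + 1[%classic y -> x / 2 < y.
  by rewrite /= in_itv/= => /andP[].
have df y v : is_derive y 1 (f ^~ v)
    (- (sqrt_tan_neg v * v ^+ n.+1 * expR (- (y * v)))).
  have d1 : is_derive y 1 (fun y : R => - (y * v)) (- v).
    have := is_deriveN (is_deriveM (is_derive_id y 1) (is_derive_cst v y 1)).
    by move/is_derive_eq; apply; rewrite /GRing.scale/=; ring.
  have := is_deriveZ (sqrt_tan_neg v * v ^+ n)
    (@is_derive1_comp _ expR (fun y : R => - (y * v)) _ _ _ (is_derive_expR _) d1).
  by move/is_derive_eq; apply; rewrite /GRing.scale/= exprS; ring.
have H1 y : `]x / 2, x + 1[%classic y -> mu.-integrable quarters (EFin \o f y).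
  by move=> /yp xy; apply: integrable_laplace; exact: lt_trans xy.
have H2 y v : `]x / 2, x + 1[%classic y -> quarters v -> derivable (f ^~ v) y 1.
  by move=> _ _; have [] := df y v.
pose G v := `|C * (sqrt_tan_neg v / v)|.
have H4 : mu.-integrable quarters (EFin \o G).
  rewrite [X in mu.-integrable _ X](_ : _ = abse \o (EFin \o (fun v => C * (sqrt_tan_neg v / v))))//.
  by apply: integrable_abse; exact: integrable_laplace_dom.
have pE y v : partial1of2 f y v = - (sqrt_tan_neg v * v ^+ n.+1 * expR (- (y * v))).
  by rewrite partial1of2E; have -> := @derive_val _ _ _ _ _ _ _ (df y v).
have H3 y v : `]x / 2, x + 1[%classic y -> quarters v ->
    `|partial1of2 f y v| <= G v.
  move=> /yp xy qv; rewrite pE normrN; apply: le_trans (HC v y qv (ltW xy)) _.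
  exact: ler_norm.
have dv := @derivable_under_integral R _ _ mu f quarters mq
  x _ _ Ix H1 H2 G (fun=> normr_ge0 _) H4 H3.
have vv := @differentiation_under_integral R _ _ mu f quarters mq
  x _ _ Ix H1 H2 G (fun=> normr_ge0 _) H4 H3.
apply: DeriveDef; first exact: dv.
rewrite -derive1E vv -mulN1r -RintegralZl//; last exact: integrable_laplace.
by apply: eq_Rintegral => v _; rewrite pE mulN1r.
Qed.

Lemma derive1n_whitham_kernel (n : nat) x : 0 < x ->
  derive1n n whitham_kernel x = pi^-1 * ((-1) ^+ n * laplace n x).
Proof.
elim: n x => [|n IHn] x x0.
  by rewrite derive1n0 whitham_kernelE ?gt_eqF// gtr0_norm// expr0 mul1r.
have E : \near x, derive1n n whitham_kernel x = pi^-1 * ((-1) ^+ n * laplace n x).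
  have : \forall y \near x, 0 < y.
    by apply: open_nbhs_nbhs; split => //; exact: open_gt.
  by apply: filterS => y; exact: IHn.
rewrite derive1nS derive1E (near_eq_derive _ E).
have := is_deriveZ pi^-1 (is_deriveZ ((-1) ^+ n) (is_derive_laplace n x0)).
by move=> [_ ->]; rewrite /GRing.scale/= exprS; ring.
Qed.

Lemma derivable_whitham_kernel (n : nat) x : 0 < x ->
  derivable (derive1n n whitham_kernel) x 1.
Proof.
move=> x0.
have [dv _] := is_deriveZ pi^-1 (is_deriveZ ((-1) ^+ n) (is_derive_laplace n x0)).
apply: near_eq_derivable dv.
have : \forall y \near x, 0 < y.
  by apply: open_nbhs_nbhs; split => //; exact: open_gt.
by apply: filterS => y y0; rewrite derive1n_whitham_kernel.
Qed.

Lemma laplace_ge0 (n : nat) x : 0 <= laplace n x.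
Proof.
apply: Rintegral_ge0 => v /quarters_gt0 v0.
by rewrite !mulr_ge0 ?sqrt_tan_neg_ge0 ?exprn_ge0 ?expR_ge0 ?ltW.
Qed.

Lemma completely_monotone_whitham_kernel : completely_monotone (@whitham_kernel R).
Proof.
move=> n x x0; split; first exact: derivable_whitham_kernel.
rewrite derive1n_whitham_kernel// mulrCA signrMK.
by rewrite mulr_ge0 ?laplace_ge0// invr_ge0 pi_ge0.
Qed.

Lemma sqrt_tan_neg_gt0 v : quarter 1 v -> 0 < sqrt_tan_neg v.
Proof.
move=> qv; have qqv : quarters v by exists 1%N.
have vp := quarters_gt0 qqv; have c0 := quarters_cos_neq0 qqv.
move: qv; rewrite quarterE => /sign_sincos; rewrite expr1 mulN1r => sc.
rewrite sqrtr_gt0 /tan.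
have -> : - (sin v / cos v / v) = - (sin v * cos v) / (cos v ^+ 2 * v).
  by field; rewrite c0 gt_eqF.
by rewrite divr_gt0// mulr_gt0// exprn_even_gt0.
Qed.

(** A nonnegative function with zero integral vanishes almost everywhere, which [quarter 1], of
    length pi/2, rules out. Positivity, strict decrease and strict convexity all come from
    strictness of an inequality between exponentials on this interval, where the density is
    positive. *)
Lemma Rintegral_quarters_gt0 (f : R -> R) :
  mu.-integrable quarters (EFin \o f) ->
  (forall v, quarters v -> 0 <= f v) -> (forall v, quarter 1 v -> 0 < f v) ->
  0 < \int[mu]_(v in quarters) f v.
Proof.
move=> fi f0 f1.
have mq := @measurable_quarters R.
rewrite lt_neqAle Rintegral_ge0// andbT; apply/negP => /eqP I0.
have mf := measurable_int _ fi.
have : (\int[mu]_(v in quarters) `|(EFin \o f) v| = 0)%E.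
  have -> : (\int[mu]_(v in quarters) `|(EFin \o f) v| =
      \int[mu]_(v in quarters) (EFin \o f) v)%E.
    by apply: eq_integral => v /set_mem qv; rewrite /= ger0_norm// f0.
  by rewrite -(fineK (integrable_fin_num mq fi)); congr (_%:E); exact/esym.
move/(ae_eq_integral_abs mu mq mf) => [N [mN N0 sub]].
have : mu (quarter 1) = 0%E.
  apply: subset_measure0 N0 => //; first exact: measurable_quarter.
  move=> v qv; apply: sub => /= /(_ (ex_intro2 _ _ 1%N I qv)) [fv].
  by have := f1 v qv; rewrite fv ltxx.
rewrite /quarter lebesgue_measure_itv/= lte_fin ltr_pM2r ?divr_gt0 ?pi_gt0//.
rewrite ltr_nat/= -EFinB => -[]; have := pi_gt0 R; lra.
Qed.

Lemma whitham_kernel_gt0 x : 0 < x -> 0 < whitham_kernel x.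
Proof.
move=> x0; rewrite whitham_kernelE ?gt_eqF// gtr0_norm//.
rewrite mulr_gt0 ?invr_gt0 ?pi_gt0//; apply: Rintegral_quarters_gt0.
- exact: integrable_laplace.
- move=> v /quarters_gt0 v0.
  by rewrite !mulr_ge0 ?sqrt_tan_neg_ge0 ?exprn_ge0 ?expR_ge0 ?ltW.
- move=> v /sqrt_tan_neg_gt0 sv.
  by rewrite expr0 mulr1 mulr_gt0// expR_gt0.
Qed.

Lemma whitham_kernel_decreasing : strictly_decreasing_pos (@whitham_kernel R).
Proof.
move=> x y x0 xy; have y0 := lt_trans x0 xy.
have mq := @measurable_quarters R.
rewrite !whitham_kernelE ?gt_eqF// !gtr0_norm//.
rewrite ltr_pM2l ?invr_gt0 ?pi_gt0// -subr_gt0.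
have ix := integrable_laplace 0 x0; have iy := integrable_laplace 0 y0.
have e v : 0 < v -> expR (- (y * v)) < expR (- (x * v)).
  by move=> v0; rewrite ltr_expR ltrN2 ltr_pM2r.
rewrite -RintegralB//; apply: Rintegral_quarters_gt0.
- have := integrableB mq ix iy; by apply: eq_integrable => // v _; rewrite /= EFinB.
- move=> v /quarters_gt0 v0; rewrite expr0 mulr1 -mulrBr.
  by rewrite mulr_ge0 ?sqrt_tan_neg_ge0// subr_ge0 ltW// e.
- move=> v qv; have v0 : 0 < v by apply: quarters_gt0; exists 1%N.
  rewrite expr0 mulr1 -mulrBr mulr_gt0 ?subr_gt0 ?e//.
  exact: sqrt_tan_neg_gt0.
Qed.

(** The strict tangent inequality at the intermediate point [r], averaged with weights t and 1 - t:
    the linear terms cancel. *)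
Lemma expR_strict_convex (p q t : R) : p != q -> 0 < t -> t < 1 ->
  expR (t * p + (1 - t) * q) < t * expR p + (1 - t) * expR q.
Proof.
move=> pq t0 t1; set r := t * p + (1 - t) * q.
have tangent (z : R) : z != r -> expR r * (1 + (z - r)) < expR z.
  move=> zr; have z0 : z - r != 0 by rewrite subr_eq0.
  have -> : expR z = expR r * expR (z - r) by rewrite -expRD addrC subrK.
  rewrite ltr_pM2l ?expR_gt0//.
  exact: expR_gt1Dx.
have pr : p != r.
  rewrite -subr_eq0 (_ : p - r = (1 - t) * (p - q)); last by rewrite /r; ring.
  by rewrite mulf_neq0 ?subr_eq0// gt_eqF.
have qr : q != r.
  rewrite -subr_eq0 (_ : q - r = t * (q - p)); last by rewrite /r; ring.
  by rewrite mulf_neq0//; [rewrite gt_eqF|rewrite subr_eq0 eq_sym].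
have h1 := tangent _ pr; have h2 := tangent _ qr.
have t1' : 0 < 1 - t by rewrite subr_gt0.
have -> : expR r = t * (expR r * (1 + (p - r))) + (1 - t) * (expR r * (1 + (q - r))).
  by rewrite /r; ring.
by rewrite ltrD// ltr_pM2l.
Qed.

Lemma whitham_kernel_convex : strictly_convex_pos (@whitham_kernel R).
Proof.
move=> x y t x0 y0 xy t0 t1.
have t1' : 0 < 1 - t by rewrite subr_gt0.
set z := t * x + (1 - t) * y.
have z0 : 0 < z by rewrite addr_gt0// mulr_gt0.
have mq := @measurable_quarters R.
rewrite !whitham_kernelE ?gt_eqF// !gtr0_norm//.
have -> : t * (pi^-1 * laplace 0 x) + (1 - t) * (pi^-1 * laplace 0 y) =
  pi^-1 * (t * laplace 0 x + (1 - t) * laplace 0 y) by ring.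
rewrite ltr_pM2l ?invr_gt0 ?pi_gt0// -subr_gt0.
pose f w v : R := sqrt_tan_neg v * v ^+ 0 * expR (- (w * v)).
have iz := integrable_laplace 0 z0.
have iZ c w : 0 < w -> mu.-integrable quarters (EFin \o (fun v => c * f w v)).
  by move=> w0; apply: integrable_scale => //; exact: integrable_laplace.
have iD : mu.-integrable quarters (EFin \o (fun v => t * f x v + (1 - t) * f y v)).
  have := integrableD mq (iZ t x x0) (iZ (1 - t) y y0).
  by apply: eq_integrable => // v _; rewrite /= EFinD.
have -> : t * laplace 0 x + (1 - t) * laplace 0 y =
    \int[mu]_(v in quarters) (t * f x v + (1 - t) * f y v).
  rewrite RintegralD//; [|exact: iZ|exact: iZ].
  by rewrite !RintegralZl//; exact: integrable_laplace.
have e v : 0 < v -> expR (- (z * v)) <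
    t * expR (- (x * v)) + (1 - t) * expR (- (y * v)).
  move=> v0.
  have -> : - (z * v) = t * - (x * v) + (1 - t) * - (y * v) by rewrite /z; ring.
  apply: expR_strict_convex => //.
  by rewrite eqr_opp; apply: contra_neq xy; apply: mulIf; rewrite gt_eqF.
have fE v : t * f x v + (1 - t) * f y v - f z v = sqrt_tan_neg v *
    (t * expR (- (x * v)) + (1 - t) * expR (- (y * v)) - expR (- (z * v))).
  by rewrite /f expr0; ring.
rewrite -RintegralB//; apply: Rintegral_quarters_gt0.
- have := integrableB mq iD iz; by apply: eq_integrable => // v _; rewrite /= EFinB.
- move=> v /quarters_gt0 v0; rewrite fE.
  by rewrite mulr_ge0 ?sqrt_tan_neg_ge0// subr_ge0 ltW// e.
- move=> v qv; have v0 : 0 < v by apply: quarters_gt0; exists 1%N.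
  rewrite fE mulr_gt0 ?subr_gt0 ?e//.
  exact: sqrt_tan_neg_gt0.
Qed.

End WhithamKernel.

(** * Functions equal off the origin, and a real-valued Fubini theorem *)

Section Fubini.
Context {R : realType}.
Notation mu := (@lebesgue_measure R).
Notation MR := (measurableTypeR R).
Implicit Types (f g b : R -> R) (k : MR * MR -> R) (x s t : R).

(** The value of the kernel at 0 is meaningless, so its formulas hold away from 0; this lemma and
    the next three make that point irrelevant for integration. *)
Lemma eq_neq0_measurable f g : measurable_fun setT g ->
  (forall x, x != 0 -> f x = g x) -> measurable_fun setT f.
Proof.
move=> mg fg.
have -> : [set: R] = [set~ 0] `|` [set 0] by rewrite setUC setUv.
apply/measurable_funU => //; first exact: measurableC.
split; last exact: measurable_fun_set1.
apply: (eq_measurable_fun g); first by move=> x /set_mem/= /eqP x0; rewrite fg.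
exact: measurable_funTS.
Qed.

Lemma eq_neq0_ae f g : (forall x, x != 0 -> f x = g x) ->
  ae_eq mu setT (EFin \o f) (EFin \o g).
Proof.
move=> fg; exists [set 0]; split.
- exact: measurable_set1.
- exact: lebesgue_measure_set1.
- move=> x /= H; apply: contrapT => /eqP x0; apply: H => _.
  by rewrite fg.
Qed.

Lemma eq_neq0_Rintegral f g : measurable_fun setT g ->
  (forall x, x != 0 -> f x = g x) -> \int[mu]_x f x = \int[mu]_x g x.
Proof.
move=> mg fg; rewrite /Rintegral; congr fine.
apply: (@ae_eq_integral _ MR R mu setT (EFin \o g) (EFin \o f)) => //.
- by apply/measurable_EFinP; exact: eq_neq0_measurable fg.
- exact/measurable_EFinP.
- exact: eq_neq0_ae.
Qed.

Lemma eq_neq0_integrable f g : mu.-integrable setT (EFin \o g) ->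
  (forall x, x != 0 -> f x = g x) -> mu.-integrable setT (EFin \o f).
Proof.
move=> gi fg.
have mg : measurable_fun (setT : set R) g by have /integrableP[/measurable_EFinP] := gi.
have mf := eq_neq0_measurable mg fg.
apply/integrableP; split; first exact/measurable_EFinP.
have /integrableP[_] := gi; apply: le_lt_trans.
rewrite (_ : (\int[mu]_x `|(EFin \o f) x| = \int[mu]_x `|(EFin \o g) x|)%E)//.
apply: (@ae_eq_integral _ MR R mu setT (EFin \o (fun x => `|g x|))
  (EFin \o (fun x => `|f x|))) => //.
- by apply/measurable_EFinP; exact: measurableT_comp.
- by apply/measurable_EFinP; exact: measurableT_comp.
- by apply: eq_neq0_ae => x /fg ->.
Qed.

(** A uniform bound on the L^1 norms of the sections in x, against an integrable weight in s, gives
    joint integrability by Tonelli. *)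
Lemma Rfubini_kernel b k (C : R) : mu.-integrable setT (EFin \o b) ->
  measurable_fun setT k ->
  (forall s, (\int[mu]_x `|k (x, s)|%:E <= C%:E)%E) ->
  mu.-integrable setT (EFin \o (fun x => \int[mu]_s (b s * k (x, s)))) /\
  \int[mu]_x \int[mu]_s (b s * k (x, s)) = \int[mu]_s (b s * \int[mu]_x k (x, s)).
Proof.
move=> bi mk kC.
have mb : measurable_fun (setT : set MR) b.
  by have /integrableP[/measurable_EFinP] := bi.
have mk1 s : measurable_fun (setT : set MR) (fun x => k (x, s)).
  by apply: measurableT_comp mk _; apply: measurable_fun_pair.
pose f (z : MR * MR) : \bar R := (b z.2 * k z)%:E.
have mf : measurable_fun setT f.
  apply/measurable_EFinP; apply: measurable_funM => //.
  exact: (measurableT_comp mb measurable_snd).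
have C0 : (0 <= C%:E)%E.
  by apply: le_trans (kC 0); apply: integral_ge0 => x _; rewrite lee_fin.
have ki s : mu.-integrable setT (EFin \o (fun x => k (x, s))).
  apply/integrableP; split; first exact/measurable_EFinP.
  by apply: (le_lt_trans (kC s)); exact: ltry.
have mG : measurable_fun setT (fubini_G mu (abse \o f)).
  apply: measurable_fun_fubini_tonelli_G; first exact: measurableT_comp.
  by move=> z; exact: abse_ge0.
have fi : (mu \x mu)%E.-integrable setT f.
  apply/(integrable21ltyP _ _ mf).
  apply: (@le_lt_trans _ _ (\int[mu]_s (C%:E * `|(EFin \o b) s|))%E).
    apply: ge0_le_integral => //.
    - by move=> s _; apply: integral_ge0.
    - apply: emeasurable_funM => //; apply: measurableT_comp => //.
      exact/measurable_EFinP.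
    - move=> s _.
      have -> : (\int[mu]_x `|f (x, s)| = \int[mu]_x (`|b s|%:E * `|k (x, s)|%:E))%E.
        by apply: eq_integral => x _; rewrite /f /= normrM EFinM.
      rewrite ge0_integralZl_EFin//; last first.
        by apply/measurable_EFinP; exact: measurableT_comp.
      by rewrite muleC lee_wpmul2r.
  have /integrableP[_ bl] := bi.
  rewrite ge0_integralZl//; last first.
    by apply: measurableT_comp => //; exact/measurable_EFinP.
  by rewrite lte_mul_pinfty// ?fin_numElt ?ltry ?ltNyr.
have Fi := integrable_fubini_F fi.
have mF : measurable_fun setT (fubini_F mu f) by exact: measurable_int Fi.
set F := fubini_F mu f in Fi mF.
have FE : (fun x => \int[mu]_s (b s * k (x, s))) = fine \o F by [].
have mfF : measurable_fun (setT : set MR) (fine \o F).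
  by apply: measurableT_comp mF; exact: fine_measurable.
split.
  rewrite FE; apply: le_integrable Fi => //; first exact/measurable_EFinP.
  by move=> x _ /=; case: (F x) => [r| |] //=; rewrite normr0 leey.
(* The inner integral is known to be finite only almost everywhere, so making it real-valued changes
   [F] on a null set. *)
transitivity (fine (\int[mu]_x F x)).
  rewrite FE /Rintegral; congr fine.
  apply: (@ae_eq_integral _ MR R mu setT F (EFin \o (fine \o F))) => //.
    exact/measurable_EFinP.
  have [N [mN N0 sub]] := integrable_ae measurableT Fi.
  exists N; split => //; apply: subset_trans sub => x /= H H'; apply: H => _.
  by rewrite /= fineK// H'.
rewrite /F /fubini_F (Fubini fi) /Rintegral; congr fine.
apply: eq_integral => s _.
have -> : (\int[mu]_x f (x, s) = \int[mu]_x ((b s)%:E * (EFin \o (fun x => k (x, s))) x))%E.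
  by apply: eq_integral => x _.
rewrite integralZl// EFinM; congr (_ * _)%E.
by rewrite fineK//; exact: (integrable_fin_num measurableT (ki s)).
Qed.

End Fubini.

(** * The Fourier transform of the two-sided exponential *)

Section Exponential.
Context {R : realType}.
Notation mu := (@lebesgue_measure R).
Notation MR := (measurableTypeR R).
Implicit Types (g : R -> R) (x s t : R).

Let opp : MR -> MR := -%R.

Let negE : `]-oo, 0[%classic = opp @^-1` `]0, +oo[%classic.
Proof. by apply/seteqP; split => x /=; rewrite /opp !in_itv/= andbT oppr_gt0. Qed.

Let setTE : [set: R] = `[0, +oo[%classic `|` `]-oo, 0[%classic.
Proof.
apply/seteqP; split => x //= _; rewrite !in_itv/= andbT.
by have [_|_] := leP 0 x; [left|right].
Qed.

Let itv_disj : [disjoint `[0, +oo[%classic & `]-oo, 0[%classic : set R].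
Proof.
by apply/disj_setPS => x [/=]; rewrite !in_itv/= andbT leNgt => /negP.
Qed.

Lemma integrable_itv_reflect g : measurable_fun setT g ->
  mu.-integrable `[0, +oo[ (EFin \o g) ->
  mu.-integrable `[0, +oo[ (EFin \o (g \o -%R)) ->
  mu.-integrable setT (EFin \o g).
Proof.
move=> mg gi gNi.
have gN' : mu.-integrable `]0, +oo[ (EFin \o (g \o -%R)).
  by apply: integrableS gNi => //; apply: subset_itvr; rewrite bnd_simp.
have mI : measurable (`]0%R, +oo[%classic : set MR) by exact: measurable_itv.
have mgN : measurable_fun setT (EFin \o (g \o -%R)).
  by apply/measurable_EFinP; exact: measurableT_comp.
have := integrable_reflect mI mgN gN'.
rewrite -/opp -negE => gN.
have {}gN : mu.-integrable `]-oo, 0[ (EFin \o g).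
  apply: eq_integrable gN => // x _.
  by rewrite /= /opp opprK.
have mE : measurable_fun (setT : set MR) (EFin \o g) by exact/measurable_EFinP.
apply/integrableP; split => //.
rewrite setTE ge0_integral_setU//; last first.
  by rewrite -setTE; exact: measurableT_comp.
have /integrableP[_ h1] := gi; have /integrableP[_ h2] := gN.
exact: lte_add_pinfty.
Qed.

Lemma Rintegral_even g : measurable_fun setT g ->
  mu.-integrable `[0, +oo[ (EFin \o g) -> (forall x, g (- x) = g x) ->
  mu.-integrable setT (EFin \o g) /\
  \int[mu]_x g x = 2 * \int[mu]_(x in `[0, +oo[) g x.
Proof.
move=> mg gi gN.
have giT : mu.-integrable setT (EFin \o g).
  apply: integrable_itv_reflect => //.
  by have -> : g \o -%R = g by apply/funext => x; exact: gN.
split => //.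
have mI : measurable (`]0%R, +oo[%classic : set MR) by exact: measurable_itv.
have gi' : mu.-integrable `]0, +oo[ (EFin \o g) by apply: integrableS giT.
rewrite {1}setTE Rintegral_setU//; last by rewrite -setTE.
have := Rintegral_reflect mI mg gi'.
rewrite -/opp -negE => E.
have -> : \int[mu]_(x in `]-oo, 0[) g x = \int[mu]_(x in `[0, +oo[) g x.
  rewrite -Rintegral_itv_obnd_cbnd//.
  by rewrite E; apply: eq_Rintegral => x _; rewrite gN.
ring.
Qed.

Lemma Rintegral_odd g : measurable_fun setT g ->
  mu.-integrable setT (EFin \o g) -> (forall x, g (- x) = - g x) ->
  \int[mu]_x g x = 0.
Proof.
move=> mg gi gN.
have := @Rintegral_reflect R setT g measurableT mg gi.
rewrite preimage_setT.
have -> : \int[mu]_x g (- x) = - \int[mu]_x g x.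
  rewrite -mulN1r -RintegralZl//.
  by apply: eq_Rintegral => x _; rewrite gN mulN1r.
lra.
Qed.

Lemma cvg_expRN_scaled s : 0 < s -> expR (- (s * x)) @[x --> +oo] --> 0.
Proof.
move=> s0.
have h : s * x @[x --> +oo] --> +oo.
  apply/cvgryPge => A; near=> b.
  have : A / s <= b by near: b; apply: nbhs_pinfty_ge; exact: num_real.
  by rewrite ler_pdivrMr// mulrC.
exact: (cvg_comp _ _ h (@cvgr_expR R)).
Unshelve. all: by end_near. Qed.

Lemma is_derive_expRN_scaled s x :
  is_derive x 1 (fun x => expR (- (s * x))) (- (s * expR (- (s * x)))).
Proof.
have d1 : is_derive x 1 (fun x : R => - (s * x)) (- s).
  have := is_deriveN (is_deriveZ s (is_derive_id x 1)).
  by move/is_derive_eq; apply; rewrite /GRing.scale/=; ring.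
have := @is_derive1_comp _ expR (fun x : R => - (s * x)) _ _ _ (is_derive_expR _) d1.
by move/is_derive_eq; apply; ring.
Qed.

Lemma continuous_expRN_scaled s : continuous (fun x => expR (- (s * x))).
Proof. by move=> x; exact: (is_derive_continuous (is_derive_expRN_scaled s x)). Qed.

Lemma integral_expRN_scaled s : 0 < s ->
  mu.-integrable `[0, +oo[ (EFin \o (fun x => expR (- (s * x)))) /\
  \int[mu]_(x in `[0, +oo[) expR (- (s * x)) = s^-1.
Proof.
move=> s0.
have dF x : is_derive x 1 (fun x => - s^-1 * expR (- (s * x))) (expR (- (s * x))).
  have := is_deriveZ (- s^-1) (is_derive_expRN_scaled s x).
  move/is_derive_eq; apply; rewrite /GRing.scale/=; field.
  by rewrite gt_eqF.
have E : (\int[mu]_(x in `[0%R, +oo[) (expR (- (s * x)))%:E = (s^-1)%:E)%E.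
  rewrite (@ge0_continuous_FTC2y _ _ (fun x => - s^-1 * expR (- (s * x))) 0 0)//.
  - by rewrite mulr0 oppr0 expR0 mulr1 -EFinB sub0r opprK.
  - by apply: continuous_in_subspaceT => x _; exact: continuous_expRN_scaled.
  - rewrite -[X in _ --> X](mulr0 (- s^-1)).
    by apply: cvgM; [exact: cvg_cst|exact: cvg_expRN_scaled].
  - by apply: cvg_at_right_filter; exact: (is_derive_continuous (dF 0)).
  - by move=> x _; rewrite derive1E; have -> := @derive_val _ _ _ _ _ _ _ (dF x).
split; last by rewrite /Rintegral E.
apply/integrableP; split.
  apply/measurable_EFinP/measurable_funTS; apply: continuous_measurable_fun.
  exact: continuous_expRN_scaled.
have -> : (\int[mu]_(x in `[0%R, +oo[) `|(EFin \o (fun x => expR (- (s * x)))%R) x| =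
   \int[mu]_(x in `[0%R, +oo[) (expR (- (s * x)))%:E)%E.
  by apply: eq_integral => x _; rewrite /= ger0_norm// expR_ge0.
by rewrite E ltry.
Qed.

Lemma measurable_expN_abs s : measurable_fun setT (fun x : R => expR (- (s * `|x|))).
Proof.
apply: measurableT_comp; first exact: measurable_expR.
by apply: measurableT_comp => //; apply: measurable_funM => //.
Qed.

Lemma integrable_expN_absM s g : 0 < s -> measurable_fun setT g ->
  (forall x, `|g x| <= 1) ->
  mu.-integrable setT (EFin \o (fun x => expR (- (s * `|x|)) * g x)).
Proof.
move=> s0 mg g1.
have ei : mu.-integrable setT (EFin \o (fun x => expR (- (s * `|x|)))).
  apply: (Rintegral_even _ _ _).1; first exact: measurable_expN_abs.
    have := (integral_expRN_scaled s0).1; apply: eq_integrable => //.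
    by move=> x /set_mem; rewrite /= in_itv/= andbT => x0; rewrite ger0_norm.
  by move=> x; rewrite normrN.
apply: le_integrable ei => //.
- by apply/measurable_EFinP; apply: measurable_funM => //; exact: measurable_expN_abs.
- move=> x _; rewrite /= lee_fin normrM ler_piMr//.
Qed.

Lemma integral_expRN_cos s t : 0 < s ->
  \int[mu]_(x in `[0, +oo[) (expR (- (s * x)) * cos (t * x)) = s / (s ^+ 2 + t ^+ 2).
Proof.
move=> s0.
have mcos := measurable_cos_scaled t.
have d0 : s ^+ 2 + t ^+ 2 != 0.
  by rewrite gt_eqF// ltr_pwDl ?exprn_gt0// sqr_ge0.
have fi : mu.-integrable `[0, +oo[
    (EFin \o (fun x => expR (- (s * x)) * cos (t * x))).
  have := integrable_expN_absM s0 mcos (fun x => cos_max (t * x)).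
  move=> h; have {}h : mu.-integrable `[0, +oo[
      (EFin \o (fun x => expR (- (s * `|x|)) * cos (t * x))) by apply: integrableS h.
  apply: eq_integrable h => // x /set_mem; rewrite /= in_itv/= andbT => x0.
  by rewrite ger0_norm.
(* The real part of the primitive e^((-s + it)x) / (-s + it). *)
pose G x := expR (- (s * x)) * ((t * sin (t * x) - s * cos (t * x)) / (s ^+ 2 + t ^+ 2)).
have dG x : is_derive x 1 G (expR (- (s * x)) * cos (t * x)).
  have dt : is_derive x 1 (fun x : R => t * x) t.
    have := is_deriveZ t (is_derive_id x 1).
    by move/is_derive_eq; apply; rewrite /GRing.scale/= mulr1.
  have ds := @is_derive1_comp _ sin (fun x : R => t * x) _ _ _ (is_derive_sin _) dt.
  have dc := @is_derive1_comp _ cos (fun x : R => t * x) _ _ _ (is_derive_cos _) dt.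
  have := is_deriveM (is_derive_expRN_scaled s x)
    (is_deriveM (is_deriveB (is_deriveZ t ds) (is_deriveZ s dc))
      (is_derive_cst (s ^+ 2 + t ^+ 2)^-1 x 1)).
  move/is_derive_eq; apply; rewrite /GRing.scale/= !fctE/= /GRing.scale/=; field.
  exact: d0.
have cn : (fun n : nat => n.+1%:R : R) @ \oo --> +oo.
  apply/cvgryPge => A; near=> n; apply: (@le_trans _ _ n%:R); last by rewrite ler_nat.
  by near: n; exact: nbhs_infty_ger.
have c1 := cvg_Rintegral_itv fi cn.
have c2 : G n.+1%:R - G 0 @[n --> \oo] --> (0 - G 0 : R).
  apply: cvgB; last exact: cvg_cst.
  apply: norm_cvg0.
  have h : expR (- (s * n.+1%:R)) * ((`|t| + `|s|) / (s ^+ 2 + t ^+ 2)) @[n --> \oo] --> (0 : R).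
    rewrite -[X in _ --> X](mul0r ((`|t| + `|s|) / (s ^+ 2 + t ^+ 2))).
    apply: cvgM; last exact: cvg_cst.
    exact: (cvg_comp _ _ cn (cvg_expRN_scaled s0)).
  apply: (@squeeze_cvgr _ _ _ _ (cst 0) _ _ _ _ _ h); last exact: cvg_cst.
  apply: nearW => n; rewrite normr_ge0/= /G normrM ger0_norm ?expR_ge0//.
  rewrite ler_wpM2l ?expR_ge0// normrM normfV.
  have p0 : 0 < s ^+ 2 + t ^+ 2 by rewrite ltr_pwDl ?exprn_gt0// sqr_ge0.
  rewrite (gtr0_norm p0) ler_pM2r ?invr_gt0//.
  apply: le_trans (ler_normB _ _) _; rewrite !normrM.
  by rewrite lerD// ler_piMr// ?sin_max ?cos_max.
have E n : \int[mu]_(x in `[0, n.+1%:R]) (expR (- (s * x)) * cos (t * x)) =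
    G n.+1%:R - G 0.
  apply: (@RFTC2 _ _ G) => //.
  move=> x _; apply: cvgM; first exact: continuous_expRN_scaled.
  exact: continuous_cos_scaled.
have c1' : G n.+1%:R - G 0 @[n --> \oo] -->
    \int[mu]_(x in `[0, +oo[) (expR (- (s * x)) * cos (t * x)).
  by under eq_fun do rewrite -E.
rewrite (cvg_unique _ c1' c2)// /G !mulr0 oppr0 expR0 sin0 cos0.
by field.
Unshelve. all: by end_near. Qed.

Lemma integral_expN_abs_cos s t : 0 < s ->
  \int[mu]_x (expR (- (s * `|x|)) * cos (t * x)) = 2 * (s / (s ^+ 2 + t ^+ 2)).
Proof.
move=> s0.
have mcos := measurable_cos_scaled t.
have gi := integrable_expN_absM s0 mcos (fun x => cos_max (t * x)).
have mg : measurable_fun setT (fun x => expR (- (s * `|x|)) * cos (t * x)).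
  by apply: measurable_funM => //; exact: measurable_expN_abs.
rewrite (Rintegral_even mg _ _).2.
- rewrite -(integral_expRN_cos t s0); congr (_ * _).
  by apply: eq_Rintegral => x /set_mem; rewrite /= in_itv/= andbT => x0; rewrite ger0_norm.
- exact: integrableS gi.
- by move=> x; rewrite normrN mulrN cosN.
Qed.

Lemma integral_expN_abs_sin s t : 0 < s ->
  \int[mu]_x (expR (- (s * `|x|)) * sin (t * x)) = 0.
Proof.
move=> s0.
have msin := measurable_sin_scaled t.
apply: Rintegral_odd.
- by apply: measurable_funM => //; exact: measurable_expN_abs.
- exact: integrable_expN_absM s0 msin (fun x => sin_max (t * x)).
- by move=> x; rewrite normrN mulrN sinN mulrN.
Qed.

(** Provides the uniform section bound for Fubini: the integral equals 2 for s != 0. The absolute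
    value of s makes it hold on the whole line. *)
Lemma integral_expN_abs_le s : (\int[mu]_x (`|s| * expR (- (`|s| * `|x|)))%:E <= 2%:E)%E.
Proof.
have [->|s0] := eqVneq s 0.
  rewrite (_ : (\int[mu]_x _ = 0)%E); first by rewrite lee_fin.
  by apply: integral0_eq => x _; rewrite normr0 mul0r.
have sp : 0 < `|s| by rewrite normr_gt0.
have E : (fun x => expR (- (`|s| * `|x|))) = (fun x => expR (- (`|s| * `|x|)) * cos (0 * x)).
  by apply/funext => x; rewrite mul0r cos0 mulr1.
have gi := integrable_expN_absM sp (measurable_cos_scaled 0) (fun x => cos_max (0 * x)).
have := integral_expN_abs_cos 0 sp; rewrite -E in gi *.
move=> I.
have -> : (\int[mu]_x (`|s| * expR (- (`|s| * `|x|)))%:E =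
    \int[mu]_x (`|s|%:E * (EFin \o (fun x => expR (- (`|s| * `|x|)))) x))%E.
  by apply: eq_integral => x _; rewrite EFinM.
rewrite integralZl// -(fineK (integrable_fin_num _ gi))// -EFinM lee_fin.
rewrite [fine _]I expr0n addr0 /=.
have -> : `|s| * (2 * (`|s| / `|s| ^+ 2)) = 2 by field; rewrite gt_eqF.
by [].
Qed.

End Exponential.

(** * The kernel as tempered inverse Fourier transform of the symbol *)

Section FourierTransform.
Context {R : realType}.
Local Open Scope complex_scope.
Notation mu := (@lebesgue_measure R).
Notation MR := (measurableTypeR R).
Implicit Types (g c : R -> R) (x s t : R).

Lemma Rintegral_eq0 (D : set MR) (f : R -> R) : (forall x, D x -> f x = 0) ->
  \int[mu]_(x in D) f x = 0.
Proof. by move=> f0; rewrite /Rintegral integral0_eq// => x Dx; rewrite f0. Qed.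

(** The Laplace integrand is split as ([sqrt_tan_neg s] / s) times s e^(-s|x|): the first factor is
    integrable, the second has L^1 norm 2 in x for every s > 0. This is the form that
    [Rfubini_kernel] requires. *)
Let b : R -> R := (fun s => sqrt_tan_neg s / s) \_ quarters.

Let integrable_b : mu.-integrable setT (EFin \o b).
Proof.
have mq := @measurable_quarters R.
have := (integrable_mkcond _ mq).1 (@integrable_sqrt_tan_negV R).
by congr (integrable _ _ _); apply/funext => s; rewrite /b /= !patchE; case: ifP.
Qed.

Let mkcond_b (h : R -> R) :
  \int[mu]_s (b s * h s) = \int[mu]_(s in quarters) (sqrt_tan_neg s / s * h s).
Proof.
rewrite [RHS]Rintegral_mkcond; apply: eq_Rintegral => s _.
by rewrite /b !patchE; case: ifP => // _; rewrite mul0r.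
Qed.

Let K : R -> R := whitham_kernel.

Lemma measurable_whitham_kernelM_dom (c : R -> R) : measurable_fun setT c ->
  measurable_fun setT (fun z : MR * MR => `|z.2| * expR (- (`|z.2| * `|z.1|)) * c z.1).
Proof.
move=> mc.
have m1 : measurable_fun setT (fun z : MR * MR => `|z.1| : R).
  exact: (measurableT_comp _ measurable_fst).
have m2 : measurable_fun setT (fun z : MR * MR => `|z.2| : R).
  exact: (measurableT_comp _ measurable_snd).
apply: measurable_funM; last exact: (measurableT_comp mc measurable_fst).
apply: measurable_funM => //; apply: measurableT_comp; first exact: measurable_expR.
by apply: measurableT_comp => //; apply: measurable_funM.
Qed.

Lemma laplace_fubini c : measurable_fun setT c -> (forall x, `|c x| <= 1) ->
  mu.-integrable setT (EFin \o (fun x => laplace 0 `|x| * c x)) /\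
  \int[mu]_x (laplace 0 `|x| * c x) =
  \int[mu]_(s in quarters) (sqrt_tan_neg s * \int[mu]_x (expR (- (s * `|x|)) * c x)).
Proof.
move=> mc c1.
pose k (z : MR * MR) : R := `|z.2| * expR (- (`|z.2| * `|z.1|)) * c z.1.
have kC s : (\int[mu]_x `|k (x, s)|%:E <= 2%:E)%E.
  apply: le_trans (integral_expN_abs_le s).
  have mk : measurable_fun (setT : set MR) (fun x => k (x, s)).
    by apply: measurableT_comp (measurable_whitham_kernelM_dom mc) _; apply: measurable_fun_pair.
  apply: ge0_le_integral => //.
  - by apply/measurable_EFinP; exact: measurableT_comp.
  - apply/measurable_EFinP; apply: measurable_funM => //.
    exact: measurable_expN_abs.
  - move=> x _; rewrite lee_fin /k normrM [X in X * _]ger0_norm ?mulr_ge0 ?expR_ge0//.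
    by rewrite ler_piMr ?mulr_ge0 ?expR_ge0.
have [ki kE] := Rfubini_kernel integrable_b (measurable_whitham_kernelM_dom mc) kC.
have mq := @measurable_quarters R.
have LE x : x != 0 -> laplace 0 `|x| * c x = \int[mu]_s (b s * k (x, s)).
  move=> x0; have xp : 0 < `|x| by rewrite normr_gt0.
  rewrite mkcond_b -RintegralZr//; last exact: integrable_laplace.
  apply: eq_Rintegral => s /set_mem /quarters_gt0 s0.
  rewrite /k/= expr0 mulr1 (gtr0_norm s0) (mulrC `|x|).
  by field; rewrite gt_eqF.
split; first exact: eq_neq0_integrable ki LE.
have mki : measurable_fun (setT : set R) (fun x => \int[mu]_s (b s * k (x, s))).
  by have /integrableP[/measurable_EFinP] := ki.
rewrite (eq_neq0_Rintegral mki LE) kE mkcond_b.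
apply: eq_Rintegral => s /set_mem /quarters_gt0 s0.
have -> : \int[mu]_x k (x, s) = s * \int[mu]_x (expR (- (s * `|x|)) * c x).
  rewrite -RintegralZl//; last exact: integrable_expN_absM.
  by apply: eq_Rintegral => x _; rewrite /k/= (gtr0_norm s0) mulrA.
by rewrite mulrA divfK// gt_eqF.
Qed.

Lemma whitham_kernel_fubini c : measurable_fun setT c -> (forall x, `|c x| <= 1) ->
  mu.-integrable setT (EFin \o (fun x => K x * c x)) /\
  \int[mu]_x (K x * c x) = pi^-1 *
  \int[mu]_(s in quarters) (sqrt_tan_neg s * \int[mu]_x (expR (- (s * `|x|)) * c x)).
Proof.
move=> mc c1; have [li lE] := laplace_fubini mc c1.
have iZ := integrable_scale pi^-1 measurableT li.
have KE x : x != 0 -> K x * c x = pi^-1 * (laplace 0 `|x| * c x).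
  by move=> x0; rewrite /K whitham_kernelE// mulrA.
split; first exact: eq_neq0_integrable iZ KE.
have mZ : measurable_fun (setT : set R) (fun x => pi^-1 * (laplace 0 `|x| * c x)).
  by have /integrableP[/measurable_EFinP] := iZ.
by rewrite (eq_neq0_Rintegral mZ KE) RintegralZl// lE.
Qed.

Lemma integrable_whitham_kernel : mu.-integrable setT (EFin \o K).
Proof.
have mc : measurable_fun setT (cst 1 : R -> R) by [].
have c1 (x : R) : `|(cst 1 : R -> R) x| <= 1 by rewrite /= normr1.
have [+ _] := whitham_kernel_fubini mc c1.
by congr (integrable _ _ _); apply/funext => x; rewrite /= mulr1.
Qed.

Lemma measurable_whitham_kernel : measurable_fun (setT : set R) K.
Proof. by have /integrableP[/measurable_EFinP] := integrable_whitham_kernel. Qed.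

(** Transforming e^(-s|x|) under the integral produces exactly the Stieltjes integral of the symbol
    at |t|, which was obtained for positive arguments. *)
Lemma whitham_kernel_cos t : t != 0 ->
  \int[mu]_x (K x * cos (t * x)) = whitham_symbol t.
Proof.
move=> t0; have tp : 0 < `|t| by rewrite normr_gt0.
have [_ ->] := whitham_kernel_fubini (measurable_cos_scaled t) (fun x => cos_max (t * x)).
have [_ S] := stieltjes_symbol tp.
have -> : \int[mu]_(s in quarters)
    (sqrt_tan_neg s * \int[mu]_x (expR (- (s * `|x|)) * cos (t * x))) =
  \int[mu]_(s in quarters) (2 * sqrt_tan_neg s * (s / (s ^+ 2 + `|t| ^+ 2))).
  apply: eq_Rintegral => s /set_mem /quarters_gt0 s0.
  by rewrite integral_expN_abs_cos// real_normK ?num_real//; ring.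
rewrite S mulrA mulVf ?mul1r ?gt_eqF ?pi_gt0//.
by have [_|_] := ger0P t; rewrite ?whitham_symbolN.
Qed.

Lemma whitham_kernel_sin t : \int[mu]_x (K x * sin (t * x)) = 0.
Proof.
have [_ ->] := whitham_kernel_fubini (measurable_sin_scaled t) (fun x => sin_max (t * x)).
rewrite Rintegral_eq0 ?mulr0// => s /quarters_gt0 s0.
by rewrite integral_expN_abs_sin// mulr0.
Qed.

(** Fubini once more: the sections of K(x) c(x, t) have L^1 norm at most that of K, which is
    integrable. *)
Lemma whitham_kernel_pairing g (c : MR * MR -> R) : mu.-integrable setT (EFin \o g) ->
  measurable_fun setT c -> (forall z, `|c z| <= 1) ->
  mu.-integrable setT (EFin \o (fun x => K x * \int[mu]_t (g t * c (x, t)))) /\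
  \int[mu]_x (K x * \int[mu]_t (g t * c (x, t))) =
  \int[mu]_t (g t * \int[mu]_x (K x * c (x, t))).
Proof.
move=> gi mc c1.
have mg : measurable_fun (setT : set MR) g.
  by have /integrableP[/measurable_EFinP] := gi.
have mK := measurable_whitham_kernel.
have Ki := integrable_whitham_kernel.
pose k (z : MR * MR) : R := K z.1 * c z.
have mk : measurable_fun setT k.
  by apply: measurable_funM => //; exact: (measurableT_comp mK measurable_fst).
have aKi : mu.-integrable setT (abse \o (EFin \o K)) by exact: integrable_abse.
have mc1 (t : MR) : measurable_fun (setT : set MR) (fun x => c (x, t)).
  by apply: measurableT_comp mc _; exact: measurable_fun_pair.
have mc2 (x : MR) : measurable_fun (setT : set MR) (fun t => c (x, t)).
  by apply: measurableT_comp mc _; exact: measurable_fun_pair.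
have kC (t : MR) : (\int[mu]_x `|k (x, t)|%:E <= (\int[mu]_x `|K x|)%:E)%E.
  rewrite fineK; last exact: (integrable_fin_num measurableT aKi).
  apply: ge0_le_integral => //.
  - apply/measurable_EFinP; apply: measurableT_comp => //.
    exact: measurable_funM.
  - by apply/measurable_EFinP; exact: measurableT_comp.
  - by move=> x _; rewrite lee_fin /k normrM ler_piMr.
have [ki kE] := Rfubini_kernel gi mk kC.
have E x : \int[mu]_t (g t * k (x, t)) = K x * \int[mu]_t (g t * c (x, t)).
  rewrite -RintegralZl//.
    by apply: eq_Rintegral => t _; rewrite /k/= mulrCA.
  apply: le_integrable gi => //.
    by apply/measurable_EFinP; exact: measurable_funM.
  by move=> t _; rewrite /= lee_fin normrM ler_piMr.
rewrite -kE; split; last by apply: eq_Rintegral => x _; rewrite E.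
by move: ki; congr (integrable _ _ _); apply/funext => x; rewrite /= E.
Qed.

Let measurable_cosM : measurable_fun setT (fun z : MR * MR => cos (z.2 * z.1) : R).
Proof.
apply: measurableT_comp; first exact: measurable_cos.
by apply: measurable_funM; [exact: measurable_snd|exact: measurable_fst].
Qed.

Let measurable_sinM : measurable_fun setT (fun z : MR * MR => sin (z.2 * z.1) : R).
Proof.
apply: measurableT_comp; first exact: measurable_sin.
by apply: measurable_funM; [exact: measurable_snd|exact: measurable_fst].
Qed.

Lemma whitham_kernel_pairing_cos g : mu.-integrable setT (EFin \o g) ->
  mu.-integrable setT (EFin \o (fun x => K x * \int[mu]_t (g t * cos (t * x)))) /\
  \int[mu]_x (K x * \int[mu]_t (g t * cos (t * x))) =
  \int[mu]_t (whitham_symbol t * g t).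
Proof.
move=> gi.
have mg : measurable_fun (setT : set R) g.
  by have /integrableP[/measurable_EFinP] := gi.
have [ci ->] := whitham_kernel_pairing gi measurable_cosM (fun z => cos_max (z.2 * z.1)).
split; first exact: ci.
apply: eq_neq0_Rintegral.
  by apply: measurable_funM => //; exact: measurable_whitham_symbol.
by move=> t t0; rewrite whitham_kernel_cos// mulrC.
Qed.

Lemma whitham_kernel_pairing_sin g : mu.-integrable setT (EFin \o g) ->
  mu.-integrable setT (EFin \o (fun x => K x * \int[mu]_t (g t * sin (t * x)))) /\
  \int[mu]_x (K x * \int[mu]_t (g t * sin (t * x))) = 0.
Proof.
move=> gi.
have [ci ->] := whitham_kernel_pairing gi measurable_sinM (fun z => sin_max (z.2 * z.1)).
split; first exact: ci.
by apply: Rintegral_eq0 => t _; rewrite [X in _ * X]whitham_kernel_sin mulr0.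
Qed.

(** Bounds on |g| and x^2 |g| together give |g| <= (C0 + C2) / (1 + x^2). *)
Lemma real_schwartz_bounded g : real_schwartz g ->
  [/\ mu.-integrable setT (EFin \o g), measurable_fun (setT : set R) g &
      exists C : R, forall x, `|g x| <= C].
Proof.
move=> [dg bg].
have [C0 H0] := bg 0%N 0%N; have [C2 H2] := bg 2%N 0%N.
have mg : measurable_fun (setT : set R) g.
  apply: continuous_measurable_fun => x.
  by apply/differentiable_continuous/derivable1_diffP; exact: (dg 0%N x).
have gb x : `|g x| <= C0 by have := H0 x; rewrite derive1n0 expr0 mul1r.
split => //; last by exists C0.
have ci : mu.-integrable setT (EFin \o (fun x => (1 + (x - 0) ^+ 2)^-1)).
  apply: (Rintegral_even _ _ _).1.
  - apply: (measurableT_comp measurable_invr); apply: measurable_funD => //.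
    by apply: measurable_funX; apply: measurable_funB.
  - exact: integrable_cauchy_kernel.
  - by move=> x; rewrite !subr0 sqrrN.
have cZ := integrable_scale (C0 + C2) measurableT ci.
apply: le_integrable cZ => //; first exact/measurable_EFinP.
move=> x _; rewrite /= lee_fin; apply: le_trans (ler_norm _).
have p0 : 0 < 1 + x ^+ 2 by rewrite ltr_pwDl// sqr_ge0.
rewrite subr0 ler_pdivlMr// mulrDr mulr1 lerD// mulrC.
by have := H2 x; rewrite derive1n0 real_normK ?num_real.
Qed.

(** Splitting into real and imaginary parts leaves pairings of K with cosine and sine transforms;
    the sine ones vanish because K is even. *)
Lemma whitham_kernel_tempered :
  tempered_inverse_fourier (@whitham_kernel R) (@whitham_symbol R).
Proof.
have KM g : real_schwartz g -> mu.-integrable setT (EFin \o (fun x => K x * g x)).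
  move=> /real_schwartz_bounded[_ mg [C HC]].
  have iZ := integrable_scale C measurableT integrable_whitham_kernel.
  apply: le_integrable iZ => //.
  - by apply/measurable_EFinP; apply: measurable_funM => //; exact: measurable_whitham_kernel.
  - move=> x _; rewrite /= lee_fin !normrM mulrC ler_wpM2r//.
    by apply: le_trans (HC x) _; exact: ler_norm.
split.
  move=> phi [sr si]; split.
    have := KM _ sr; congr (integrable _ _ _); apply/funext => x.
    by rewrite Re_mulc/= mul0r subr0.
  have := KM _ si; congr (integrable _ _ _); apply/funext => x.
  by rewrite Im_mulc/= mul0r addr0.
move=> phi [sr si].
set p := fun x => Re (phi x) in sr; set q := fun x => Im (phi x) in si.
have [pi_ mp _] := real_schwartz_bounded sr.
have [qi mq _] := real_schwartz_bounded si.
have iM (g h : R -> R) : mu.-integrable setT (EFin \o g) -> measurable_fun setT h ->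
    (forall x, `|h x| <= 1) -> mu.-integrable setT (EFin \o (fun t => g t * h t)).
  move=> gi mh h1.
  have mg : measurable_fun (setT : set R) g.
    by have /integrableP[/measurable_EFinP] := gi.
  apply: le_integrable gi => //.
    by apply/measurable_EFinP; exact: measurable_funM.
  by move=> t _; rewrite /= lee_fin normrM ler_piMr.
have mc x : measurable_fun setT (fun t : R => cos (t * x)).
  by under eq_fun do rewrite mulrC; exact: measurable_cos_scaled.
have ms x : measurable_fun setT (fun t : R => sin (t * x)).
  by under eq_fun do rewrite mulrC; exact: measurable_sin_scaled.
have ReF x : Re (fourier phi x) =
    \int[mu]_t (p t * cos (t * x)) + \int[mu]_t (q t * sin (t * x)).
  rewrite /fourier /Cintegral/= -RintegralD//; last 2 first.
  - exact: iM (mc x) (fun t => cos_max (t * x)).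
  - exact: iM (ms x) (fun t => sin_max (t * x)).
  by apply: eq_Rintegral => t _; rewrite Re_mulc /cis/= cosN sinN mulrN opprK.
have ImF x : Im (fourier phi x) =
    \int[mu]_t (q t * cos (t * x)) - \int[mu]_t (p t * sin (t * x)).
  rewrite /fourier /Cintegral/= -RintegralB//; last 2 first.
  - exact: iM (mc x) (fun t => cos_max (t * x)).
  - exact: iM (ms x) (fun t => sin_max (t * x)).
  apply: eq_Rintegral => t _; rewrite Im_mulc /cis/= cosN sinN -/(p t) -/(q t).
  by ring.
have [c1 e1] := whitham_kernel_pairing_cos pi_.
have [c2 e2] := whitham_kernel_pairing_sin qi.
have [c3 e3] := whitham_kernel_pairing_cos qi.
have [c4 e4] := whitham_kernel_pairing_sin pi_.
rewrite /Cintegral; congr (_ +i* _).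
  have -> : \int[mu]_x Re ((whitham_kernel x)%:C * fourier phi x) =
      \int[mu]_x (K x * (\int[mu]_t (p t * cos (t * x))) +
                  K x * (\int[mu]_t (q t * sin (t * x)))).
    by apply: eq_Rintegral => x _; rewrite Re_mulc ReF/= mul0r subr0 mulrDr.
  rewrite RintegralD// e1 e2 addr0.
  by apply: eq_Rintegral => t _; rewrite Re_mulc/= mul0r subr0.
have -> : \int[mu]_x Im ((whitham_kernel x)%:C * fourier phi x) =
    \int[mu]_x (K x * (\int[mu]_t (q t * cos (t * x))) -
                K x * (\int[mu]_t (p t * sin (t * x)))).
  by apply: eq_Rintegral => x _; rewrite Im_mulc ImF/= mul0r addr0 mulrBr.
rewrite RintegralB// e3 e4 subr0.
by apply: eq_Rintegral => t _; rewrite Im_mulc/= mul0r addr0.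
Qed.

End FourierTransform.

(** * Measures given by a density *)

Section Density.
Context d (T : measurableType d) (R : realType).
Implicit Types (mu nu : {measure set T -> \bar R}) (f : T -> R).
Local Open Scope ereal_scope.
Import HBNNSimple.

Lemma exists_density mu f : measurable_fun setT f -> (forall x, (0 <= f x)%R) ->
  exists nu : {measure set T -> \bar R},
    forall A, measurable A -> nu A = \int[mu]_(x in A) (f x)%:E.
Proof.
move=> mf f0.
pose m A := \int[mu]_(x in A) (f x)%:E.
have m0 : m set0 = 0 by rewrite /m integral_set0.
have m_ge0 A : 0 <= m A by apply: integral_ge0 => x _; rewrite lee_fin.
have m_sa : semi_sigma_additive m.
  move=> F mF tF mUF; rewrite /m ge0_integral_bigcup//; last 2 first.
  - by apply/measurable_EFinP/measurable_funTS.
  - by move=> x _; rewrite lee_fin.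
  by apply: is_cvg_nneseries => n _ _; exact: m_ge0.
pose mm := isMeasure.Build _ _ _ m m0 m_ge0 m_sa.
pose nu : {measure set T -> \bar R} := HB.pack m mm.
by exists nu.
Qed.

(** [nu] is known through its values on measurable sets, which settles simple functions; monotone
    convergence does the rest. *)
Lemma integral_density mu nu f : measurable_fun setT f -> (forall x, (0 <= f x)%R) ->
  (forall A, measurable A -> nu A = \int[mu]_(x in A) (f x)%:E) ->
  forall (D : set T) (g : T -> \bar R), measurable D -> measurable_fun D g ->
  (forall x, D x -> 0 <= g x) ->
  \int[nu]_(x in D) g x = \int[mu]_(x in D) (g x * (f x)%:E).
Proof.
move=> mf f0 nuE D g mD mg g0.
have mfE : measurable_fun D (EFin \o f) by apply/measurable_EFinP/measurable_funTS.
pose g_ := nnsfun_approx mD mg.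
have gc x : D x -> (g_ n x)%:E @[n --> \oo] --> g x.
  by move=> Dx; exact: cvg_nnsfun_approx.
have gnd x m n : (m <= n)%N -> (g_ m x <= g_ n x)%R.
  by move=> mn; exact/lefP/nd_nnsfun_approx.
have mgE n : measurable_fun D (fun x => (g_ n x)%:E).
  by apply/measurable_EFinP/measurable_funTS.
have mpre n r : measurable (g_ n @^-1` [set r]) by [].
have mind n r : measurable_fun D (fun x => (r * \1_(g_ n @^-1` [set r]) x)%:E).
  by apply/measurable_EFinP/measurable_funM => //; exact: measurable_indic.
have step n : \int[nu]_(x in D) (g_ n x)%:E = \int[mu]_(x in D) ((g_ n x)%:E * (f x)%:E).
  transitivity (\sum_(k \in range (g_ n)) (k%:E * nu ((g_ n @^-1` [set k]) `&` D))).
    under eq_integral do rewrite fimfunE -fsumEFin//.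
    rewrite ge0_integral_fsum//; last 2 first.
    - by move=> r; exact: mind.
    - by move=> r x _; rewrite EFinM nnfun_muleindic_ge0.
    by apply: eq_fsbigr => r _; rewrite integralZl_indic_nnsfun// integral_indic.
  transitivity (\sum_(k \in range (g_ n))
      \int[mu]_(x in D) ((k * \1_(g_ n @^-1` [set k]) x)%:E * (f x)%:E)).
    apply: eq_fsbigr => r /set_mem [y _ yr].
    have r0 : (0 <= r)%R by rewrite -yr.
    transitivity (\int[mu]_(x in D) (r%:E * ((\1_(g_ n @^-1` [set r]) x)%:E * (f x)%:E))).
      rewrite ge0_integralZl_EFin//; last 2 first.
      - by move=> x _; rewrite mule_ge0// lee_fin.
      - apply: emeasurable_funM => //; apply/measurable_EFinP.
        exact: measurable_indic.
      rewrite nuE; last exact: measurableI.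
      congr (_ * _); rewrite setIC integral_mkcondr; apply: eq_integral => x _.
      by rewrite patchE indicE; case: ifP; rewrite ?mul1e ?mul0e.
    by apply: eq_integral => x _; rewrite EFinM muleA.
  rewrite -ge0_integral_fsum//; last 2 first.
  - by move=> r; exact: emeasurable_funM.
  - by move=> r x _; rewrite mule_ge0 ?lee_fin// -lee_fin EFinM nnfun_muleindic_ge0.
  apply: eq_integral => x _.
  rewrite -ge0_mule_fsuml; last by move=> r; rewrite EFinM nnfun_muleindic_ge0.
  by rewrite fsumEFin// -fimfunE.
transitivity (limn (fun n => \int[nu]_(x in D) (g_ n x)%:E)).
  rewrite -monotone_convergence//.
  - by apply: eq_integral => x /set_mem Dx; apply/esym/cvg_lim => //; exact: gc.
  - by move=> n x _; rewrite lee_fin.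
  - by move=> x _ m n mn; rewrite lee_fin gnd.
rewrite (_ : (fun n => _) = (fun n => \int[mu]_(x in D) ((g_ n x)%:E * (f x)%:E))); last first.
  by apply/funext => n; exact: step.
rewrite -monotone_convergence//.
- apply: eq_integral => x /set_mem Dx; apply/cvg_lim => //.
  by apply: cvgeZr => //; exact: gc.
- by move=> n; exact: emeasurable_funM.
- by move=> n x _; rewrite mule_ge0// lee_fin.
- by move=> x _ m n mn; rewrite lee_wpmul2r ?lee_fin ?gnd.
Qed.

End Density.

(** * The substitution t = s^2 on the half-line *)

Section SquareSubstitution.
Context {R : realType}.
Notation mu := (@lebesgue_measure R).
Notation MR := (measurableTypeR R).
Implicit Types (x s a b : R).

(** The odd extension of s^2 is increasing on the whole line, so preimages of intervals ]a, b] are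
    again such intervals, and it is differentiable with derivative 2 |s| even at 0. *)
Definition signed_sqr s : R := s * `|s|.

Definition signed_sqrt x : R := if 0 <= x then Num.sqrt x else - Num.sqrt (- x).

Lemma signed_sqrtK : cancel signed_sqrt signed_sqr.
Proof.
move=> x; rewrite /signed_sqrt /signed_sqr; case: ifPn => x0.
  by rewrite ger0_norm ?sqrtr_ge0// -expr2 sqr_sqrtr.
have xp : 0 <= - x by rewrite oppr_ge0 ltW// ltNge.
by rewrite normrN ger0_norm ?sqrtr_ge0// mulNr -expr2 sqr_sqrtr// opprK.
Qed.

Lemma signed_sqr_homo : {homo signed_sqr : x y / x < y}.
Proof.
move=> x y xy; rewrite /signed_sqr.
by have [x0|x0] := ger0P x; have [y0|y0] := ger0P y; nra.
Qed.

Lemma signed_sqr_le : {mono signed_sqr : x y / x <= y}.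
Proof. exact: le_mono signed_sqr_homo. Qed.

Lemma signed_sqr_lt : {mono signed_sqr : x y / x < y}.
Proof. exact: leW_mono signed_sqr_le. Qed.

Lemma is_derive_signed_sqr s : is_derive s 1 signed_sqr (2 * `|s|).
Proof.
have dsq : is_derive s 1 (fun s => s * s) (2 * s).
  have := is_deriveM (is_derive_id s 1) (is_derive_id s 1).
  by move/is_derive_eq; apply; rewrite /GRing.scale/=; ring.
have [s0|s0|->] := ltgtP s 0.
- have [d v] := is_deriveN dsq.
  have N : \forall y \near s, (- (fun s => s * s : R)) y = signed_sqr y.
    have : \forall y \near s, y < 0 by apply: open_nbhs_nbhs; split => //; exact: open_lt.
    by apply: filterS => y y0; rewrite /signed_sqr ltr0_norm// mulrN.
  apply: DeriveDef.
    exact: near_eq_derivable N d.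
  by rewrite -(near_eq_derive _ N) v ltr0_norm// mulrN.
- have N : \forall y \near s, (y * y : R) = signed_sqr y.
    have : \forall y \near s, 0 < y by apply: open_nbhs_nbhs; split => //; exact: open_gt.
    by apply: filterS => y y0; rewrite /signed_sqr gtr0_norm.
  have [d v] := dsq; apply: DeriveDef.
    exact: near_eq_derivable N d.
  by rewrite -(near_eq_derive _ N) v gtr0_norm.
have h : (fun h : R => h^-1 *: ((signed_sqr \o shift 0) (h *: 1) - signed_sqr 0)) @ 0^' --> (0 : R).
  have n0 : (fun h : R => `|h|) @ 0^' --> (0 : R).
    rewrite -[X in _ --> X](normr0 R); apply: cvg_norm.
    by rewrite /dnbhs; apply: cvg_within_filter; exact: cvg_id.
  apply: cvg_trans n0; apply: near_eq_cvg; near=> y.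
  have y0 : y != 0 by near: y; exact: nbhs_dnbhs_neq.
  by rewrite /signed_sqr /GRing.scale/= mulr1 addr0 mul0r subr0 mulKf.
rewrite normr0 mulr0; apply: DeriveDef; first by apply/cvg_ex; exists 0; exact: h.
exact/cvg_lim.
Unshelve. all: by end_near. Qed.

(** Lebesgue measure is the image under [signed_sqr] of the measure with density 2 |s|: the two
    agree on intervals ]a, b] by the fundamental theorem, hence everywhere by uniqueness. *)
Lemma ge0_integral_sqr (F : R -> \bar R) : measurable_fun setT F ->
  (forall x, (0 <= F x)%E) ->
  (\int[mu]_(x in `]0%R, +oo[) F x =
   \int[mu]_(s in `]0%R, +oo[) (F (s ^+ 2)%R * (2 * s)%:E))%E.
Proof.
move=> mF F0.
pose phi : MR -> MR := signed_sqr.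
have mphi : measurable_fun setT phi.
  apply: continuous_measurable_fun => s.
  exact: (is_derive_continuous (is_derive_signed_sqr s)).
have md : measurable_fun (setT : set MR) (fun s : R => 2 * `|s|).
  by apply: measurable_funM => //; exact: measurableT_comp.
have d0 (s : MR) : 0 <= 2 * `|s| by rewrite mulr_ge0.
have [rho rhoE] := exists_density mu md d0.
have cd : continuous (fun s : R => 2 * `|s|).
  by move=> s; apply: cvgM; [exact: cvg_cst|apply: cvg_norm; exact: cvg_id].
have phiE a b : phi @^-1` `]a, b]%classic = `]signed_sqrt a, signed_sqrt b]%classic.
  apply/seteqP; split => s /=; rewrite /phi !in_itv/=.
    by rewrite -{1}[a]signed_sqrtK -{1}[b]signed_sqrtK signed_sqr_lt signed_sqr_le.
  by rewrite -{2}[a]signed_sqrtK -{2}[b]signed_sqrtK signed_sqr_lt signed_sqr_le.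
have pushE (A : set MR) : measurable A -> mu A = pushforward rho phi A.
  move=> mA; apply: lebesgue_measure_unique => //= _ [[a b]] _ <-.
  rewrite /pushforward/=; have [ab|ba] := ltP a b; last first.
    by rewrite set_itv_ge ?bnd_simp -?leNgt// preimage_set0 !measure0.
  rewrite phiE rhoE//.
  have ab' : signed_sqrt a < signed_sqrt b by rewrite -signed_sqr_lt !signed_sqrtK.
  rewrite integral_itv_obnd_cbnd; last by apply/measurable_EFinP/measurable_funTS.
  have ci : mu.-integrable `[signed_sqrt a, signed_sqrt b] (EFin \o (fun s : R => 2 * `|s|)).
    by apply: continuous_integrable_itv => s _; exact: cd.
  have mJ : measurable (`[signed_sqrt a, signed_sqrt b]%classic : set MR).
    exact: measurable_itv.
  rewrite -(fineK (integrable_fin_num mJ ci)).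
  have -> : fine (\int[mu]_(s in `[signed_sqrt a, signed_sqrt b]) (EFin \o (fun s : R => 2 * `|s|)%R) s)%E =
      b - a.
    rewrite -[in RHS](signed_sqrtK a) -[in RHS](signed_sqrtK b).
    apply: (@RFTC2 R (fun s => 2 * `|s|) signed_sqr) => //.
    - by move=> s _; exact: is_derive_signed_sqr.
    - by move=> s _; exact: cd.
  by rewrite lebesgue_measure_itv/= lte_fin ab EFinB.
have mI : measurable (`]0%R, +oo[%classic : set MR) by exact: measurable_itv.
have phiI : phi @^-1` `]0, +oo[%classic = `]0, +oo[%classic.
  apply/seteqP; split => s /=; rewrite /phi !in_itv/= !andbT.
    by rewrite -{1}(mul0r `|0 : R|) signed_sqr_lt.
  by rewrite -{2}(mul0r `|0 : R|) signed_sqr_lt.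
have -> : (\int[mu]_(x in `]0%R, +oo[) F x = \int[pushforward rho phi]_(x in `]0%R, +oo[) F x)%E.
  by apply: eq_measure_integral => // A mA _; exact: pushE.
rewrite (@ge0_integral_pushforward _ _ _ _ R phi mphi rho _ F mI)//; last first.
  exact: measurable_funTS.
rewrite phiI (integral_density md d0 rhoE mI
  (measurable_funTS (measurableT_comp mF mphi)) (fun s _ => F0 (phi s))).
apply: eq_integral => s /set_mem; rewrite /= in_itv/= andbT => s0.
by rewrite /phi /signed_sqr/= gtr0_norm.
Qed.

End SquareSubstitution.

(** * The tangent series and the measures sigma and mu *)

Section TangentSeries.
Context {R : realType}.
Notation mu := (@lebesgue_measure R).
Notation MR := (measurableTypeR R).
Implicit Types (s t x : R).

(** The series starts at n = 1, so its interval for n = k + 1 is the one of index 2k + 1, where tan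
    is negative. *)
Lemma quarter_odd (k : nat) :
  `](2 * k.+1%:R - 1) * pi / 2, k.+1%:R * pi[%classic = quarter (k.*2.+1) :> set R.
Proof.
have k2 : k.*2%:R = 2 * k%:R :> R by rewrite -mul2n natrM.
have -> : (2 * k.+1%:R - 1) * pi / 2 = k.*2.+1%:R * (pi / 2) :> R.
  by rewrite -(natr1 k.*2) -(natr1 k) k2; field.
have -> : k.+1%:R * pi = k.*2.+2%:R * (pi / 2) :> R.
  by rewrite -(natr1 k.*2.+1) -(natr1 k.*2) -(natr1 k) k2; field.
by [].
Qed.

Lemma quarter_tan (n : nat) s : quarter n s ->
  exists2 c : R, 0 < c & tan s / s = (-1) ^+ n * c.
Proof.
move=> qs; have qqs : quarters s by exists n.
have s0 := quarters_gt0 qqs; have c0 := quarters_cos_neq0 qqs.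
exists ((-1) ^+ n * (sin s * cos s) / (cos s ^+ 2 * s)).
  apply: divr_gt0; first by move: qs; rewrite quarterE => /sign_sincos.
  by rewrite mulr_gt0// exprn_even_gt0.
rewrite mulrA signrMK /tan; field.
by rewrite c0 gt_eqF.
Qed.

Lemma sqrt_tan_neg_odd (k : nat) s : quarter k.*2.+1 s ->
  sqrt_tan_neg s = Num.sqrt (`|tan s| / s).
Proof.
move=> qs; have qqs : quarters s by exists k.*2.+1.
have s0 := quarters_gt0 qqs; have [c c0 E] := quarter_tan qs.
rewrite /sqrt_tan_neg -[X in `|_| / X](gtr0_norm s0) -normf_div E.
by rewrite exprS -mul2n exprM sqrrN expr1n expr1n mulr1 mulN1r opprK normrN gtr0_norm.
Qed.

Lemma sqrt_tan_neg_even (k : nat) s : quarter k.*2 s -> sqrt_tan_neg s = 0.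
Proof.
move=> qs; have [c c0 E] := quarter_tan qs.
apply/eqP; rewrite /sqrt_tan_neg E -mul2n exprM sqrrN expr1n expr1n mul1r.
by rewrite sqrtr_eq0 oppr_le0 ltW.
Qed.

Lemma sincos_pihalf (j : nat) : sin (j%:R * (pi / 2)) * cos (j%:R * (pi / 2)) = 0 :> R.
Proof.
elim: j => [|j IHj]; first by rewrite mul0r sin0 mul0r.
rewrite -natr1 mulrDl mul1r sinDpihalf cosDpihalf mulrN mulrC.
by rewrite IHj oppr0.
Qed.

(** Holds at every point, not just almost everywhere: at a multiple of pi/2 either sin is 0, or cos
    is 0 and its inverse is 0 by convention. *)
Lemma sqrt_tan_neg_supp s : 0 <= s -> sqrt_tan_neg s != 0 ->
  exists k : nat, quarter k.*2.+1 s.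
Proof.
move=> s0 n0.
have sp : 0 < s.
  rewrite lt_def s0 andbT; apply: contraNneq n0 => ->.
  by rewrite /sqrt_tan_neg invr0 mulr0 oppr0 sqrtr0.
have : `]0, +oo[%classic s by rewrite /= in_itv/= sp.
rewrite quartersE => -[[n _ qs]|[[j _ js] _]]; last first.
  move: n0; rewrite -js /sqrt_tan_neg /tan.
  have := sincos_pihalf j; move/eqP; rewrite mulf_eq0 => /orP[]/eqP ->.
    by rewrite !mul0r oppr0 sqrtr0 eqxx.
  by rewrite invr0 mulr0 mul0r oppr0 sqrtr0 eqxx.
exists n./2; have := odd_double_half n; case on : (odd n) => /=.
  by rewrite add1n => ->.
rewrite add0n => nE; move: qs; rewrite -nE => /sqrt_tan_neg_even E.
by rewrite E eqxx in n0.
Qed.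

Lemma sqrt_tan_neg_series s : 0 <= s ->
  (\sum_(1 <= n <oo) (Num.sqrt (`|tan s| / s) *
    \1_(`](2 * n%:R - 1) * pi / 2, n%:R * pi[%classic : set R) s)%:E =
   (sqrt_tan_neg s)%:E)%E.
Proof.
move=> s0.
pose f (n : nat) : R := Num.sqrt (`|tan s| / s) *
  \1_(`](2 * n%:R - 1) * pi / 2, n%:R * pi[%classic : set R) s.
have fE n : f (n + 1)%N = if s \in quarter n.*2.+1 then sqrt_tan_neg s else 0.
  rewrite /f addn1 quarter_odd indicE; case: ifPn => [qs|_] /=.
    by rewrite mulr1 (sqrt_tan_neg_odd (set_mem qs)).
  by rewrite mulr0.
have f0 n : (0 <= (f n)%:E)%E by rewrite lee_fin mulr_ge0// sqrtr_ge0.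
rewrite -(@nneseries_addn _ (fun n => (f n)%:E) 1)//.
have [n0|n0] := eqVneq (sqrt_tan_neg s) 0.
  rewrite n0; apply: eseries0 => n _ _; rewrite fE n0.
  by case: ifP.
have [k qk] := sqrt_tan_neg_supp s0 n0.
rewrite (@nneseriesD1 _ (fun i => (f (i + 1)%N)%:E) k xpredT)//.
rewrite fE mem_set// eseries0 ?adde0// => n _ /= nk.
rewrite fE; case: ifPn => // /set_mem qn.
have /trivIsetP/(_ _ _ I I) := @trivIset_quarters R.
move=> /(_ n.*2.+1 k.*2.+1).
have nk' : n.*2.+1 != k.*2.+1.
  by apply: contraNneq nk => -[] /double_inj ->.
by move=> /(_ nk') /seteqP[/(_ s (conj qn qk))].
Qed.

Lemma sigma_densityE t : sigma_density t = (pi^-1 * sqrt_tan_neg (Num.sqrt t))%:E.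
Proof.
rewrite /sigma_density EFinM; congr (_ * _)%E.
rewrite -(sqrt_tan_neg_series (sqrtr_ge0 t)).
(* Membership in the squared interval must be matched for every real [t]; for t <= 0, where
   [Num.sqrt t] is 0, both sides of this equality are false. *)
have s2 a : 0 <= a -> (a < Num.sqrt t) = (a ^+ 2 < t).
  move=> a0; have [t0|t0] := ltP 0 t.
    by rewrite -[a in LHS]ger0_norm// -sqrtr_sqr ltr_sqrt.
  rewrite (eqP (_ : Num.sqrt t == 0)) ?sqrtr_eq0//.
  by rewrite !ltNge a0 (le_trans t0 (sqr_ge0 a)).
have s3 a : 0 < a -> (Num.sqrt t < a) = (t < a ^+ 2).
  by move=> a0; rewrite -[a in LHS]gtr0_norm// -sqrtr_sqr ltr_sqrt// exprn_gt0.
rewrite -[LHS]nneseries_addn; last by move=> n; rewrite lee_fin mulr_ge0// sqrtr_ge0.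
rewrite -[RHS]nneseries_addn; last by move=> n; rewrite lee_fin mulr_ge0// sqrtr_ge0.
apply: eq_eseriesr => n _; congr (_ * _)%:E; rewrite !indicE; congr (nat_of_bool _)%:R.
rewrite addn1.
have p0 := pi_gt0 R.
have a0 : 0 <= (2 * n.+1%:R - 1) * pi / 2 :> R.
  rewrite !mulr_ge0 ?invr_ge0 ?(ltW p0)// subr_ge0 -natrM ler1n muln_gt0//.
have b0 : 0 < n.+1%:R * pi :> R by rewrite mulr_gt0.
by apply/idP/idP => /set_mem/=; rewrite !in_itv/= => H; apply/mem_set;
  move: H; rewrite /= in_itv/= s2// s3.
Qed.

Lemma integral_laplace0 x : 0 < x ->
  (\int[mu]_(s in `]0%R, +oo[) (sqrt_tan_neg s * expR (- (s * x)))%:E =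
   (laplace 0 x)%:E)%E.
Proof.
move=> x0.
have mq := @measurable_quarters R.
have E : (fun s => sqrt_tan_neg s * expR (- (s * x))) =
    (fun s => sqrt_tan_neg s * s ^+ 0 * expR (- (x * s))).
  by apply/funext => s; rewrite expr0 mulr1 (mulrC s).
have li := integrable_laplace 0 x0; rewrite -E in li.
have ml := measurable_laplace_integrand 0 x; rewrite -E in ml.
have mlE : measurable_fun (setT : set MR) (EFin \o (fun s => sqrt_tan_neg s * expR (- (s * x)))).
  exact/measurable_EFinP.
rewrite integral_itv_obnd_cbnd; last exact: measurable_funTS.
rewrite integral_quartersE; last exact/(integrable_quartersP mlE).
rewrite -(fineK (integrable_fin_num mq li)); congr (_%:E).
rewrite /laplace; apply: eq_Rintegral => s _.
by rewrite expr0 mulr1 (mulrC s).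
Qed.

Lemma laplace_series x : 0 < x ->
  (\sum_(1 <= n <oo) \int[mu]_(s in
     (`]((2 * n%:R - 1) * pi / 2)%R, (n%:R * pi)%R[%classic : set R))
     (expR (- (s * x)) * Num.sqrt (`|tan s| / s))%:E = (laplace 0 x)%:E)%E.
Proof.
move=> x0.
rewrite -nneseries_addn; last first.
  by move=> n; apply: integral_ge0 => s _; rewrite lee_fin mulr_ge0 ?expR_ge0 ?sqrtr_ge0.
pose g s := sqrt_tan_neg s * s ^+ 0 * expR (- (x * s)).
have mg := measurable_laplace_integrand 0 x.
transitivity (\sum_(n <oo) \int[mu]_(s in quarter n.*2.+1) (g s)%:E)%E.
  apply: eq_eseriesr => n _; rewrite addn1 quarter_odd.
  apply: eq_integral => s /set_mem qs.
  by rewrite /g expr0 mulr1 (sqrt_tan_neg_odd qs) mulrC (mulrC s).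
have g0 s : (0 <= (g s)%:E)%E.
  rewrite lee_fin /g expr0 mulr1 mulr_ge0 ?expR_ge0//; exact: sqrt_tan_neg_ge0.
rewrite -ge0_integral_bigcup//; last 3 first.
- by move=> n; exact: measurable_quarter.
- by apply/measurable_EFinP/measurable_funTS.
- apply/trivIsetP => m n _ _ mn; have /trivIsetP := @trivIset_quarters R; apply => //.
  by apply: contraNneq mn => -[] /double_inj ->.
have mq := @measurable_quarters R.
have -> : (laplace 0 x)%:E = (\int[mu]_(s in quarters) (g s)%:E)%E.
  rewrite /laplace /Rintegral fineK//.
  exact: (integrable_fin_num mq (integrable_laplace 0 x0)).
rewrite integral_mkcond.
rewrite [RHS]integral_mkcond; apply: eq_integral => s _; rewrite !patchE.
case: ifPn => [/set_mem[n _ qs]|n1]; case: ifPn => [/set_mem qs'|n2] //.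
  by case/negP: n2; apply: mem_set; exists n.*2.+1.
have [n0|n0] := eqVneq (sqrt_tan_neg s) 0; first by rewrite /g n0 !mul0r.
have [k qk] := sqrt_tan_neg_supp (ltW (quarters_gt0 qs')) n0.
by case/negP: n1; apply: mem_set; exists k.
Qed.

Lemma exists_pushforward d1 d2 (T1 : measurableType d1) (T2 : measurableType d2)
  (m : {measure set T1 -> \bar R}) (f : T1 -> T2) : measurable_fun setT f ->
  exists nu : {measure set T2 -> \bar R}, forall A, nu A = pushforward m f A.
Proof.
move=> mf.
by unshelve eexists (pushforward m f : {measure set T2 -> \bar R}).
Qed.

Lemma integrable_sqrt_tan_negV_itv (c : R) :
  (\int[mu]_(s in `]0%R, +oo[) (c * (sqrt_tan_neg s / s))%:E < +oo)%E.
Proof.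
have mI : measurable (`[0%R, +oo[%classic : set MR) by exact: measurable_itv.
have mi : measurable_fun (setT : set MR) (EFin \o (fun s => c * (sqrt_tan_neg s / s))).
  apply/measurable_EFinP; apply: measurable_funM => //; apply: measurable_funM.
    exact: measurable_sqrt_tan_neg.
  exact: measurable_invr.
have ii := (integrable_quartersP mi).2 (integrable_laplace_dom c).
rewrite integral_itv_obnd_cbnd; last exact: measurable_funTS.
exact: (integrable_lty mI ii).
Qed.

(** Substituting t = s^2 turns the density of sigma into (2s / pi) [sqrt_tan_neg s] for its
    pushforward; the factor 1/(2s) cancels the Jacobian, so mu has density [sqrt_tan_neg s] / pi and
    its Laplace transform is the kernel. *)
Lemma exists_whitham_measures :
  exists sigma nu : {measure set MR -> \bar R},
     sigma (~` `]0, +oo[) = 0%E /\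
     (\int[sigma]_(t in `]0%R, +oo[) (t^-1)%:E < +oo)%E /\
     sigma `<< lebesgue_measure /\
     (forall A : set MR, measurable A ->
        sigma A = (\int[lebesgue_measure]_(t in A) sigma_density t)%E) /\
     (forall A : set MR, measurable A ->
        nu A = (\int[pushforward sigma (Num.sqrt : MR -> MR)]_(
                  s in A `&` `]0%R, +oo[) ((2 * s)^-1)%:E)%E) /\
     (forall x : R, x != 0 -> (whitham_kernel x)%:E =
        (\int[nu]_(s in `]0%R, +oo[) (expR (- (s * `|x|)))%:E)%E).
Proof.
pose f t : R := pi^-1 * sqrt_tan_neg (Num.sqrt t).
have p0 := pi_gt0 R.
have mf : measurable_fun (setT : set MR) f.
  apply: measurable_funM => //.
  exact: (measurableT_comp measurable_sqrt_tan_neg measurable_sqrtr).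
have f0 (t : MR) : 0 <= f t by rewrite mulr_ge0 ?invr_ge0 ?(ltW p0)// sqrt_tan_neg_ge0.
have f_npos t : t <= 0 -> f t = 0.
  move=> t0; rewrite /f ler0_sqrtr// /sqrt_tan_neg invr0 mulr0 oppr0 sqrtr0.
  by rewrite mulr0.
have f_sqr s : 0 < s -> f (s ^+ 2) = pi^-1 * sqrt_tan_neg s.
  by move=> s0; rewrite /f sqrtr_sqr gtr0_norm.
have [sigma sE] := exists_density mu mf f0.
pose sq : MR -> MR := Num.sqrt.
have msq : measurable_fun setT sq by exact: measurable_sqrtr.
have [tau tauE] := exists_pushforward sigma msq.
have mI : measurable (`]0%R, +oo[%classic : set MR) by exact: measurable_itv.
(* The weight 1/(2s) is cut off to be nonnegative on the whole line, as a density must be; this is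
   also where the intersection with (0, +oo) in the formula for mu comes from. *)
pose h : MR -> R := (fun s => (2 * s)^-1) \_ `]0, +oo[.
have mh : measurable_fun setT h.
  apply/(measurable_restrictT _ mI); apply: measurable_funTS.
  apply: (measurableT_comp measurable_invr); exact: measurable_funM.
have h0 s : 0 <= h s.
  rewrite /h patchE; case: ifPn => // /set_mem; rewrite /= in_itv/= andbT => s0.
  by rewrite invr_ge0 mulr_ge0// ltW.
have [nu nE] := exists_density tau mh h0.
exists sigma, nu; split; [|split; [|split; [|split; [|split]]]].
- rewrite sE; last exact: measurableC.
  apply: integral0_eq => t /=; rewrite in_itv/= andbT => /negP; rewrite -leNgt => t0.
  by rewrite f_npos.
- rewrite (integral_density mf f0 sE)//; last 2 first.
  + apply/measurable_EFinP/measurable_funTS; exact: measurable_invr.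
  + by move=> t /=; rewrite in_itv/= andbT => t0; rewrite lee_fin invr_ge0 ltW.
  (* The square substitution asks for a function that is nonnegative on the whole line, hence the
     absolute value. It leads to 2/pi times the integral of [sqrt_tan_neg s] / s, already known to
     be finite. *)
  pose F (t : R) : \bar R := (`|t^-1| * f t)%:E.
  have mF : measurable_fun setT F.
    apply/measurable_EFinP; apply: measurable_funM => //.
    by apply: measurableT_comp => //; exact: measurable_invr.
  have F0 t : (0 <= F t)%E by rewrite lee_fin mulr_ge0// f0.
  have -> : (\int[mu]_(t in `]0%R, +oo[) ((t^-1)%:E * (f t)%:E) =
      \int[mu]_(t in `]0%R, +oo[) F t)%E.
    apply: eq_integral => t /set_mem; rewrite /= in_itv/= andbT => t0.
    by rewrite /F gtr0_norm ?invr_gt0// EFinM.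
  rewrite ge0_integral_sqr//.
  have -> : (\int[mu]_(s in `]0%R, +oo[) (F (s ^+ 2)%R * (2 * s)%:E) =
      \int[mu]_(s in `]0%R, +oo[) (2 / pi * (sqrt_tan_neg s / s))%:E)%E.
    apply: eq_integral => s /set_mem; rewrite /= in_itv/= andbT => s0.
    rewrite /F -EFinM f_sqr// gtr0_norm ?invr_gt0 ?exprn_gt0//; congr (_%:E).
    have sn : (s : R) != 0 by rewrite gt_eqF.
    have pn : (pi : R) != 0 by rewrite gt_eqF.
    by move: (pi : R) (sqrt_tan_neg s) pn => p q pn; field; rewrite sn pn.
  exact: integrable_sqrt_tan_negV_itv.
- apply/null_content_dominatesP => A mA A0; rewrite sE//.
  have := @integral_abs_eq0 _ _ _ mu A (EFin \o f) mA _ A0.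
  have -> : (\int[mu]_(x in A) `|(EFin \o f) x| = \int[mu]_(x in A) (f x)%:E)%E.
    by apply: eq_integral => t _; rewrite /= ger0_norm.
  by apply; apply/measurable_EFinP/measurable_funTS.
- by move=> A mA; rewrite sE//; apply: eq_integral => t _; rewrite sigma_densityE.
- move=> A mA; rewrite nE// integral_mkcondr.
  have -> : (\int[tau]_(x in A) (h x)%:E =
      \int[pushforward sigma (Num.sqrt : MR -> MR)]_(x in A) (h x)%:E)%E.
    by apply: eq_measure_integral => // B mB _; exact: tauE.
  by apply: eq_integral => s _; rewrite /h !patchE; case: ifP.
- move=> x x0; have xp : 0 < `|x| by rewrite normr_gt0.
  pose e s : R := expR (- (s * `|x|)).
  have me : measurable_fun (setT : set MR) e.
    apply: measurableT_comp; first exact: measurable_expR.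
    by apply: measurableT_comp => //; exact: measurable_funM.
  rewrite (integral_density mh h0 nE)//; last by apply/measurable_EFinP/measurable_funTS.
  pose G (s : R) : \bar R := (e s * h s)%:E.
  have mG : measurable_fun (setT : set MR) G.
    by apply/measurable_EFinP; exact: measurable_funM.
  have G0 s : (0 <= G s)%E by rewrite lee_fin mulr_ge0 ?expR_ge0.
  have -> : (\int[tau]_(s in `]0%R, +oo[) ((e s)%:E * (h s)%:E) =
      \int[pushforward sigma sq]_(s in `]0%R, +oo[) G s)%E.
    transitivity (\int[tau]_(s in `]0%R, +oo[) G s)%E.
      by apply: eq_integral => s _; rewrite /G EFinM.
    by apply: eq_measure_integral => // B mB _; exact: tauE.
  rewrite (@ge0_integral_pushforward _ _ _ _ R sq msq sigma _ G mI)//; last first.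
    exact: measurable_funTS.
  have sqI : sq @^-1` `]0, +oo[%classic = `]0, +oo[%classic.
    by apply/seteqP; split => s /=; rewrite /sq !in_itv/= !andbT sqrtr_gt0.
  have mGs : measurable_fun setT (G \o sq) by exact: measurableT_comp msq.
  rewrite sqI (integral_density mf f0 sE mI (measurable_funTS mGs) (fun s _ => G0 (sq s))).
  pose F (t : R) : \bar R := (G (sq t) * (f t)%:E)%E.
  have mF : measurable_fun setT F.
    by apply: emeasurable_funM => //; exact/measurable_EFinP.
  have F0 t : (0 <= F t)%E by rewrite mule_ge0// lee_fin f0.
  rewrite (@ge0_integral_sqr R F mF F0).
  have -> : (\int[mu]_(s in `]0%R, +oo[) (F (s ^+ 2)%R * (2 * s)%:E) =
      \int[mu]_(s in `]0%R, +oo[) ((pi^-1)%:E * (sqrt_tan_neg s * expR (- (s * `|x|)))%:E))%E.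
    apply: eq_integral => s /set_mem; rewrite /= in_itv/= andbT => s0.
    rewrite /F /G /sq f_sqr// sqrtr_sqr gtr0_norm// -!EFinM; congr (_%:E).
    rewrite /h patchE mem_set/= ?in_itv/= ?s0// /e.
    by move: (pi^-1 : R) => q; field; rewrite gt_eqF.
  rewrite ge0_integralZl_EFin ?invr_ge0 ?(ltW p0)//; last 2 first.
  + by move=> s _; rewrite lee_fin mulr_ge0 ?expR_ge0// sqrt_tan_neg_ge0.
  + apply/measurable_EFinP/measurable_funTS; apply: measurable_funM => //.
    exact: measurable_sqrt_tan_neg.
  by rewrite integral_laplace0// -EFinM whitham_kernelE.
Qed.

End TangentSeries.

Theorem proposition2p23 (R : realType) :
  (forall x : R, x != 0 ->
     ((fun ab : R * R => complex.Re (truncated_kernel ab.1 ab.2 x)) @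
        filter_prod (pinfty_nbhs R) (pinfty_nbhs R) --> whitham_kernel x) /\
     ((fun ab : R * R => complex.Im (truncated_kernel ab.1 ab.2 x)) @
        filter_prod (pinfty_nbhs R) (pinfty_nbhs R) --> (0 : R))) /\
  tempered_inverse_fourier (@whitham_kernel R) (@whitham_symbol R) /\
  (exists sigma mu : {measure set (measurableTypeR R) -> \bar R},
     sigma (~` `]0, +oo[) = 0%E /\
     (\int[sigma]_(t in `]0%R, +oo[) (t^-1)%:E < +oo)%E /\
     sigma `<< lebesgue_measure /\
     (forall A : set (measurableTypeR R), measurable A ->
        sigma A = (\int[lebesgue_measure]_(t in A) sigma_density t)%E) /\
     (forall A : set (measurableTypeR R), measurable A ->
        mu A = (\int[pushforward sigma
                       (Num.sqrt : measurableTypeR R -> measurableTypeR R)]_(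
                  s in A `&` `]0%R, +oo[) ((2 * s)^-1)%:E)%E) /\
     (forall x : R, x != 0 ->
        (whitham_kernel x)%:E =
        (\int[mu]_(s in `]0%R, +oo[) (expR (- (s * `|x|)))%:E)%E)) /\
  (forall x : R, x != 0 ->
     (whitham_kernel x)%:E =
     ((pi^-1)%:E * \sum_(1 <= n <oo)
        \int[lebesgue_measure]_(
            s in (`]((2 * n%:R - 1) * pi / 2)%R, (n%:R * pi)%R[%classic : set R))
          (expR (- (s * `|x|)) * Num.sqrt (`|tan s| / s))%:E)%E) /\
  completely_monotone (@whitham_kernel R) /\
  (forall x : R, 0 < x -> 0 < whitham_kernel x) /\
  strictly_decreasing_pos (@whitham_kernel R) /\
  strictly_convex_pos (@whitham_kernel R).
Proof.
split; [|split; [|split; [|split; [|split; [|split; [|split]]]]]].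
- move=> x x0; rewrite whitham_kernelE//.
  by split; [exact: cvg_Re_truncated_kernel|exact: cvg_Im_truncated_kernel].
- exact: whitham_kernel_tempered.
- exact: exists_whitham_measures.
- move=> x x0; have xp : 0 < `|x| by rewrite normr_gt0.
  by rewrite laplace_series// -EFinM whitham_kernelE.
- exact: completely_monotone_whitham_kernel.
- exact: whitham_kernel_gt0.
- exact: whitham_kernel_decreasing.
- exact: whitham_kernel_convex.
Qed.
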